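(* Let $(M,g)$ be a complete Riemannian $G$-manifold, let $\bar p\bar q$ be a minimal geodesic segment of length $d$ in the orbit space $M/G$ connecting $\bar p$ and $\bar q$, and let $pq$ be a horizontal lift of it to $M$, with end points $p\in\bar p$ and $q\in\bar q$. Then for every interior point $x$ of $pq$ the stabilizer $G_x$ is contained in the stabilizers $G_p$ and $G_q$ of the end points.
   Context: A complete Riemannian $G$-manifold is a connected complete Riemannian manifold $(M,g)$ together with a Lie group $G$ of isometries acting properly on $M$; $\pi:M\to M/G$ is the projection. For two orbits $\bar p,\bar q\in M/G$, the distance between $\bar p$ and $\bar q$ is the minimum of the lengths of all curves in $M$ connecting the orbits $\bar p$ and $\bar q$; this makes $M/G$ a metric space. A minimal geodesic segment in $M/G$ is a curve connecting two points whose length equals the distance between them. A geodesic in $M$ is called normal if it is orthogonal to every orbit it meets. A horizontal lift of a minimal geodesic segment in $M/G$ is a normal geodesic segment $\gamma$ in $M$ such that $\pi(\gamma)$ is the given minimal geodesic segment. $G_x=\{g\in G: g.x=x\}$. *)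

(* Defs.v *)
From HB Require Import structures.
From mathcomp Require Import all_boot all_order all_algebra.
From mathcomp Require Import all_classical all_reals all_analysis.

Set Implicit Arguments.
Unset Strict Implicit.
Unset Printing Implicit Defensive.

Import Order.TTheory GRing.Theory Num.Theory.
Import numFieldNormedType.Exports.

Local Open Scope classical_set_scope.
Local Open Scope ring_scope.

(** * Smooth functions on an open subset of a finite-dimensional normed space *)

(* For V of finite dimension and U open, C^(k+1) on U amounts to being
   differentiable on U with all directional derivatives C^k on U. *)
Fixpoint Ck (R : realType) (V W : normedModType R) (k : nat) (U : set V)
    (f : V -> W) : Prop :=
  match k with
  | 0%N => forall x, U x -> {for x, continuous f}
  | k'.+1 => (forall x, U x -> differentiable f x) /\
             (forall v : V, Ck k' U (fun x => 'D_v f x))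
  end.

Definition smooth_on (R : realType) (V W : normedModType R) (U : set V)
    (f : V -> W) : Prop := forall k, Ck k U f.

(** * Smooth manifolds *)

(* A homeomorphism from an open subset of M onto an open subset of R^n;
   chart_fun and chart_inv are only meaningful on chart_dom and on its image. *)
Record chart (R : realType) (n : nat) (M : topologicalType) := Chart {
  chart_dom : set M ;
  chart_fun :> M -> 'rV[R]_n ;
  chart_inv : 'rV[R]_n -> M ;
  chart_open : open chart_dom ;
  chart_img_open : open (chart_fun @` chart_dom) ;
  chart_funK : forall x, chart_dom x -> chart_inv (chart_fun x) = x ;
  chart_continuous : forall x, chart_dom x -> {for x, continuous chart_fun} ;
  chart_inv_continuous : forall y, (chart_fun @` chart_dom) y ->
    {for y, continuous chart_inv}
}.

Definition chart_img (R : realType) (n : nat) (M : topologicalType)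
    (phi : chart R n M) : set 'rV[R]_n := phi @` chart_dom phi.

(* chart_at x is a chosen chart around x: the tangent space at x is identified
   with R^n by means of the coordinates of chart_at x. *)
HB.mixin Record isManifold (R : realType) (n : nat) M of Topological M := {
  atlas : set (chart R n M) ;
  chart_at : M -> chart R n M ;
  chart_at_atlas : forall x, atlas (chart_at x) ;
  chart_at_dom : forall x, chart_dom (chart_at x) x ;
  atlas_smooth : forall phi psi, atlas phi -> atlas psi ->
    smooth_on (phi @` (chart_dom phi `&` chart_dom psi))
              (psi \o chart_inv phi) ;
  manifold_hausdorff : hausdorff_space M ;
  manifold_second_countable : @second_countable M
}.

#[short(type="manifoldType")]
HB.structure Definition Manifold (R : realType) (n : nat) :=
  { M of isManifold R n M & Topological M }.

Definition smooth_map (R : realType) (m n : nat) (M : manifoldType R m)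
    (N : manifoldType R n) (f : M -> N) : Prop :=
  continuous f /\
  forall (phi : chart R m M) (psi : chart R n N), atlas phi -> atlas psi ->
    smooth_on (phi @` (chart_dom phi `&` f @^-1` chart_dom psi))
              (psi \o f \o chart_inv phi).

(* Smoothness of f : M1 x M2 -> N, read in the product charts of M1 x M2,
   whose coordinates are the row vectors row_mx (phi1 x1) (phi2 x2). *)
Definition smooth_map2 (R : realType) (m1 m2 n : nat) (M1 : manifoldType R m1)
    (M2 : manifoldType R m2) (N : manifoldType R n) (f : M1 -> M2 -> N) : Prop :=
  continuous (fun x : M1 * M2 => f x.1 x.2) /\
  forall (phi1 : chart R m1 M1) (phi2 : chart R m2 M2) (psi : chart R n N),
    atlas phi1 -> atlas phi2 -> atlas psi ->
    smooth_on
      [set row_mx (phi1 x.1) (phi2 x.2) | x in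
         [set x : M1 * M2 | [/\ chart_dom phi1 x.1, chart_dom phi2 x.2 &
                                chart_dom psi (f x.1 x.2)]]]
      (fun y : 'rV[R]_(m1 + m2) =>
         psi (f (chart_inv phi1 (lsubmx y)) (chart_inv phi2 (rsubmx y)))).

(* The differential of f at x, in the coordinates chart_at x, chart_at (f x). *)
Definition tangent_map (R : realType) (m n : nat) (M : manifoldType R m)
    (N : manifoldType R n) (f : M -> N) (x : M) : 'rV[R]_m -> 'rV[R]_n :=
  'd (chart_at (f x) \o f \o chart_inv (chart_at x)) (chart_at x x).

(* U is meant to be an open subset of R. *)
Definition smooth_curve (R : realType) (n : nat) (M : manifoldType R n)
    (U : set R) (c : R -> M) : Prop :=
  (forall t, U t -> {for t, continuous c}) /\
  forall phi : chart R n M, atlas phi ->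
    smooth_on (U `&` c @^-1` chart_dom phi) (phi \o c : R -> 'rV[R]_n).

(* The velocity c'(t), in the coordinates chart_at (c t). *)
Definition velocity (R : realType) (n : nat) (M : manifoldType R n)
    (c : R -> M) (t : R) : 'rV[R]_n :=
  derive1 (chart_at (c t) \o c : R -> 'rV[R]_n) t.

(** * Lie groups *)

HB.mixin Record isLieGroup (R : realType) (k : nat) G
    of Manifold R k G & Group G := {
  lie_mul_smooth : smooth_map2 (fun g h : G => (g * h)%g) ;
  lie_inv_smooth : smooth_map (fun g : G => (g^-1)%g)
}.

#[short(type="lieGroupType")]
HB.structure Definition LieGroup (R : realType) (k : nat) :=
  { G of isLieGroup R k G & Manifold R k G & Group G }.

(** * Riemannian manifolds *)

Definition bilin (R : realType) (n : nat) (A : 'M[R]_n) (u v : 'rV[R]_n) : R :=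
  (u *m A *m v^T) 0 0.

(* gram phi y is the matrix (g_ij) of the metric in the chart phi, at the point
   of coordinates y; gram_change says that these matrices represent the same
   bilinear form on the tangent space. *)
HB.mixin Record isRiemannian (R : realType) (n : nat) M of Manifold R n M := {
  gram : chart R n M -> 'rV[R]_n -> 'M[R]_n ;
  gram_smooth : forall phi, atlas phi -> smooth_on (chart_img phi) (gram phi) ;
  gram_sym : forall phi y, atlas phi -> chart_img phi y ->
    (gram phi y)^T = gram phi y ;
  gram_pos : forall phi y v, atlas phi -> chart_img phi y -> v != 0 ->
    0 < bilin (gram phi y) v v ;
  gram_change : forall phi psi x, atlas phi -> atlas psi ->
    chart_dom phi x -> chart_dom psi x ->
    let D := 'd (psi \o chart_inv phi) (phi x) in
    forall u v, bilin (gram phi (phi x)) u v =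
                bilin (gram psi (psi x)) (D u) (D v)
}.

#[short(type="riemannianType")]
HB.structure Definition Riemannian (R : realType) (n : nat) :=
  { M of isRiemannian R n M & Manifold R n M }.

Section Riemannian_geometry.
Context (R : realType) (n : nat) (M : riemannianType R n).
Implicit Types (c : R -> M) (phi : chart R n M).

(* Tangent vectors at x are given in the coordinates chart_at x. *)
Definition inner (x : M) (u v : 'rV[R]_n) : R :=
  bilin (gram (chart_at x) (chart_at x x)) u v.

Definition speed c (t : R) : R :=
  Num.sqrt (inner (c t) (velocity c t) (velocity c t)).

(* The velocity need not exist at the finitely many break points of a piecewise
   smooth curve; they do not contribute to the integral. *)
Definition curve_length c (a b : R) : R :=
  (\int[lebesgue_measure]_(t in `[a, b]) speed c t)%R.

Definition smooth_segment c (a b : R) : Prop :=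
  exists (c' : R -> M) (e : R),
    [/\ 0 < e, smooth_curve `]a - e, b + e[ c' & {in `[a, b], c =1 c'}].

Definition piecewise_smooth c (a b : R) : Prop :=
  exists2 s : seq R, itv_partition a b s &
    forall i, (i < size s)%N ->
      smooth_segment c (nth b (a :: s) i) (nth b (a :: s) i.+1).

Definition set_dist (A B : set M) : R :=
  inf [set l | exists (c : R -> M) (a b : R),
    [/\ a < b, piecewise_smooth c a b, A (c a), B (c b) &
        l = curve_length c a b]].

Definition riemannian_dist (x y : M) : R := set_dist [set x] [set y].

Definition complete_riemannian : Prop :=
  forall u : nat -> M,
    (forall e : R, 0 < e -> exists N, forall i j, (N <= i)%N -> (N <= j)%N ->
       riemannian_dist (u i) (u j) < e) ->
    exists l : M, forall e : R, 0 < e -> exists N, forall i, (N <= i)%N ->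
       riemannian_dist (u i) l < e.

(* dgram phi y i j l is d g_jl / d x_i at y *)
Definition dgram phi (y : 'rV[R]_n) (i j l : 'I_n) : R :=
  'D_(delta_mx 0 i) (fun z : 'rV[R]_n => gram phi z j l) y.

(* The Christoffel symbol Gamma^k_ij of the Levi-Civita connection. *)
Definition christoffel phi (y : 'rV[R]_n) (k i j : 'I_n) : R :=
  2^-1 * \sum_(l < n) invmx (gram phi y) k l *
    (dgram phi y i j l + dgram phi y j i l - dgram phi y l i j).

(* Constant curves are geodesics with this definition. *)
Definition geodesic (U : set R) c : Prop :=
  smooth_curve U c /\
  forall phi t, atlas phi -> U t -> chart_dom phi (c t) ->
    let x (k : 'I_n) : R -> R := fun s => phi (c s) 0 k in
    forall k, derive1 (derive1 (x k)) t +
      \sum_(i < n) \sum_(j < n) christoffel phi (phi (c t)) k i j *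
        derive1 (x i) t * derive1 (x j) t = 0.

(* A geodesic segment is the restriction to [a, b] of a geodesic defined on a
   neighbourhood of [a, b]. *)
Definition geodesic_segment c (a b : R) : Prop :=
  exists2 e : R, 0 < e & geodesic `]a - e, b + e[ c.

(* The tangent space at x of a submanifold S of M. *)
Definition tangent_to (S : set M) (x : M) : set 'rV[R]_n :=
  [set w | exists (c : R -> M) (e : R),
    [/\ 0 < e, smooth_curve `]- e, e[ c,
        forall t, t \in `]- e, e[ -> S (c t), c 0 = x & w = velocity c 0]].

Definition riemannian_isometry (f : M -> M) : Prop :=
  [/\ bijective f, smooth_map f &
      forall x u v,
        inner (f x) (tangent_map f x u) (tangent_map f x v) = inner x u v].

End Riemannian_geometry.

Arguments complete_riemannian {R n} M.

(** * Riemannian G-manifolds and their orbit spaces *)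

Section G_manifold.
Context (R : realType) (n k : nat) (M : riemannianType R n)
  (G : lieGroupType R k) (act : G -> M -> M).

Definition proper_action : Prop :=
  forall K : set (M * M), compact K ->
    compact [set gx : G * M | K (act gx.1 gx.2, gx.2)].

Record complete_riemannian_G_manifold : Prop := {
  Gmfd_connected : connected [set: M] ;
  Gmfd_complete : complete_riemannian M ;
  Gmfd_act1 : forall x, act 1%g x = x ;
  Gmfd_actM : forall g h x, act (g * h)%g x = act g (act h x) ;
  Gmfd_smooth : smooth_map2 act ;
  Gmfd_isometry : forall g, riemannian_isometry (act g) ;
  Gmfd_proper : proper_action
}.

Definition stabilizer (x : M) : set G := [set g | act g x = x].

Definition Gorbit (x : M) : set M := [set act g x | g in [set: G]].

Definition orbit_space : Type := {O : set M | exists x, O = Gorbit x}.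

Definition orbit_proj (x : M) : orbit_space :=
  exist _ (Gorbit x) (ex_intro _ x erefl).

Definition orbit_dist (p q : orbit_space) : R := set_dist (sval p) (sval q).

Definition orbit_continuous (sigma : R -> orbit_space) (a b : R) : Prop :=
  forall t, t \in `[a, b] -> forall e : R, 0 < e ->
    exists2 delta : R, 0 < delta & forall s, s \in `[a, b] ->
      `|s - t| < delta -> orbit_dist (sigma s) (sigma t) < e.

(* The length of a curve in the metric space M/G: the supremum of the lengths
   of the inscribed polygons. *)
Definition orbit_length (sigma : R -> orbit_space) (a b : R) : \bar R :=
  ereal_sup [set (\sum_(0 <= i < size s)
                    orbit_dist (sigma (nth b (a :: s) i))
                               (sigma (nth b (a :: s) i.+1)))%:E
            | s in itv_partition a b].

Definition minimal_geodesic_segment (sigma : R -> orbit_space) (a b : R)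
    (p q : orbit_space) : Prop :=
  [/\ a < b, orbit_continuous sigma a b, sigma a = p, sigma b = q &
      orbit_length sigma a b = (orbit_dist p q)%:E].

Definition normal_on (gamma : R -> M) (a b : R) : Prop :=
  forall t, t \in `[a, b] -> forall w,
    tangent_to (Gorbit (gamma t)) (gamma t) w ->
    inner (gamma t) (velocity gamma t) w = 0.

Definition horizontal_lift (gamma : R -> M) (sigma : R -> orbit_space)
    (a b : R) : Prop :=
  [/\ geodesic_segment gamma a b, normal_on gamma a b &
      forall t, t \in `[a, b] -> orbit_proj (gamma t) = sigma t].

End G_manifold.

(* Main.v *)
(* Let x = gamma t and let v be the velocity of gamma at x. By minimality and
   the triangle inequality in M/G, the orbits of gamma (t - h), x, gamma (t + h)
   satisfy the equality case of the triangle inequality. For g in G_x the same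
   holds after replacing gamma (t + h) by g gamma (t + h). The velocity is
   normal to the orbit of x, so both halves of the broken path have length
   asymptotic to h |v|; if g v were different from v, the segment in a chart
   from gamma (t - h) to g gamma (t + h) would be shorter to first order. Hence
   g v = v, so that the geodesics gamma and g gamma coincide and g fixes gamma.

   The lower bound for the distance from gamma (t + h) to the orbit of x needs
   that points y of the orbit near x satisfy <v, y - x> = o(|y - x|), that is,
   y = g x with |g - 1| = O(|y - x|). Otherwise, by properness, elements g
   moving x much less than their distance from 1 accumulate at 1, and their
   powers yield elements of G_x which cancel these g to first order. *)

From HB Require Import structures.
Require Import Defs.
From mathcomp Require Import all_boot all_order all_algebra.
From mathcomp Require Import all_classical all_reals all_analysis.
From mathcomp Require Import measurable_realfun.
From mathcomp Require Import ring lra.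

Set Implicit Arguments.
Unset Strict Implicit.
Unset Printing Implicit Defensive.

Import Order.TTheory GRing.Theory Num.Theory.
Import numFieldNormedType.Exports.

Local Open Scope classical_set_scope.
Local Open Scope ring_scope.

(** * Differential calculus *)

(** Normality is a condition on velocities of curves inside an orbit, whereas a bound for the
    distance to the orbit involves all its points near x. Bridging this gap is the main labour: it
    rests on strict differentiability of the product at (1, 1) and of the action at (1, x), with
    powers g^m in the role of one-parameter subgroups. Distances are infima, so each comparison uses
    nearly minimal curves and carries an error e; only first-order statements at x survive. Lengths
    are bounded below by integrating a linear functional of the coordinates (a calibration) and
    above by coordinate segments. That equal initial data force two geodesics to coincide is derived
    from the Euler-Lagrange form of the equation, tested against arbitrary vectors: this form is
    carried along by isometries, and testing it on the second derivative of the difference of two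
    solutions gives a Gronwall estimate. The corner argument needs gamma (t - h) and gamma (t + h)
    on the segment, hence an interior t. The end points are reached afterwards, because a geodesic
    segment extends to a neighbourhood of [a, b]. *)

Section Differentiability.
Context {R : realType}.
Implicit Types V W : normedModType R.

Lemma differentiable_approx V W (f : V -> W) x : differentiable f x ->
  forall e : R, 0 < e ->
  \forall y \near x, `|f y - f x - 'd f x (y - x)| <= e * `|y - x|.
Proof.
move=> /diff_locallyP[_ /eqaddoP fx] e e0.
rewrite [\forall y \near x, _](near_shift 0) subr0.
apply: filterS (fx _ e0) => y /=; rewrite !fctE /= /shift /= addrK.
by rewrite opprD addrA.
Qed.

Lemma approx_differentiable V W (f : V -> W) x (L : {linear V -> W}) :
  continuous L ->
  (forall e : R, 0 < e ->
    \forall y \near x, `|f y - f x - L (y - x)| <= e * `|y - x|) ->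
  differentiable f x /\ 'd f x = L :> (V -> W).
Proof.
move=> Lc fL.
have fo : f \o shift x = cst (f x) + L +o_ 0 id.
  apply/eqaddoP => e e0; have := fL _ e0.
  rewrite [\forall y \near x, _](near_shift 0) subr0.
  by apply: filterS => y /=; rewrite !fctE /= /shift /= addrK opprD addrA.
have dfL : 'd f x = L :> (V -> W) by exact: diff_unique.
by split => //; apply/diff_locallyP; rewrite dfL.
Qed.

Lemma near_eq_differentiable V W (f g : V -> W) x :
  {near x, f =1 g} -> differentiable f x -> differentiable g x.
Proof.
move=> fg fx.
have [] // := @approx_differentiable V W g x ('d f x).
  exact: diff_continuous.
move=> e e0; have := differentiable_approx fx e0.
have fgx := nbhs_singleton fg.
by apply: filterS2 fg => y /= -> ; rewrite fgx.
Qed.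

Lemma coord_le_norm m n (u : 'M[R]_(m, n)) i j : `|u i j| <= `|u|.
Proof.
rewrite [leRHS]/Num.Def.normr /= mx_normrE.
exact: (le_bigmax _ (fun ij : 'I_m * 'I_n => `|u ij.1 ij.2|) (i, j)).
Qed.

Lemma mx_norm_le m n (u : 'M[R]_(m, n)) (e : R) : 0 <= e ->
  (forall i j, `|u i j| <= e) -> `|u| <= e.
Proof.
move=> e0 ue; rewrite /Num.Def.normr /= mx_normrE.
by apply: bigmax_le => //= -[i j] _; exact: ue.
Qed.

Lemma mx_continuousP m n (T : topologicalType) (f : T -> 'M[R]_(m, n)) x :
  {for x, continuous f} <->
  (forall i j, {for x, continuous (fun y => f y i j)}).
Proof.
split=> [fx i j|fx].
  apply: (@continuous_comp _ _ _ f (fun M : 'M[R]_(m, n) => M i j)) => //.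
  exact: coord_continuous.
apply/cvgrPdist_le => /= e e0; near=> y; apply: mx_norm_le => [|i j].
  exact: ltW.
rewrite !mxE; move: i j; near: y.
apply: filter_forall => i; apply: filter_forall => j.
by have /cvgrPdist_le := fx i j; apply.
Unshelve. all: by end_near. Qed.

Lemma differentiable_mxP m n V (f : V -> 'M[R]_(m, n)) x :
  differentiable f x <-> (forall i j, differentiable (fun y => f y i j) x).
Proof.
split=> [fx i j|fx].
  apply: (@differentiable_comp _ _ _ _ f (fun M : 'M[R]_(m, n) => M i j)) => //.
  exact: differentiable_coord.
have -> : f = (\sum_(i < m) \sum_(j < n) (fun y => f y i j *: delta_mx i j)).
  apply/funext => y; rewrite [LHS]matrix_sum_delta fct_sumE.
  by apply: eq_bigr => i _; rewrite fct_sumE.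
apply: differentiable_sum => i; apply: differentiable_sum => j.
exact: differentiableZl.
Qed.

Lemma derive_coord m n V (f : V -> 'M[R]_(m, n)) x v i j :
  derivable f x v -> 'D_v (fun y => f y i j) x = 'D_v f x i j.
Proof. by move=> fx; rewrite derive_mx// mxE. Qed.

Lemma derive1_coord m n (f : R -> 'M[R]_(m, n)) t i j :
  differentiable f t -> derive1 (fun y => f y i j) t = derive1 f t i j.
Proof.
by move=> fx; rewrite !derive1E derive_coord//; exact: diff_derivable.
Qed.

Lemma is_derive_coord m n (f : R -> 'M[R]_(m, n)) t i j :
  differentiable f t -> is_derive t 1 (fun y => f y i j) (derive1 f t i j).
Proof.
move=> ft; apply: DeriveDef; last by rewrite -derive1E derive1_coord.
by have /derivable_mxP := @diff_derivable _ _ _ f t 1 ft.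
Qed.

Lemma diff_curve V (c : R -> V) t : differentiable c t ->
  'd c t 1 = derive1 c t.
Proof. by move=> ct; rewrite derive1E' . Qed.

Lemma derive1_comp_diff V W (f : V -> W) (c : R -> V) t :
  differentiable c t -> differentiable f (c t) ->
  derive1 (f \o c) t = 'd f (c t) (derive1 c t).
Proof.
move=> ct fct; rewrite derive1E'; last exact: differentiable_comp.
by rewrite diff_comp//= diff_curve.
Qed.

(* Since every clause of [Ck] is quantified over the points of the set, it is a
   condition on each point separately; no openness is needed. *)
Lemma CkP V W k (U : set V) (f : V -> W) :
  Ck k U f <-> (forall x, U x -> Ck k [set x] f).
Proof.
elim: k f => [|k IH] f /=; first by split=> [fU x Ux _ ->|fU x /fU]; auto.
split=> [[fd fk] x Ux|fU].
  split=> [_ ->|v]; first exact: fd.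
  by have /IH := fk v; apply.
split=> [x /fU[]|v]; first by move/(_ x erefl).
by apply/IH => x /fU[_].
Qed.

Lemma Ck_subset V W k (U U' : set V) (f : V -> W) :
  U' `<=` U -> Ck k U f -> Ck k U' f.
Proof. by move=> UU /CkP fU; apply/CkP => x /UU; exact: fU. Qed.

Lemma near_eq_Ck V W k (f g : V -> W) x :
  {near x, f =1 g} -> Ck k [set x] f -> Ck k [set x] g.
Proof.
elim: k f g => [|k IH] f g fg /= fk.
  move=> _ ->; have fx := fk _ erefl.
  have gfx := nbhs_singleton fg.
  rewrite /prop_for /continuous_at -gfx; apply: cvg_trans fx.
  by apply: near_eq_cvg; apply: filterS fg => y ->.
case: fk => fd fk; split=> [_ ->|v].
  by apply: near_eq_differentiable fg _; exact: fd.
apply: IH (fk v); move/nbhs_interior : fg; apply: filterS => y fg.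
by apply: near_eq_derive; apply: filterS fg => z ->.
Qed.

Lemma CkW V W k (U : set V) (f : V -> W) : Ck k.+1 U f -> Ck k U f.
Proof.
elim: k f => [|k IH] f [fd fk].
  by move=> x /fd; exact: differentiable_continuous.
by split=> // v; exact: IH.
Qed.

Lemma Ck_cst V W k (U : set V) (a : W) : Ck k U (cst a : V -> W).
Proof.
elim: k a => [|k IH] a; first by move=> x _; exact: cvg_cst.
split=> [x _|v]; first exact: differentiable_cst.
rewrite (_ : (fun x => _) = cst 0); first exact: IH.
by apply/funext => x; rewrite derive_cst.
Qed.

Lemma eq_open_Ck V W k (U : set V) (f g : V -> W) : open U ->
  (forall x, U x -> f x = g x) -> Ck k U f -> Ck k U g.
Proof.
move=> Uo fg fU; apply/CkP => x Ux; apply: (@near_eq_Ck _ _ _ f).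
  by near=> y; apply: fg; near: y; exact: open_nbhs_nbhs.
by move/CkP : fU; exact.
Unshelve. all: by end_near. Qed.

Lemma CkD V W k (U : set V) (f g : V -> W) : open U ->
  Ck k U f -> Ck k U g -> Ck k U (fun x => f x + g x).
Proof.
move=> Uo; elim: k f g => [|k IH] f g.
  by move=> fU gU x Ux; apply: cvgD; [exact: fU|exact: gU].
move=> [fd fk] [gd gk]; split=> [x Ux|v].
  by apply: differentiableD; [exact: fd|exact: gd].
apply: eq_open_Ck (IH _ _ (fk v) (gk v)) => // x Ux /=.
by rewrite -deriveD//; apply: diff_derivable; [exact: fd|exact: gd].
Qed.

Lemma CkM V k (U : set V) (f g : V -> R) : open U ->
  Ck k U f -> Ck k U g -> Ck k U (fun x => f x * g x).
Proof.
move=> Uo; elim: k f g => [|k IH] f g.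
  by move=> fU gU x Ux; apply: cvgM; [exact: fU|exact: gU].
move=> /[dup] fU [fd fk] /[dup] gU [gd gk]; split=> [x Ux|v].
  by apply: differentiableM; [exact: fd|exact: gd].
have h := CkD Uo (IH _ _ (CkW fU) (gk v)) (IH _ _ (CkW gU) (fk v)).
apply: eq_open_Ck h => // x Ux /=.
by rewrite -[LHS]deriveM//; apply: diff_derivable; [exact: fd|exact: gd].
Qed.

Lemma Ck_mxP V m n k (U : set V) (f : V -> 'M[R]_(m, n)) : open U ->
  Ck k U f <-> (forall i j, Ck k U (fun x => f x i j)).
Proof.
move=> Uo; elim: k f => [|k IH] f.
  split=> [fU i j x Ux|fU x Ux]; first by have /mx_continuousP := fU x Ux; apply.
  by apply/mx_continuousP => i j; exact: fU.
split=> [[fd fk] i j|fU].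
  split=> [x Ux|v]; first by have /differentiable_mxP := fd x Ux; apply.
  have /IH /(_ i j) := fk v; apply: eq_open_Ck => // x Ux.
  by rewrite derive_coord//; apply: diff_derivable; exact: fd.
have fd x : U x -> differentiable f x.
  by move=> Ux; apply/differentiable_mxP => i j; have [] := fU i j; auto.
split=> // v; apply/IH => i j; have [_ /(_ v)] := fU i j.
apply: eq_open_Ck => // x Ux.
by rewrite derive_coord//; apply: diff_derivable; exact: fd.
Qed.

Lemma derive_basis W n (f : 'rV[R]_n -> W) x v : differentiable f x ->
  'D_v f x = \sum_i v 0 i *: 'D_(delta_mx 0 i) f x.
Proof.
move=> fx; rewrite deriveE// {1}(row_sum_delta v) linear_sum.
by apply: eq_bigr => i _; rewrite linearZ deriveE.
Qed.

Lemma derive_compose V W n (f : 'rV[R]_n -> W) (g : V -> 'rV[R]_n) x v :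
  differentiable g x -> differentiable f (g x) ->
  'D_v (f \o g) x = \sum_i 'D_v g x 0 i *: 'D_(delta_mx 0 i) f (g x).
Proof.
move=> gx fgx; rewrite deriveE; last exact: differentiable_comp.
by rewrite diff_comp//= -derive_basis// [RHS]deriveE// (deriveE v gx).
Qed.

(** By the chain rule a directional derivative of the composite is a finite sum of products. One
    factor is a coordinate of a derivative of [g], the other a partial derivative of [f] composed
    with [g], which is C^k by induction once [g] is weakened by one order. *)
Lemma Ck_comp_scalar V n k (U : set V) (U' : set 'rV[R]_n)
    (f : 'rV[R]_n -> R) (g : V -> 'rV[R]_n) :
  open U -> g @` U `<=` U' -> Ck k U g -> Ck k U' f -> Ck k U (f \o g).
Proof.
move=> Uo gUU; elim: k f g gUU => [|k IH] f g gUU.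
  move=> gU fU x Ux; apply: continuous_comp; first exact: gU.
  by apply: fU; apply: gUU; exists x.
move=> /[dup] gU [gd gk] [fd fk].
have fgd x : U x -> differentiable f (g x).
  by move=> Ux; apply: fd; apply: gUU; exists x.
split=> [x Ux|v]; first by apply: differentiable_comp; [exact: gd|exact: fgd].
(* Summing over an arbitrary list of indices lets the binary rule [CkD] be iterated. *)
suff : forall r : seq 'I_n, Ck k U (fun x =>
    \sum_(i <- r) 'D_v g x 0 i * 'D_(delta_mx 0 i) f (g x)).
  move/(_ (index_enum _)); apply: eq_open_Ck => // x Ux.
  by rewrite derive_compose//; [exact: gd|exact: fgd].
elim=> [|i r IHr].
  by under eq_fun do rewrite big_nil; exact: Ck_cst.
under eq_fun do rewrite big_cons.
apply: CkD => //; apply: CkM => //.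
  by have /(Ck_mxP _ _ Uo) := gk v; apply.
exact: (IH _ g gUU (CkW gU) (fk (delta_mx 0 i))).
Qed.

Lemma Ck_comp V m n p k (U : set V) (U' : set 'rV[R]_n)
    (f : 'rV[R]_n -> 'M[R]_(m, p)) (g : V -> 'rV[R]_n) :
  open U -> open U' -> g @` U `<=` U' -> Ck k U g -> Ck k U' f ->
  Ck k U (f \o g).
Proof.
move=> Uo U'o gUU gU /(Ck_mxP _ _ U'o) fU; apply/Ck_mxP => // i j.
exact: (Ck_comp_scalar Uo gUU gU (fU i j)).
Qed.

Lemma smooth_on_comp V m n p (U : set V) (U' : set 'rV[R]_n)
    (f : 'rV[R]_n -> 'M[R]_(m, p)) (g : V -> 'rV[R]_n) :
  open U -> open U' -> g @` U `<=` U' -> smooth_on U g -> smooth_on U' f ->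
  smooth_on U (f \o g).
Proof. by move=> Uo U'o gUU gU fU k; exact: Ck_comp (gU k) (fU k). Qed.

Lemma smooth_on_differentiable V W (U : set V) (f : V -> W) x :
  smooth_on U f -> U x -> differentiable f x.
Proof. by move=> /(_ 1%N)[+ _]; exact. Qed.

Lemma differentiable_affine V (u w : V) (t : R) :
  differentiable (fun t : R => u + t *: w) t.
Proof.
exact: (@differentiableD _ _ _ (cst u) (fun t : R => t *: w)).
Qed.

Lemma derive1_affine V (u w : V) (t : R) : derive1 (fun t : R => u + t *: w) t = w.
Proof.
rewrite -diff_curve; last exact: differentiable_affine.
rewrite (_ : (fun t : R => u + t *: w) = cst u + (fun t : R => t *: w))//.
have dw : differentiable (fun t : R => t *: w) t by exact: differentiableZl.
rewrite diffD// /= diff_cst diffZl//= diff_val scale1r.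
exact: add0r.
Qed.

Lemma smooth_affine V (U : set R) (u w : V) : smooth_on U (fun t : R => u + t *: w).
Proof.
move=> [|k]; first by move=> t _; exact/differentiable_continuous/differentiable_affine.
split=> [t _|v]; first exact: differentiable_affine.
rewrite (_ : (fun x => _) = cst (v *: w)); first exact: Ck_cst.
apply/funext => t; have dw := @differentiable_affine V u w t.
by rewrite deriveE// -[v in LHS]mulr1 linearZ/= diff_curve// derive1_affine.
Qed.

(** Strict differentiability: both points vary, and the error is relative to their mutual distance.
    It follows from the mean value theorem on the segment from z to y, where the partial derivatives
    are close to those at x. *)
Lemma Ck1_strict n m p (U : set 'rV[R]_n) (f : 'rV[R]_n -> 'M[R]_(m, p)) x :
  open U -> U x -> Ck 1 U f -> forall e : R, 0 < e ->
  exists2 d : R, 0 < d & forall y z, `|y - x| < d -> `|z - x| < d ->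
    [/\ U y, U z & `|f y - f z - 'd f x (y - z)| <= e * `|y - z|].
Proof.
move=> Uo Ux [fd fc] e e0.
(* Each of the n partial derivatives may vary by this much; [n.+1] keeps the quotient meaningful for
   n = 0. *)
have e1 : 0 < e / n.+1%:R by rewrite divr_gt0.
have : \forall y \near x, U y /\ forall i : 'I_n,
    `|'D_(delta_mx 0 i) f x - 'D_(delta_mx 0 i) f y| <= e / n.+1%:R.
  have hU := open_nbhs_nbhs (conj Uo Ux).
  have hA : \forall y \near x, forall i : 'I_n,
      `|'D_(delta_mx 0 i) f x - 'D_(delta_mx 0 i) f y| <= e / n.+1%:R.
    apply: (@filter_forall _ _ (fun (i : 'I_n) y =>
      `|'D_(delta_mx 0 i) f x - 'D_(delta_mx 0 i) f y| <= e / n.+1%:R) _ (nbhs_filter x)) => i.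
    by have /cvgrPdist_le := fc (delta_mx 0 i) x Ux; apply.
  exact: filterI hU hA.
move=> /nbhs_ballP[d /= d0 xd]; exists d => // y z yd zd.
have ballP t : `|t - x| < d -> ball x d t.
  by rewrite mx_norm_ball /ball_ /= distrC.
have seg (t : R) : 0 <= t <= 1 -> `|z + t *: (y - z) - x| < d.
  move=> /andP[t0 t1].
  have -> : z + t *: (y - z) - x = (1 - t) *: (z - x) + t *: (y - x).
    apply/matrixP => i j; rewrite !mxE; ring.
  apply: (le_lt_trans (ler_normD _ _)); rewrite !normrZ.
  rewrite (ger0_norm t0) (@ger0_norm _ (1 - t)) ?subr_ge0//.
  have [->|t0'] := eqVneq t 0; first by rewrite subr0 mul1r mul0r addr0.
  apply: (@lt_le_trans _ _ ((1 - t) * d + t * d)); last by rewrite -mulrDl subrK mul1r.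
  apply: ler_ltD; first by rewrite ler_wpM2l// ?subr_ge0// ltW.
  by rewrite ltr_pM2l// lt0r t0' t0.
have Useg (t : R) : 0 <= t <= 1 -> U (z + t *: (y - z)).
  by move=> /seg/ballP/xd[].
have fdseg (t : R) : 0 <= t <= 1 -> differentiable f (z + t *: (y - z)).
  by move=> /Useg; exact: fd.
split.
- by have [] := xd _ (ballP _ yd).
- by have [] := xd _ (ballP _ zd).
apply: mx_norm_le => [|a b]; first by rewrite mulr_ge0// ltW.
pose g1 (t : R) := f (z + t *: (y - z)) a b.
pose g2 (t : R) := t * 'd f x (y - z) a b.
(* Subtracting the linear part first makes the mean value theorem produce the error term itself. *)
pose g := g1 - g2.
have [G GE] : {G : R -> R | forall t : R, G t =
    'd f (z + t *: (y - z)) (y - z) a b - 'd f x (y - z) a b} by eexists.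
have gd (t : R) : 0 <= t <= 1 -> is_derive t 1 g (G t).
  move=> t01; rewrite GE.
  have h1 : is_derive t (1 : R) g1
      ('d f (z + t *: (y - z)) (y - z) a b).
    pose c (t : R) := z + t *: (y - z).
    have cd := @differentiable_affine _ z (y - z) t.
    have fcd : differentiable (f \o c) t.
      by apply: differentiable_comp => //; exact: fdseg.
    apply: is_derive_eq (@is_derive_coord _ _ (f \o c) t a b fcd) _.
    by rewrite derive1_comp_diff// ?derive1_affine//; exact: fdseg.
  have h2 : is_derive t (1 : R) g2
      ('d f x (y - z) a b).
    apply: is_derive_eq.
    by rewrite scaler0 add0r scaler1.
  exact: (@is_deriveB _ _ _ g1 g2 t 1 _ _ h1 h2).
have [t t01 gt] : exists2 t, t \in `[0 : R, 1] & g 1 - g 0 = G t * (1 - 0).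
  apply: (@MVT_segment _ g _ 0 1 ler01).
    move=> t; rewrite in_itv/= => /andP[t0 t1]; apply: gd.
    by rewrite !ltW.
  apply: derivable_within_continuous => t; rewrite in_itv/= => t01.
  by have [] := gd t t01.
rewrite in_itv/= in t01.
have -> : (f y - f z - 'd f x (y - z)) a b = g 1 - g 0.
  have h1 : z + 1 *: (y - z) = y by rewrite scale1r addrC subrK.
  have h0 : z + 0 *: (y - z) = z by rewrite scale0r addr0.
  rewrite /g !fctE /g1 /g2 h1 h0 mul0r mul1r subr0 mxE [(f y - f z) a b]mxE.
  by rewrite [(- f z) a b]mxE [(- 'd f x _) a b]mxE addrAC.
have dx := fd x Ux; have dt := fdseg t t01.
have basis w : differentiable f w -> 'd f w (y - z) a b =
    (\sum_i (y - z) 0 i *: 'D_(delta_mx 0 i) f w) a b.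
  by move=> dw; rewrite -(derive_basis (y - z) dw) -(deriveE (y - z) dw).
have := etrans (GE t) (congr2 (fun u v => u - v) (basis _ dt) (basis _ dx)).
rewrite {}gt subr0 mulr1 => ->.
rewrite !summxE -sumrB; apply: le_trans (ler_norm_sum _ _ _) _.
apply: (@le_trans _ _ (\sum_(i < n) e / n.+1%:R * `|y - z|)).
  apply: ler_sum => i _; rewrite !mxE -mulrBr normrM mulrC.
  apply: ler_pM => //; last by rewrite (le_trans _ (coord_le_norm _ 0 i))// !mxE.
  have [_ /(_ i)] := xd _ (ballP _ (seg _ t01)); apply: le_trans.
  by rewrite distrC (le_trans _ (coord_le_norm _ a b))// !mxE.
rewrite sumr_const card_ord -[leLHS]mulr_natl mulrA ler_wpM2r//.
rewrite mulrCA ger_pMr// ler_pdivrMr// mul1r ler_nat.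
exact: leqnSn.
Qed.

End Differentiability.

(** * Smooth curves and maps between manifolds *)

Section ManifoldCalculus.
Context {R : realType}.

Lemma smooth_on_local (V W : normedModType R) (U : set V) (f : V -> W) :
  (forall x, U x -> exists2 O : set V, O x & smooth_on O f) -> smooth_on U f.
Proof.
move=> Uf k; apply/CkP => x Ux; have [A Ax /(_ k)] := Uf x Ux.
by apply: Ck_subset => _ ->.
Qed.

Lemma smooth_on_subset (V W : normedModType R) (U U' : set V) (f : V -> W) :
  U' `<=` U -> smooth_on U f -> smooth_on U' f.
Proof. by move=> UU fU k; exact: Ck_subset (fU k). Qed.

Lemma eq_open_smooth_on (V W : normedModType R) (U : set V) (f g : V -> W) :
  open U -> (forall x, U x -> f x = g x) -> smooth_on U f -> smooth_on U g.
Proof. by move=> Uo fg fU k; exact: eq_open_Ck fg (fU k). Qed.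

Lemma open_preimage_on (T S : topologicalType) (U : set T) (c : T -> S)
    (A : set S) : open U -> open A ->
  (forall t, U t -> {for t, continuous c}) -> open (U `&` c @^-1` A).
Proof.
move=> Uo Ao cc; rewrite openE => t [Ut At]; apply: filterI.
  exact: open_nbhs_nbhs.
by apply: cc => //; exact: open_nbhs_nbhs.
Qed.

Section Charts.
Context {n : nat} {M : manifoldType R n}.
Implicit Types (phi psi : chart R n M) (x : M) (c : R -> M).

Lemma near_chart_dom phi x : chart_dom phi x -> \forall y \near x, chart_dom phi y.
Proof. by move=> px; apply: open_nbhs_nbhs; split => //; exact: chart_open. Qed.

Lemma chart_invK phi y : chart_img phi y -> phi (chart_inv phi y) = y.
Proof. by move=> [x px <-]; rewrite chart_funK. Qed.

Lemma chart_dom_inv phi y : chart_img phi y -> chart_dom phi (chart_inv phi y).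
Proof. by move=> [x px <-]; rewrite chart_funK. Qed.

Lemma chart_image_open phi (A : set M) : open A ->
  open (phi @` (chart_dom phi `&` A)).
Proof.
move=> Ao; rewrite openE => _ [x [px Ax] <-].
have ix : chart_img phi (phi x) by exists x.
have : \forall z \near phi x, chart_img phi z /\ A (chart_inv phi z).
  apply: filterI.
    by apply: open_nbhs_nbhs; split => //; exact: chart_img_open.
  have := @chart_inv_continuous _ _ _ phi _ ix; apply.
  by rewrite chart_funK//; exact: open_nbhs_nbhs.
apply: filterS => z [zi Az]; exists (chart_inv phi z); last exact: chart_invK.
by split => //; exact: chart_dom_inv.
Qed.

Lemma smooth_curve_continuous (U : set R) c t :
  smooth_curve U c -> U t -> {for t, continuous c}.
Proof. by case=> + _; exact. Qed.

Lemma smooth_curve_subset (U U' : set R) c :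
  U' `<=` U -> smooth_curve U c -> smooth_curve U' c.
Proof.
move=> UU [cc cs]; split=> [t /UU|phi aphi]; first exact: cc.
by apply: smooth_on_subset (cs phi aphi) => t [/UU].
Qed.

Lemma smooth_curve_chart (U : set R) c phi t : smooth_curve U c -> atlas phi ->
  U t -> chart_dom phi (c t) ->
  [/\ differentiable (phi \o c) t,
      {for t, continuous (derive1 (phi \o c))} &
      differentiable (derive1 (phi \o c)) t].
Proof.
move=> [cc cs] aphi Ut pc; have Ot : (U `&` c @^-1` chart_dom phi) t by [].
have e1 : derive1 (phi \o c) = 'D_1 (phi \o c).
  by apply/funext => s; rewrite derive1E.
have [d1 /(_ 1)[d2 _]] := cs _ aphi 2%N.
have dd : differentiable (derive1 (phi \o c)) t by rewrite e1; exact: d2.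
split; [exact: d1|exact: differentiable_continuous|exact: dd].
Qed.

(** Coordinate segments supply the short competitors in [short_segment] and, in the chart of the
    group at 1, the curves inside an orbit in [orbit_tangent]. *)
Lemma chart_segment_smooth phi (U : set R) (u w : 'rV[R]_n) : open U ->
  atlas phi -> (forall t, U t -> chart_img phi (u + t *: w)) ->
  smooth_curve U (fun t : R => chart_inv phi (u + t *: w)).
Proof.
move=> Uo aphi Uimg.
have cc t : U t -> {for t, continuous (fun t : R => chart_inv phi (u + t *: w))}.
  move=> Ut; apply: (@continuous_comp _ _ _ (fun t : R => u + t *: w)).
    exact/differentiable_continuous/differentiable_affine.
  by apply: chart_inv_continuous; exact: Uimg.
split => // psi apsi.
have Oo := open_preimage_on Uo (chart_open psi) cc.
apply: (@smooth_on_comp _ _ _ _ _ _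
  (phi @` (chart_dom phi `&` chart_dom psi)) (psi \o chart_inv phi)
  (fun t : R => u + t *: w)) => //.
- by apply: chart_image_open; exact: chart_open.
- move=> _ [t [Ut pt] <-]; exists (chart_inv phi (u + t *: w)).
    by split => //; apply: chart_dom_inv; exact: Uimg.
  by rewrite chart_invK//; exact: Uimg.
- exact: smooth_affine.
- exact: atlas_smooth.
Qed.

Lemma smooth_curve_cst (U : set R) x : open U -> smooth_curve U (cst x).
Proof.
move=> Uo; split=> [t _|phi aphi]; first exact: cvg_cst.
by move=> k; exact: (@Ck_cst _ _ _ _ _ (phi x)).
Qed.

Lemma smooth_curve_shift (U : set R) c (s : R) : open U -> smooth_curve U c ->
  smooth_curve ((fun t : R => t + s) @^-1` U) (fun t : R => c (t + s)).
Proof.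
move=> Uo [cc cs].
have sc : continuous (fun t : R => t + s).
  by move=> t; apply: cvgD; [exact: cvg_id|exact: cvg_cst].
have U'o : open ((fun t : R => t + s) @^-1` U).
  by apply: open_comp => // t _; exact: sc.
have cc' t : ((fun t : R => t + s) @^-1` U) t ->
    {for t, continuous (fun t : R => c (t + s))}.
  move=> Ut; apply: (@continuous_comp _ _ _ (fun t : R => t + s)); first exact: sc.
  exact: cc.
split=> // phi aphi; have {}cs := cs phi aphi.
have Oo := open_preimage_on U'o (chart_open phi) cc'.
have O2o := open_preimage_on Uo (chart_open phi) cc.
move=> k; move: (cs k).
have : (fun t : R => t + s) @` ((fun t : R => t + s) @^-1` U `&`
    (fun t : R => c (t + s)) @^-1` chart_dom phi) `<=` U `&` c @^-1` chart_dom phi.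
  by move=> _ [t [Ut pt] <-].
move: Oo O2o; set O := (X in open X -> _); set O' := (X in _ -> open X -> _).
rewrite (_ : (phi \o fun t : R => c (t + s)) = (phi \o c) \o (fun t : R => t + s))//.
(* With [f] arbitrary the induction on k can pass to its derivatives, which commute with the
   translation. *)
move: (phi \o c) => f Oo O'o OO'; move: f.
elim: k => [|k IH] f.
  move=> fk t Ot; apply: (@continuous_comp _ _ _ (fun t : R => t + s)).
    exact: sc.
  by apply: fk; apply: OO'; exists t.
have sd t : is_diff t (fun t : R => t + s) id.
  apply: is_diff_eq.
  by apply/funext => h; rewrite fctE addr0.
move=> [fd fk].
have fd' t : O t -> differentiable f (t + s).
  by move=> Ot; apply: fd; apply: OO'; exists t.
split=> [t Ot|v].
  by apply: differentiable_comp; [exact: ex_diff|exact: fd'].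
apply: eq_open_Ck (IH _ (fk v)) => // t Ot /=.
have E : (fun h : R => h^-1 *: ((f \o shift (t + s)) (h *: v) - f (t + s))) =
    (fun h : R => h^-1 *: (((f \o (fun t : R => t + s)) \o shift t) (h *: v) -
      (f \o (fun t : R => t + s)) t)).
  by apply/funext => h /=; rewrite addrA.
by rewrite /derive E.
Qed.

End Charts.

Lemma smooth_map_curve m n (M : manifoldType R m) (N : manifoldType R n)
    (f : M -> N) (U : set R) (c : R -> M) : open U ->
  smooth_map f -> smooth_curve U c -> smooth_curve U (f \o c).
Proof.
move=> Uo [fc fs] [cc cs].
have fcc t : U t -> {for t, continuous (f \o c)}.
  by move=> Ut; apply: continuous_comp; [exact: cc|exact: fc].
split => // psi apsi; apply: smooth_on_local => t [Ut pt].
pose phi := chart_at (c t); have aphi : atlas phi by exact: chart_at_atlas.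
have Oo := open_preimage_on (open_preimage_on Uo (chart_open psi) fcc)
  (chart_open phi) (fun t tU => cc t tU.1).
exists ((U `&` (f \o c) @^-1` chart_dom psi) `&` c @^-1` chart_dom phi).
  by split => //; exact: chart_at_dom.
have fo : open (f @^-1` chart_dom psi).
  by apply: open_comp; [move=> x _; exact: fc|exact: chart_open].
have := @smooth_on_comp _ _ _ _ _ _
  (phi @` (chart_dom phi `&` f @^-1` chart_dom psi))
  (psi \o f \o chart_inv phi) (phi \o c) Oo (chart_image_open fo).
set P := _ `<=` _; have HP : P by move=> _ [s [[Us ps] qs] <-]; exists (c s).
move=> /(_ HP) h; apply: eq_open_smooth_on (h _ (fs _ _ aphi apsi)) => //.
  by move=> s [_ ps] /=; rewrite chart_funK.
by apply: smooth_on_subset (cs _ aphi) => s [[Us _]].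
Qed.

Lemma map_chart_dom_open m p (N : manifoldType R m) (P : manifoldType R p)
    (f : N -> P) (phi : chart R m N) (psi : chart R p P) :
  smooth_map f -> open (phi @` (chart_dom phi `&` f @^-1` chart_dom psi)).
Proof.
move=> [fc _]; apply: chart_image_open; apply: open_comp => [y _|].
  exact: fc.
exact: chart_open.
Qed.

Lemma smooth_map_chart_differentiable m p (N : manifoldType R m)
    (P : manifoldType R p) (f : N -> P)
    (phi : chart R m N) (psi : chart R p P) (x : N) :
  smooth_map f -> atlas phi -> atlas psi -> chart_dom phi x ->
  chart_dom psi (f x) -> differentiable (psi \o f \o chart_inv phi) (phi x).
Proof.
move=> [_ fs] aphi apsi px qx; have h := fs _ _ aphi apsi.
by apply: (smooth_on_differentiable h); exists x.
Qed.

Lemma near_map_chart m p (N : manifoldType R m) (P : manifoldType R p)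
    (f : N -> P) (phi : chart R m N) (psi : chart R p P) (c : R -> N) (t : R) :
  {for t, continuous c} -> chart_dom phi (c t) ->
  {near t, (psi \o f \o chart_inv phi) \o (phi \o c) =1 psi \o (f \o c)}.
Proof.
move=> cc pc; have : \forall s \near t, chart_dom phi (c s).
  by apply: cc; exact: near_chart_dom.
by apply: filterS => s ps /=; rewrite chart_funK.
Qed.

(** Chain rule for velocities read in any two charts of the atlases; for the identity map it becomes
    the coordinate change [curve_transition]. *)
Lemma curve_map m p (N : manifoldType R m) (P : manifoldType R p)
    (f : N -> P) (phi : chart R m N) (psi : chart R p P) (c : R -> N) (t : R) :
  smooth_map f -> atlas phi -> atlas psi -> {for t, continuous c} ->
  chart_dom phi (c t) -> chart_dom psi (f (c t)) ->
  differentiable (phi \o c) t ->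
  differentiable (psi \o (f \o c)) t /\
  derive1 (psi \o (f \o c)) t =
    'd (psi \o f \o chart_inv phi) (phi (c t)) (derive1 (phi \o c) t).
Proof.
move=> fs aphi apsi cc pc qc dc.
have dT := smooth_map_chart_differentiable fs aphi apsi pc qc.
have nT := @near_map_chart _ _ _ _ f phi psi c t cc pc.
split.
  by apply: near_eq_differentiable nT _; exact: differentiable_comp.
rewrite -(derive1_comp_diff dc dT) !derive1E; apply: near_eq_derive.
by apply: filterS nT => s ->.
Qed.

Lemma smooth_map_id n (M : manifoldType R n) : smooth_map (@id M).
Proof.
split=> [x|phi psi aphi apsi]; first exact: cvg_id.
exact: atlas_smooth.
Qed.

Lemma curve_transition n (M : manifoldType R n) (phi psi : chart R n M) c t :
  atlas phi -> atlas psi ->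
  {for t, continuous c} -> chart_dom phi (c t) -> chart_dom psi (c t) ->
  differentiable (phi \o c) t ->
  differentiable (psi \o c) t /\
  derive1 (psi \o c) t =
    'd (psi \o chart_inv phi) (phi (c t)) (derive1 (phi \o c) t).
Proof. exact: (@curve_map _ _ _ _ id _ _ c t (@smooth_map_id n M)). Qed.

Lemma smooth_on_row_mx (V : normedModType R) m n (U : set V)
    (f : V -> 'rV[R]_m) (g : V -> 'rV[R]_n) : open U ->
  smooth_on U f -> smooth_on U g -> smooth_on U (fun t => row_mx (f t) (g t)).
Proof.
move=> Uo fU gU k; apply/Ck_mxP => // i j.
have [l jl|l jl] := splitP j.
  have -> : (fun t => row_mx (f t) (g t) i j) = (fun t => f t i l).
    have -> : j = lshift n l by apply/val_inj.
    by apply/funext => t; rewrite row_mxEl.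
  by have /(Ck_mxP _ _ Uo) := fU k; apply.
have -> : (fun t => row_mx (f t) (g t) i j) = (fun t => g t i l).
  have -> : j = rshift m l by apply/val_inj.
  by apply/funext => t; rewrite row_mxEr.
by have /(Ck_mxP _ _ Uo) := gU k; apply.
Qed.

Definition smooth2_dom m1 m2 n (M1 : manifoldType R m1)
    (M2 : manifoldType R m2) (N : manifoldType R n) (f : M1 -> M2 -> N)
    (phi1 : chart R m1 M1) (phi2 : chart R m2 M2) (psi : chart R n N) :
    set 'rV[R]_(m1 + m2) :=
  [set row_mx (phi1 x.1) (phi2 x.2) | x in
    [set x : M1 * M2 | [/\ chart_dom phi1 x.1, chart_dom phi2 x.2 &
                           chart_dom psi (f x.1 x.2)]]].

Lemma smooth2_dom_open m1 m2 n (M1 : manifoldType R m1)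
    (M2 : manifoldType R m2) (N : manifoldType R n) (f : M1 -> M2 -> N)
    phi1 phi2 psi : continuous (fun x : M1 * M2 => f x.1 x.2) ->
  open (smooth2_dom f phi1 phi2 psi).
Proof.
move=> fc; rewrite openE => _ [[x1 x2] /= [p1 p2 q] <-].
set y := row_mx _ _.
have l1 : lsubmx y = phi1 x1 by rewrite row_mxKl.
have l2 : rsubmx y = phi2 x2 by rewrite row_mxKr.
have i1 : chart_img phi1 (lsubmx y) by exists x1.
have i2 : chart_img phi2 (rsubmx y) by exists x2.
have n1 : \forall z \near y, chart_img phi1 (lsubmx z).
  have h : nbhs (lsubmx y) (chart_img phi1).
    by apply: open_nbhs_nbhs; split => //; exact: chart_img_open.
  by have := @continuous_lsubmx _ _ _ _ y _ h.
have n2 : \forall z \near y, chart_img phi2 (rsubmx z).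
  have h : nbhs (rsubmx y) (chart_img phi2).
    by apply: open_nbhs_nbhs; split => //; exact: chart_img_open.
  by have := @continuous_rsubmx _ _ _ _ y _ h.
have n3 : \forall z \near y,
    chart_dom psi (f (chart_inv phi1 (lsubmx z)) (chart_inv phi2 (rsubmx z))).
  have c1 : (chart_inv phi1 \o lsubmx) z @[z --> y] --> x1.
    rewrite -(chart_funK p1) -l1; apply: continuous_comp.
      exact: continuous_lsubmx.
    exact: chart_inv_continuous.
  have c2 : (chart_inv phi2 \o rsubmx) z @[z --> y] --> x2.
    rewrite -(chart_funK p2) -l2; apply: continuous_comp.
      exact: continuous_rsubmx.
    exact: chart_inv_continuous.
  have := fc (x1, x2) _ (near_chart_dom q).
  by move=> /(cvg_pair c1 c2).
apply: filterS3 n1 n2 n3 => z z1 z2 z3.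
exists (chart_inv phi1 (lsubmx z), chart_inv phi2 (rsubmx z)) => /=.
  by split => //; exact: chart_dom_inv.
by rewrite !chart_invK// hsubmxK.
Qed.

Lemma smooth_map2_curve m1 m2 n (M1 : manifoldType R m1)
    (M2 : manifoldType R m2) (N : manifoldType R n) (f : M1 -> M2 -> N)
    (U : set R) (c1 : R -> M1) (c2 : R -> M2) : open U ->
  smooth_map2 f -> smooth_curve U c1 -> smooth_curve U c2 ->
  smooth_curve U (fun t => f (c1 t) (c2 t)).
Proof.
move=> Uo [fc fs] [cc1 cs1] [cc2 cs2].
have fcc t : U t -> {for t, continuous (fun t => f (c1 t) (c2 t))}.
  move=> Ut; have k1 : c1 s @[s --> t] --> c1 t by exact: cc1.
  have k2 : c2 s @[s --> t] --> c2 t by exact: cc2.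
  by move=> A /(fc (c1 t, c2 t)) /(cvg_pair k1 k2).
split => // psi apsi; apply: smooth_on_local => t [Ut pt].
pose phi1 := chart_at (c1 t); have a1 : atlas phi1 by exact: chart_at_atlas.
pose phi2 := chart_at (c2 t); have a2 : atlas phi2 by exact: chart_at_atlas.
pose O0 := U `&` (fun t => f (c1 t) (c2 t)) @^-1` chart_dom psi.
have O0o : open O0 := open_preimage_on Uo (chart_open psi) fcc.
pose O1 := O0 `&` c1 @^-1` chart_dom phi1.
have O1o : open O1.
  exact: (open_preimage_on O0o (chart_open phi1) (fun s sO => cc1 s sO.1)).
pose O2 := O1 `&` c2 @^-1` chart_dom phi2.
have O2o : open O2.
  exact: (open_preimage_on O1o (chart_open phi2) (fun s sO => cc2 s sO.1.1)).
exists O2; first by do ![split => //]; exact: chart_at_dom.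
have := @smooth_on_comp _ _ _ _ _ O2 (smooth2_dom f phi1 phi2 psi)
  (fun y => psi (f (chart_inv phi1 (lsubmx y)) (chart_inv phi2 (rsubmx y))))
  (fun t => row_mx (phi1 (c1 t)) (phi2 (c2 t))) O2o (smooth2_dom_open fc).
set P := _ `<=` _.
have HP : P by move=> _ [s [[[Us ps] s1] s2] <-]; exists (c1 s, c2 s).
move=> /(_ HP) h; apply: eq_open_smooth_on (h _ (fs _ _ _ a1 a2 apsi)) => //.
  by move=> s [[_ ps1] ps2] /=; rewrite row_mxKl row_mxKr !chart_funK.
apply: smooth_on_row_mx => //.
  by apply: smooth_on_subset (cs1 _ a1) => s [[[]]].
by apply: smooth_on_subset (cs2 _ a2) => s [[[]]].
Qed.

End ManifoldCalculus.

(** * Lengths of piecewise smooth curves *)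

Section Bilinear.
Context {R : realType} {n : nat}.
Implicit Types (A B : 'M[R]_n) (u v w : 'rV[R]_n) (y : 'rV[R]_n).

Lemma bilinE A u v : bilin A u v = \sum_i \sum_j u 0 j * A j i * v 0 i.
Proof.
rewrite /bilin mxE; apply: eq_bigr => i _.
by rewrite !mxE mulr_suml.
Qed.

Lemma bilinDl A u v w : bilin A (u + v) w = bilin A u w + bilin A v w.
Proof. by rewrite /bilin !mulmxDl mxE. Qed.

Lemma bilinDr A u v w : bilin A u (v + w) = bilin A u v + bilin A u w.
Proof. by rewrite /bilin linearD mulmxDr mxE. Qed.

Lemma bilinZl A u v (a : R) : bilin A (a *: u) v = a * bilin A u v.
Proof. by rewrite /bilin -!scalemxAl mxE. Qed.

Lemma bilinZr A u v (a : R) : bilin A u (a *: v) = a * bilin A u v.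
Proof. by rewrite /bilin linearZ -scalemxAr mxE. Qed.

Lemma bilinNl A u v : bilin A (- u) v = - bilin A u v.
Proof. by rewrite -scaleN1r bilinZl mulN1r. Qed.

Lemma bilinNr A u v : bilin A u (- v) = - bilin A u v.
Proof. by rewrite -scaleN1r bilinZr mulN1r. Qed.

Lemma bilinBmx A B u v : bilin (A - B) u v = bilin A u v - bilin B u v.
Proof. by rewrite /bilin mulmxBr mulmxBl !mxE. Qed.

Lemma bilin0l A v : bilin A 0 v = 0.
Proof. by rewrite /bilin !mul0mx mxE. Qed.

Lemma bilin0r A u : bilin A u 0 = 0.
Proof. by rewrite /bilin trmx0 mulmx0 mxE. Qed.

Lemma bilinC A u v : A^T = A -> bilin A u v = bilin A v u.
Proof.
move=> As; rewrite /bilin -[in RHS]As.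
have -> : v *m A^T *m u^T = (u *m A *m v^T)^T by rewrite !trmx_mul trmxK mulmxA.
by rewrite [RHS]mxE.
Qed.

Lemma bilin_norm A u v : `|bilin A u v| <= (n * n)%:R * `|A| * `|u| * `|v|.
Proof.
rewrite bilinE; apply: le_trans (ler_norm_sum _ _ _) _.
apply: (@le_trans _ _ (\sum_(i < n) \sum_(j < n) `|A| * `|u| * `|v|)).
  apply: ler_sum => i _; apply: le_trans (ler_norm_sum _ _ _) _.
  apply: ler_sum => j _; rewrite !normrM.
  apply: ler_pM => //; last exact: coord_le_norm.
  by rewrite mulrC ler_pM//; exact: coord_le_norm.
rewrite !sumr_const card_ord -mulrnA -[leLHS]mulr_natl !mulrA.
exact: lexx.
Qed.

(** The quadratic polynomial s -> A(u + s v, u + s v) is nonnegative. Only semidefiniteness is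
    assumed, so A(v, v) = 0 is treated apart. *)
Lemma bilin_CS A u v : A^T = A -> (forall w, 0 <= bilin A w w) ->
  bilin A u v <= Num.sqrt (bilin A u u) * Num.sqrt (bilin A v v).
Proof.
move=> As Ap.
have h s : 0 <= bilin A u u + 2 * s * bilin A u v + s ^+ 2 * bilin A v v.
  have := Ap (u + s *: v); rewrite !bilinDl !bilinDr !bilinZl !bilinZr (bilinC v)//.
  by rewrite (_ : _ + _ = bilin A u u + 2 * s * bilin A u v + s ^+ 2 * bilin A v v)//; ring.
rewrite -sqrtrM//; apply: (le_trans (ler_norm _)).
rewrite -sqrtr_sqr ler_wsqrtr//.
move: (Ap u) (Ap v) h; set a := bilin A u u; set b := bilin A v v; set c := bilin A u v.
move=> a0 b0 h; have [b00|bn0] := eqVneq b 0.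
  have [->|cn0] := eqVneq c 0; first by rewrite expr0n /= b00 mulr0.
  (* The polynomial is now affine with slope 2c, and takes the value -1 at this point. *)
  have := h (- (a + 1) / (2 * c)); rewrite b00 mulr0 addr0.
  rewrite (_ : 2 * _ * c = - (a + 1)); last by field.
  by rewrite opprD addrA subrr add0r oppr_ge0 ler10.
have bp : 0 < b by rewrite lt0r bn0.
have := h (- c / b).
(* The minimum of the polynomial is attained at s = - c / b. *)
rewrite (_ : _ + _ = (a * b - c ^+ 2) / b); last by field.
by rewrite pmulr_lge0 ?invr_gt0// subr_ge0.
Qed.

Lemma continuous_sum (T : topologicalType) (I : finType) (f : I -> T -> R) (x : T) :
  (forall i, {for x, continuous (f i)}) ->
  {for x, continuous (fun z => \sum_i f i z)}.
Proof.
move=> fc; rewrite (_ : (fun z => _) = \sum_i f i); last first.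
  by apply/funext => z; rewrite fct_sumE.
elim/big_ind : _ => //; first exact: cvg_cst.
by move=> g h gc hc; exact: cvgD.
Qed.

Lemma compact_sphere m : compact [set u : 'rV[R]_m | `|u| = 1].
Proof.
apply: bounded_closed_compact.
  by exists 1; split => // x x1 u /= ->; exact: ltW.
rewrite (_ : [set u | _] = (fun u : 'rV[R]_m => `|u|) @^-1` [set 1]).
  by apply: closed_comp => [u _|]; [exact: norm_continuous|exact: closed_eq].
by apply/seteqP; split.
Qed.

(** The constant is the minimum of the form on the compact unit sphere; homogeneity does the
    rest. *)
Lemma bilin_lower_bound A : (forall w, w != 0 -> 0 < bilin A w w) ->
  exists2 l : R, 0 < l & forall u, l * `|u| ^+ 2 <= bilin A u u.
Proof.
move=> Ap; pose S : set 'rV[R]_n := [set u | `|u| = 1].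
have norm1 u : u != 0 -> S (`|u|^-1 *: u).
  by move=> u0; rewrite /S /= normrZ normfV normr_id mulVf// normr_eq0.
(* In dimension 0 the unit sphere is empty and there is no minimum to take. *)
have [S0|/set0P[u1 Su1]] := eqVneq S set0.
  exists 1 => // u; have [->|u0] := eqVneq u 0.
    by rewrite normr0 bilin0l expr0n mulr0.
  by have := norm1 _ u0; rewrite S0.
have Sc : compact S by exact: compact_sphere.
have bc : continuous (fun u => bilin A u u).
  move=> u; rewrite (_ : (fun u => _) = fun u : 'rV[R]_n => \sum_i \sum_j u 0 j * A j i * u 0 i); last first.
    by apply/funext => w; rewrite bilinE.
  have cc j : (fun w : 'rV[R]_n => w 0 j) w @[w --> u] --> u 0 j.
    exact: coord_continuous.
  apply: continuous_sum => i; apply: continuous_sum => j.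
  have h1 : (fun w : 'rV[R]_n => w 0 j * A j i) w @[w --> u] --> u 0 j * A j i.
    by apply: cvgM (cc j) _; exact: cvg_cst.
  exact: cvgM h1 (cc i).
have [w Sw wmin] := @EVT_min_rV R n (fun u => bilin A u u) S (ex_intro _ _ Su1) Sc (continuous_subspaceT bc).
have w0 : w != 0.
  apply/eqP => w0; move: Sw; rewrite inE /S /= w0 normr0 => /eqP.
  by rewrite eq_sym oner_eq0.
exists (bilin A w w); first exact: Ap.
move=> u; have [->|u0] := eqVneq u 0.
  by rewrite normr0 bilin0l expr0n mulr0.
have := wmin _ (mem_set (norm1 _ u0)).
have up : 0 < `|u| by rewrite normr_gt0.
rewrite bilinZl bilinZr mulrA -expr2 exprVn mulrC ler_pdivlMr ?exprn_gt0//.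
Qed.

(** The lower bound for the form at [y0] turns the absolute error of the matrices into a relative
    error, uniform in u. *)
Lemma near_bilin (G : 'rV[R]_n -> 'M[R]_n) y0 :
  {for y0, continuous G} -> (forall w, w != 0 -> 0 < bilin (G y0) w w) ->
  forall e : R, 0 < e -> \forall y \near y0, forall u,
    `|bilin (G y) u u - bilin (G y0) u u| <= e * bilin (G y0) u u.
Proof.
move=> Gc Gp e e0; have [l l0 lG] := bilin_lower_bound Gp.
pose N : R := (n * n).+1%:R.
have d0 : 0 < e * l / N by rewrite divr_gt0// mulr_gt0.
have /cvgrPdist_le /(_ _ d0) := Gc.
apply: filterS => y Gy u; rewrite -bilinBmx.
apply: le_trans (bilin_norm _ _ _) _.
apply: (@le_trans _ _ (e * (l * `|u| ^+ 2))); last by rewrite ler_pM2l.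
rewrite -mulrA -expr2 mulrA ler_wpM2r// ?exprn_ge0//.
rewrite distrC in Gy; apply: (@le_trans _ _ (N * (e * l / N))).
    rewrite ler_pM// ler_nat; exact: leqnSn.
by rewrite mulrC divfK// pnatr_eq0.
Qed.

End Bilinear.

(** * Integrals of real functions over intervals *)

Section Integration.
Context {R : realType}.
Notation mu := (@lebesgue_measure R).
Implicit Types f g : R -> R.

Lemma integrable_itv_cat f (a x b : R) : a <= x -> x <= b ->
  mu.-integrable `[a, x] (EFin \o f) -> mu.-integrable `[x, b] (EFin \o f) ->
  mu.-integrable `[a, b] (EFin \o f).
Proof.
move=> ax xb /integrableP[/measurable_EFinP m1 i1].
move=> /integrableP[/measurable_EFinP m2 i2].
have E : `[a, b]%classic = `[a, x] `|` `]x, b].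
  apply/seteqP; split => t /=; rewrite !in_itv /=.
    move=> /andP[at_ tb]; have [tx|xt] := leP t x.
      by left; apply/andP; split.
    by right; apply/andP; split.
  case=> /andP[t1 t2]; rewrite ?t1 ?t2 ?(le_trans t2 xb)//= ?andbT//.
  exact: le_trans ax (ltW t1).
have sub : `]x, b]%classic `<=` `[x, b].
  by move=> t /=; rewrite !in_itv /= => /andP[/ltW -> ->].
have m2' : measurable_fun `]x, b] f by exact: measurable_funS sub m2.
have mf : measurable_fun `[a, b] f by rewrite E; apply/measurable_funU.
apply/integrableP; split; first exact/measurable_EFinP.
rewrite E ge0_integral_setU//=.
- apply: lte_add_pinfty => //; apply: le_lt_trans i2.
  apply: ge0_subset_integral => //=.
  by apply/measurable_EFinP; exact: measurableT_comp.
- by apply/measurable_EFinP; rewrite -E; exact: measurableT_comp.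
- apply/disj_setPS => t /= []; rewrite !in_itv /= => /andP[_ tx] /andP[xt _].
  by move: (lt_le_trans xt tx); rewrite ltxx.
Qed.

(** The end points are a null set. A piecewise smooth curve and a smooth extension of one of its
    pieces have equal germs, hence equal speeds, only inside the interval. *)
Lemma eq_open_Rintegral f g (a b : R) : mu.-integrable `[a, b] (EFin \o f) ->
  {in `]a, b[, f =1 g} -> mu.-integrable `[a, b] (EFin \o g) /\
  \int[mu]_(t in `[a, b]) g t = \int[mu]_(t in `[a, b]) f t.
Proof.
move=> /[dup] fi /integrableP[/measurable_EFinP mf ifoo] fg.
have sub : `]a, b[%classic `<=` `[a, b] by exact: subset_itv_oo_cc.
have mfo : measurable_fun `]a, b[ f by exact: measurable_funS sub mf.
have mgo : measurable_fun `]a, b[ g.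
  by apply: eq_measurable_fun mfo => t /[!inE] tab; exact: fg.
have mg : measurable_fun `[a, b] g by exact: measurable_fun_itv_cc mgo.
split; last first.
  congr fine; apply/esym; exact: eq_integral_itv_bounded.
apply/integrableP; split; first exact/measurable_EFinP.
have <- : (\int[mu]_(x in `[a, b]) `|f x|%:E = \int[mu]_(x in `[a, b]) `|g x|%:E)%E.
  apply: eq_integral_itv_bounded.
  - exact: measurableT_comp.
  - exact: measurableT_comp.
  - by move=> t tab; rewrite fg.
exact: ifoo.
Qed.

Lemma Rintegral_itv_cat f (a x b : R) : a <= x -> x <= b ->
  mu.-integrable `[a, b] (EFin \o f) ->
  \int[mu]_(t in `[a, b]) f t =
  \int[mu]_(t in `[a, x]) f t + \int[mu]_(t in `[x, b]) f t.
Proof.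
move=> ax xb fi.
have /(_ ax xb) := @Rintegral_itvB R f (BLeft a) (BRight b) x fi.
rewrite Rintegral_itv_obnd_cbnd => [<-|]; first by rewrite addrC subrK.
apply: integrableS fi => // t /=; rewrite !in_itv /= => /andP[xt ->].
by rewrite andbT (le_trans ax)// ltW.
Qed.

Lemma Rintegral_shift f (a b s : R) : a <= b ->
  {within `[a, b], continuous f} ->
  \int[mu]_(t in `[a, b]) f t = \int[mu]_(t in `[a - s, b - s]) f (t + s).
Proof.
move=> ab fc; pose F (t : R) := t + s.
have FE : F = id + cst s by apply/funext.
have F1 : derive1 F = cst 1.
  apply/funext => t; rewrite derive1E.
  by rewrite FE deriveD// derive_id derive_cst addr0.
have Fc : continuous F by move=> t; apply: cvgD; [exact: cvg_id|exact: cvg_cst].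
have Fa : F (a - s) = a by rewrite /F subrK.
have Fb : F (b - s) = b by rewrite /F subrK.
rewrite /Rintegral; congr fine.
have := @integration_by_substitution_increasing R F f (a - s) (b - s).
rewrite Fa Fb F1 => ->//.
- by apply: eq_integral => t _ /=; rewrite mulr1.
- by rewrite lerB.
- by move=> t u _ _ tu; rewrite /F ltrD2r.
- by move=> t _; exact: cvg_cst.
- exact: is_cvg_cst.
- exact: is_cvg_cst.
- split => //.
  + by apply: cvg_at_right_filter; exact: Fc.
  + by apply: cvg_at_left_filter; exact: Fc.
Qed.

End Integration.

(** * Speed and length of piecewise smooth curves *)

Section Broken.
Context {R : realType} {n : nat} {M : riemannianType R n}.
Notation mu := (@lebesgue_measure R).
Implicit Types (phi psi : chart R n M) (x : M) (c : R -> M).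

Lemma gram_continuous phi y : atlas phi -> chart_img phi y ->
  {for y, continuous (gram phi)}.
Proof. by move=> aphi iy; exact: (gram_smooth phi aphi 0%N). Qed.

Lemma bilin_gram_ge0 phi y w : atlas phi -> chart_img phi y ->
  0 <= bilin (gram phi y) w w.
Proof.
move=> aphi iy; have [->|w0] := eqVneq w 0; first by rewrite bilin0l.
by apply/ltW/gram_pos.
Qed.

Lemma speed_ge0 c t : 0 <= speed c t.
Proof. exact: sqrtr_ge0. Qed.

(** [speed] reads the velocity in a chart that changes with t; by [gram_change] it can be computed
    in one fixed chart, where continuity and integration make sense. *)
Lemma speed_chart phi c t : atlas phi -> {for t, continuous c} ->
  chart_dom phi (c t) -> differentiable (phi \o c) t ->
  speed c t = Num.sqrt (bilin (gram phi (phi (c t)))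
    (derive1 (phi \o c) t) (derive1 (phi \o c) t)).
Proof.
move=> aphi cc pc dc; rewrite /speed /inner /velocity.
have [_ ->] := curve_transition aphi (chart_at_atlas (c t)) cc pc (chart_at_dom (c t)) dc.
congr Num.sqrt; apply/esym; apply: gram_change => //.
  exact: chart_at_atlas.
exact: chart_at_dom.
Qed.

Lemma eq_speed c c' t : {near t, c =1 c'} -> speed c t = speed c' t.
Proof.
move=> cc'; have ct := nbhs_singleton cc'.
have v : velocity c t = velocity c' t.
  rewrite /velocity ct !derive1E; apply: near_eq_derive.
  by apply: filterS cc' => s /= ->.
by rewrite /speed v ct.
Qed.

Lemma speed_continuous (U : set R) c t : open U -> smooth_curve U c -> U t ->
  {for t, continuous (speed c)}.
Proof.
move=> Uo cs Ut; pose phi := chart_at (c t).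
have aphi : atlas phi by exact: chart_at_atlas.
have pt : chart_dom phi (c t) by exact: chart_at_dom.
have cc := smooth_curve_continuous cs.
pose s := fun t => Num.sqrt (bilin (gram phi (phi (c t)))
  (derive1 (phi \o c) t) (derive1 (phi \o c) t)).
have ns : {near t, s =1 speed c}.
  have Oo := open_preimage_on Uo (chart_open phi) cc.
  have : \forall r \near t, (U `&` c @^-1` chart_dom phi) r.
    exact: open_nbhs_nbhs.
  apply: filterS => r [Ur pr].
  have [dr _ _] := smooth_curve_chart cs aphi Ur pr.
  by rewrite (speed_chart aphi (cc _ Ur) pr dr).
have [dt d't _] := smooth_curve_chart cs aphi Ut pt.
have sc : {for t, continuous s}.
  apply: continuous_comp; last exact: sqrt_continuous.
  rewrite (_ : (fun t => _) = (fun r => \sum_i \sum_j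
      derive1 (phi \o c) r 0 j * gram phi (phi (c r)) j i * derive1 (phi \o c) r 0 i)); last first.
    by apply/funext => r; rewrite bilinE.
  have g'c i : {for t, continuous (fun r => derive1 (phi \o c) r 0 i)}.
    by have /mx_continuousP := d't; apply.
  have gc : {for t, continuous (gram phi \o (phi \o c))}.
    apply: continuous_comp; first exact: differentiable_continuous.
    by apply: gram_continuous => //; exists (c t).
  apply: continuous_sum => i; apply: continuous_sum => j.
  apply: (@cvgM _ _ _ _ (fun r => derive1 (phi \o c) r 0 j * gram phi (phi (c r)) j i)
    (fun r => derive1 (phi \o c) r 0 i)); last exact: g'c.
  apply: (@cvgM _ _ _ _ (fun r => derive1 (phi \o c) r 0 j)
    (fun r => gram phi (phi (c r)) j i)); first exact: g'c.
  by have /mx_continuousP := gc; apply.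
have st := nbhs_singleton ns; move: s sc ns st; clear => s sc ns st.
rewrite /prop_for /continuous_at -st; apply: cvg_trans sc.
exact: near_eq_cvg ns.
Qed.

Lemma mem_widen (a b e t : R) : 0 < e -> t \in `[a, b] ->
  `]a - e, b + e[%classic t.
Proof.
move=> e0; rewrite /= !in_itv /= => /andP[at_ tb].
by rewrite ltrBlDr (le_lt_trans at_) ?ltrDl// (le_lt_trans tb)// ltrDl.
Qed.

Lemma speed_within c (a b e : R) : 0 < e -> smooth_curve `]a - e, b + e[ c ->
  {within `[a, b], continuous (speed c)}.
Proof.
move=> e0 cs; apply: continuous_in_subspaceT => t /[1!inE] tab.
apply: speed_continuous cs _; first exact: interval_open.
exact: mem_widen.
Qed.

Lemma speed_integrable c (a b e : R) : 0 < e ->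
  smooth_curve `]a - e, b + e[ c -> mu.-integrable `[a, b] (EFin \o speed c).
Proof.
move=> e0 cs; apply: continuous_compact_integrable; first exact: segment_compact.
exact: speed_within cs.
Qed.

Lemma eq_length c c' (a b : R) : mu.-integrable `[a, b] (EFin \o speed c) ->
  {in `]a, b[, c =1 c'} -> mu.-integrable `[a, b] (EFin \o speed c') /\
  curve_length c' a b = curve_length c a b.
Proof.
move=> ci cc'; apply: eq_open_Rintegral ci _ => t tab.
apply: eq_speed; have : \forall s \near t, s \in `]a, b[ by exact: near_in_itvoo.
by apply: filterS => s; exact: cc'.
Qed.

Lemma smooth_segment_ext c (a b : R) : smooth_segment c a b ->
  exists c' e, [/\ 0 < e, smooth_curve `]a - e, b + e[ c',
    {in `[a, b], c =1 c'}, mu.-integrable `[a, b] (EFin \o speed c) &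
    curve_length c a b = curve_length c' a b].
Proof.
move=> [c' [e [e0 c's cc']]]; exists c', e.
have c'i := speed_integrable e0 c's.
have [|ci cl] := eq_length (c' := c) c'i.
  by move=> t tab; rewrite cc'//; exact: subset_itv_oo_cc.
by split.
Qed.

Lemma smooth_segment_sub c (a b a' b' : R) : a <= a' -> b' <= b ->
  smooth_segment c a b -> smooth_segment c a' b'.
Proof.
move=> aa bb [c' [e [e0 c's cc']]]; exists c', e; split => //.
  apply: smooth_curve_subset c's => t /=; rewrite !in_itv /= => /andP[t1 t2].
  by rewrite (le_lt_trans _ t1) ?lerB// (lt_le_trans t2)// lerD.
move=> t; rewrite in_itv /= => /andP[t1 t2].
by apply: cc'; rewrite in_itv /= (le_trans aa)// (le_trans t2).
Qed.

Lemma eq_smooth_segment c1 c2 (a b : R) : {in `[a, b], c1 =1 c2} ->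
  smooth_segment c1 a b -> smooth_segment c2 a b.
Proof.
move=> c12 [c' [e [e0 c's cc']]]; exists c', e; split => // t tab.
by rewrite -c12// cc'.
Qed.

(* [piecewise_smooth] without reference to a partition. *)
Inductive broken c : R -> R -> Prop :=
| broken_one (a b : R) : a < b -> smooth_segment c a b -> broken c a b
| broken_cons (a x b : R) : a < x -> smooth_segment c a x -> broken c x b -> broken c a b.

Lemma broken_lt c (a b : R) : broken c a b -> a < b.
Proof. by elim=> // {}a x {}b ax _ _ xb; exact: lt_trans xb. Qed.

Lemma piecewise_broken c (a b : R) : a < b -> piecewise_smooth c a b -> broken c a b.
Proof.
move=> ab [s sab cs]; elim: s a ab sab cs => [|x s IH] a ab sab cs.
  by have := itv_partition_nil sab => abE; rewrite abE ltxx in ab.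
have ax : a < x by case: sab => /= /andP[].
have sx : smooth_segment c a x by exact: (cs 0%N).
have xb := itv_partition_cons sab.
case: s IH xb cs {sab} => [|y s] IH xb cs.
  have /= xE := itv_partition_nil xb; rewrite -xE.
  exact: broken_one.
have xltb : x < b by apply: itv_partition_size_neq0 xb.
apply: broken_cons ax sx (IH _ xltb xb _) => i si.
exact: (cs i.+1).
Qed.

Lemma broken_piecewise c (a b : R) : broken c a b -> piecewise_smooth c a b.
Proof.
elim=> [{}a {}b ab cs|{}a x {}b ax cs _ [s sx IH]].
  by exists [:: b]; [exact: itv_partition1|case].
exists (x :: s); last by case=> [|i] //= si; exact: IH.
by case: sx => px lx; split => //=; rewrite ax.
Qed.

Lemma broken_cat c (a x b : R) : broken c a x -> broken c x b -> broken c a b.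
Proof.
move=> cax; elim: cax b => [{}a {}x ax cs b|{}a y {}x ay cs _ IH b xb].
  exact: broken_cons.
by apply: broken_cons ay cs _; exact: IH.
Qed.

Lemma broken_sub c (a b a' b' : R) : broken c a b -> a <= a' -> a' < b' -> b' <= b ->
  broken c a' b'.
Proof.
move=> cab; elim: cab a' b' => [{}a {}b ab cs|{}a x {}b ax cs xb IH] a' b' aa ab' bb.
  by apply: broken_one => //; exact: smooth_segment_sub cs.
have [bx|xb'] := leP b' x.
  by apply: broken_one => //; exact: smooth_segment_sub cs.
have [xa|ax'] := leP x a'; first exact: IH.
apply: (@broken_cons _ _ x) => //; first exact: smooth_segment_sub cs.
exact: IH.
Qed.

Lemma eq_broken c1 c2 (a b : R) : {in `[a, b], c1 =1 c2} -> broken c1 a b ->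
  broken c2 a b.
Proof.
move=> c12 cab; elim: cab c12 => [{}a {}b ab cs|{}a x {}b ax cs xb IH] c12.
  by apply: broken_one => //; exact: eq_smooth_segment cs.
have xltb := broken_lt xb.
apply: (@broken_cons _ _ x) => //.
  apply: eq_smooth_segment cs => t; rewrite in_itv /= => /andP[t1 t2].
  by apply: c12; rewrite in_itv /= t1 (le_trans t2)// ltW.
apply: IH => t; rewrite in_itv /= => /andP[t1 t2].
by apply: c12; rewrite in_itv /= t2 (le_trans _ t1)// ltW.
Qed.

Lemma broken_integrable c (a b : R) : broken c a b ->
  mu.-integrable `[a, b] (EFin \o speed c).
Proof.
elim=> [{}a {}b ab /smooth_segment_ext[c' [e []]]//|].
move=> {}a x {}b ax /smooth_segment_ext[c' [e [_ _ _ ci _]]] xb IH.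
by apply: integrable_itv_cat ci IH; apply: ltW => //; exact: broken_lt xb.
Qed.

Lemma length_cat c (a x b : R) : broken c a b -> a <= x -> x <= b ->
  curve_length c a b = curve_length c a x + curve_length c x b.
Proof.
by move=> cab ax xb; apply: Rintegral_itv_cat => //; exact: broken_integrable.
Qed.

Lemma length_ge0 c (a b : R) : 0 <= curve_length c a b.
Proof. by apply: Rintegral_ge0 => t _; exact: speed_ge0. Qed.

Lemma length_le c (a b a' b' : R) : broken c a b -> a <= a' -> a' <= b' -> b' <= b ->
  curve_length c a' b' <= curve_length c a b.
Proof.
move=> cab aa ab' bb; have [->|a'b'] := eqVneq a' b'.
  by rewrite {1}/curve_length set_itv1 Rintegral_set1 length_ge0.
have ltab : a' < b' by rewrite lt_neqAle a'b'.
rewrite (length_cat cab aa (le_trans ab' bb)).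
apply: le_trans (_ : curve_length c a' b <= _); last by rewrite lerDr length_ge0.
have cab' : broken c a' b by apply: broken_sub cab _ _ _ => //; exact: lt_le_trans bb.
by rewrite (length_cat cab' ab' bb) lerDl length_ge0.
Qed.

Lemma eq_broken_length c1 c2 (a b : R) : {in `[a, b], c1 =1 c2} -> broken c1 a b ->
  curve_length c2 a b = curve_length c1 a b.
Proof.
move=> c12 /broken_integrable ci; have [] // := eq_length ci (c' := c2).
by move=> t tab; apply: c12; exact: subset_itv_oo_cc.
Qed.

(** The curve is arbitrary outside [a, b], so continuity holds only relative to the interval and is
    stated with explicit radii. At a break point the radii of both sides are combined. *)
Lemma broken_continuous c (a b t : R) (A : set M) : broken c a b -> t \in `[a, b] ->
  nbhs (c t) A -> exists2 d : R, 0 < d &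
  forall s, s \in `[a, b] -> `|s - t| < d -> A (c s).
Proof.
have one a' b' s : smooth_segment c a' b' -> s \in `[a', b'] ->
    nbhs (c s) A -> exists2 d : R, 0 < d &
    forall s', s' \in `[a', b'] -> `|s' - s| < d -> A (c s').
  move=> [c' [e [e0 c's cc']]] sab; rewrite cc'// => nA.
  have c'c := smooth_curve_continuous c's (mem_widen e0 sab).
  have /nbhs_ballP[d d0 dA] := c'c _ nA.
  exists d => // s' s'ab s's; rewrite cc'//; apply: dA.
  by rewrite /ball /= distrC.
elim=> [{}a {}b ab cs|{}a x {}b ax cs xb IH]; first exact: one.
rewrite in_itv /= => /andP[at_ tb] nA; have xltb := broken_lt xb.
have [tx|xt|tx] := ltgtP t x.
- have tax : t \in `[a, x] by rewrite in_itv /= at_ ltW.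
  have [d d0 dA] := one _ _ _ cs tax nA.
  exists (Num.min d (x - t)); first by rewrite lt_min d0 subr_gt0.
  move=> s; rewrite in_itv /= => /andP[as_ sb]; rewrite lt_min => /andP[sd sx].
  apply: dA => //; rewrite in_itv /= as_ /=.
  by have := ler_norm (s - t); lra.
- have txb : t \in `[x, b] by rewrite in_itv /= tb ltW.
  have [d d0 dA] := IH txb nA.
  exists (Num.min d (t - x)); first by rewrite lt_min d0 subr_gt0.
  move=> s; rewrite in_itv /= => /andP[as_ sb]; rewrite lt_min => /andP[sd sx].
  apply: dA => //; rewrite in_itv /= sb andbT.
  by have := ler_norm (t - s); rewrite distrC; lra.
have tax : t \in `[a, x] by rewrite in_itv /= at_ tx lexx.
have txb : t \in `[x, b] by rewrite in_itv /= tb tx lexx.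
have [d d0 dA] := one _ _ _ cs tax nA.
have [d' d'0 d'A] := IH txb nA.
exists (Num.min d d'); first by rewrite lt_min d0.
move=> s; rewrite in_itv /= => /andP[as_ sb]; rewrite lt_min => /andP[sd sd'].
have [sx|xs] := leP s x.
  by apply: dA; rewrite // in_itv /= as_.
by apply: d'A; rewrite // in_itv /= sb ltW.
Qed.

Lemma is_derive_functional m (g : R -> 'rV[R]_m) t (w : 'cV[R]_m) :
  differentiable g t ->
  is_derive t 1 (fun s => (g s *m w) 0 0) ((derive1 g t *m w) 0 0).
Proof.
move=> dg.
have -> : (fun s => (g s *m w) 0 0) = \sum_j (fun s => g s 0 j * w j 0).
  by apply/funext => s; rewrite fct_sumE mxE.
rewrite mxE; apply: is_derive_sum => j.
have h1 := is_derive_coord 0 j dg.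
have h2 := @is_deriveM R R (fun s => g s 0 j) (cst (w j 0)) t 1 _ _ h1 _.
apply: is_derive_eq (h2 _ (is_derive_cst _ _ _)) _.
by rewrite scaler0 add0r [LHS]mulrC.
Qed.

(** Calibration: the increment of the functional is the integral of its derivative, which is at most
    [C] times the speed at every time. The bounds of lengths by coordinates come from here, with [w]
    a coordinate functional or the covector dual to a vector. *)
Lemma segment_functional phi c (a b : R) (w : 'cV[R]_n) (C : R) : atlas phi ->
  a < b -> smooth_segment c a b ->
  (forall t, t \in `[a, b] -> chart_dom phi (c t)) ->
  (forall t u, t \in `[a, b] ->
    (u *m w) 0 0 <= C * Num.sqrt (bilin (gram phi (phi (c t))) u u)) ->
  ((phi (c b) - phi (c a)) *m w) 0 0 <= C * curve_length c a b.
Proof.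
move=> aphi ab /smooth_segment_ext[c' [e [e0 c's cc' ci ->]]] cp cC.
have aab : a \in `[a, b] by rewrite in_itv /= lexx ltW.
have bab : b \in `[a, b] by rewrite in_itv /= lexx ltW.
rewrite (cc' _ aab) (cc' _ bab).
pose f t := (derive1 (phi \o c') t *m w) 0 0.
pose F t := ((phi (c' t)) *m w) 0 0.
have c'p t : t \in `[a, b] -> chart_dom phi (c' t).
  by move=> tab; rewrite -cc'//; exact: cp.
have dF t : t \in `[a, b] -> is_derive t 1 F (f t).
  move=> tab; apply: is_derive_functional.
  by have [] := smooth_curve_chart c's aphi (mem_widen e0 tab) (c'p _ tab).
have Fc t : t \in `[a, b] -> {for t, continuous F}.
  move=> tab; apply: differentiable_continuous; apply/derivable1_diffP.
  by have [] := dF t tab.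
have fc : {within `[a, b], continuous f}.
  apply: continuous_in_subspaceT => t /[1!inE] tab.
  have [_ d'c _] := smooth_curve_chart c's aphi (mem_widen e0 tab) (c'p _ tab).
  rewrite (_ : f = fun t => \sum_j derive1 (phi \o c') t 0 j * w j 0); last first.
    by apply/funext => s; rewrite /f mxE.
  apply: continuous_sum => j.
  apply: (@cvgM _ _ _ _ (fun r => derive1 (phi \o c') r 0 j) (cst (w j 0))).
    by have /mx_continuousP := d'c; apply.
  exact: cvg_cst.
have fi : mu.-integrable `[a, b] (EFin \o f).
  by apply: continuous_compact_integrable fc; exact: segment_compact.
have si := speed_integrable e0 c's.
have FTC : \int[mu]_(t in `[a, b]) f t = F b - F a.
  rewrite /Rintegral (@continuous_FTC2 R f F a b ab fc)//.
    split=> [t tab||].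
    - by have [] := dF t (subset_itv_oo_cc tab).
    - by apply: cvg_at_right_filter; exact: Fc.
    - by apply: cvg_at_left_filter; exact: Fc.
  move=> t tab; rewrite derive1E.
  by have [_ ->] := dF t (subset_itv_oo_cc tab).
have -> : ((phi (c' b) - phi (c' a)) *m w) 0 0 = F b - F a.
  by rewrite /F mulmxBl !mxE.
rewrite -FTC /curve_length -RintegralZl//; apply: le_Rintegral => //.
  apply: continuous_compact_integrable; first exact: segment_compact.
  apply: continuous_in_subspaceT => t /[1!inE] tab.
  apply: (@cvgM _ _ _ _ (cst C) (speed c')); first exact: cvg_cst.
  exact: (speed_continuous (@interval_open _ _ _ _ _) c's (mem_widen e0 tab)).
move=> t /= tab; have tI := mem_widen e0 tab.
have [dc _ _] := smooth_curve_chart c's aphi tI (c'p _ tab).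
rewrite (speed_chart aphi (smooth_curve_continuous c's tI) (c'p _ tab) dc).
by rewrite -(cc' _ tab); exact: cC.
Qed.

Lemma length_functional phi c (a b : R) (w : 'cV[R]_n) (C : R) : atlas phi ->
  broken c a b -> (forall t, t \in `[a, b] -> chart_dom phi (c t)) ->
  (forall t u, t \in `[a, b] ->
    (u *m w) 0 0 <= C * Num.sqrt (bilin (gram phi (phi (c t))) u u)) ->
  ((phi (c b) - phi (c a)) *m w) 0 0 <= C * curve_length c a b.
Proof.
move=> aphi; elim=> [{}a {}b ab cs|{}a x {}b ax cs xb IH] cp cC.
  exact: segment_functional.
have xltb := broken_lt xb.
have cab : broken c a b by exact: broken_cons xb.
have s1 t : t \in `[a, x] -> t \in `[a, b].
  by rewrite !in_itv /= => /andP[-> /= tx]; rewrite (le_trans tx)// ltW.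
have s2 t : t \in `[x, b] -> t \in `[a, b].
  by rewrite !in_itv /= => /andP[xt ->]; rewrite andbT (le_trans _ xt)// ltW.
rewrite (length_cat cab (ltW ax) (ltW xltb)) mulrDr.
have -> : phi (c b) - phi (c a) = (phi (c x) - phi (c a)) + (phi (c b) - phi (c x)).
  by rewrite [RHS]addrC subrKA.
rewrite mulmxDl mxE lerD//.
  by apply: segment_functional => // [t /s1|t u /s1]; [exact: cp|exact: cC].
by apply: IH => [t /s2|t u /s2]; [exact: cp|exact: cC].
Qed.

End Broken.

(** * Isometries and the distance of orbits *)

Section Isometries.
Context {R : realType} {n : nat} {M : riemannianType R n}.
Implicit Types (phi psi : chart R n M) (x : M) (c : R -> M) (f : M -> M).

Lemma isometry_smooth f : riemannian_isometry f -> smooth_map f.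
Proof. by case. Qed.

Lemma isometry_speed f (U : set R) c t : riemannian_isometry f ->
  smooth_curve U c -> U t -> speed (f \o c) t = speed c t.
Proof.
move=> [_ fs fi] cs Ut; have cc := smooth_curve_continuous cs Ut.
have [dc _ _] := smooth_curve_chart cs (chart_at_atlas (c t)) Ut (chart_at_dom (c t)).
have [_ v] := curve_map fs (chart_at_atlas (c t)) (chart_at_atlas (f (c t))) cc
  (chart_at_dom (c t)) (chart_at_dom (f (c t))) dc.
have v' : velocity (f \o c) t = tangent_map f (c t) (velocity c t) := v.
by rewrite /speed v' fi.
Qed.

Lemma isometry_segment f c (a b : R) : a < b -> riemannian_isometry f ->
  smooth_segment c a b ->
  smooth_segment (f \o c) a b /\ curve_length (f \o c) a b = curve_length c a b.
Proof.
move=> ab fi /smooth_segment_ext[c' [e [e0 c's cc' ci ->]]].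
have fc's : smooth_curve `]a - e, b + e[ (f \o c').
  by apply: (smooth_map_curve _ (isometry_smooth fi) c's); exact: interval_open.
have sfc : smooth_segment (f \o c) a b.
  by exists (f \o c'), e; split => // t tab /=; rewrite cc'.
split; first exact: sfc.
have [|_ ->] := eq_length (c := f \o c') (c' := f \o c) (speed_integrable e0 fc's).
  by move=> t tab /=; rewrite cc'//; exact: subset_itv_oo_cc.
apply: eq_Rintegral => t /[!inE] tab.
by apply: isometry_speed fi c's _; exact: mem_widen.
Qed.

Lemma isometry_broken f c (a b : R) : riemannian_isometry f -> broken c a b ->
  broken (f \o c) a b /\ curve_length (f \o c) a b = curve_length c a b.
Proof.
move=> fi; elim=> [{}a {}b ab cs|{}a x {}b ax cs xb [fxb Lxb]].
  have [fcs fL] := isometry_segment ab fi cs.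
  by split; [exact: broken_one|exact: fL].
have [fcs fL] := isometry_segment ax fi cs.
have fab : broken (f \o c) a b by exact: broken_cons fcs fxb.
have cab : broken c a b by exact: broken_cons cs xb.
have ltxb := broken_lt xb; split; first exact: fab.
rewrite (length_cat fab (ltW ax) (ltW ltxb)) fL Lxb.
by rewrite -(length_cat cab (ltW ax) (ltW ltxb)).
Qed.

Lemma derive1_shift (V : normedModType R) (g : R -> V) (s t : R) :
  derive1 (fun t : R => g (t + s)) t = derive1 g (t + s).
Proof.
have E : (fun h : R => h^-1 *: (g (h + (t + s)) - g (t + s))) =
    (fun h : R => h^-1 *: (g (h + t + s) - g (t + s))).
  by apply/funext => h; rewrite addrA.
by rewrite /derive1 E.
Qed.

Lemma speed_shift c (s t : R) : speed (fun t : R => c (t + s)) t = speed c (t + s).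
Proof.
have v : velocity (fun t : R => c (t + s)) t = velocity c (t + s).
  exact: (@derive1_shift _ (chart_at (c (t + s)) \o c : R -> 'rV[R]_n) s t).
by rewrite /speed v.
Qed.

Lemma segment_shift c (a b s : R) : a < b -> smooth_segment c a b ->
  smooth_segment (fun t : R => c (t + s)) (a - s) (b - s) /\
  curve_length (fun t : R => c (t + s)) (a - s) (b - s) = curve_length c a b.
Proof.
move=> ab /smooth_segment_ext[c' [e [e0 c's cc' ci ->]]].
have tabs t : t \in `[a - s, b - s] -> t + s \in `[a, b].
  by rewrite !in_itv /= lerBlDr lerBrDr.
have sc's : smooth_curve `](a - s) - e, (b - s) + e[ (fun t : R => c' (t + s)).
  have oI : open `]a - e, b + e[%classic by exact: interval_open.
  have sub : `](a - s) - e, (b - s) + e[%classic `<=`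
      (fun t : R => t + s) @^-1` `]a - e, b + e[.
    by move=> t /=; rewrite !in_itv /= => /andP[t1 t2]; apply/andP; split; lra.
  exact: smooth_curve_subset sub (smooth_curve_shift s oI c's).
split.
  exists (fun t : R => c' (t + s)), e; split => // t tab.
  by rewrite cc'//; exact: tabs.
have [|_ ->] := eq_length (c := fun t : R => c' (t + s))
    (c' := fun t : R => c (t + s)) (speed_integrable e0 sc's).
  by move=> t tab; rewrite cc'//; apply: tabs; exact: subset_itv_oo_cc.
rewrite /curve_length (@Rintegral_shift _ _ a b s (ltW ab) (speed_within e0 c's)).
by apply: eq_Rintegral => t _; rewrite speed_shift.
Qed.

Lemma broken_shift c (a b s : R) : broken c a b ->
  broken (fun t : R => c (t + s)) (a - s) (b - s) /\
  curve_length (fun t : R => c (t + s)) (a - s) (b - s) = curve_length c a b.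
Proof.
elim=> [{}a {}b ab cs|{}a x {}b ax cs xb [fxb Lxb]].
  have [fcs fL] := segment_shift s ab cs.
  by split; [apply: broken_one; rewrite ?ltrD2r|exact: fL].
have [fcs fL] := segment_shift s ax cs.
have ax' : a - s < x - s by rewrite ltrD2r.
have fab := broken_cons ax' fcs fxb.
have cab : broken c a b by exact: broken_cons cs xb.
have ltxb := broken_lt xb; split; first exact: fab.
have xb' : x - s <= b - s by rewrite lerD2r ltW.
rewrite (length_cat fab (ltW ax') xb') fL Lxb.
by rewrite -(length_cat cab (ltW ax) (ltW ltxb)).
Qed.

(** The second curve is translated in time so that its parameter starts at [b1]. *)
Lemma broken_concat c1 c2 (a1 b1 a2 b2 : R) : broken c1 a1 b1 ->
  broken c2 a2 b2 -> c1 b1 = c2 a2 ->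
  exists c (b : R), [/\ broken c a1 b, c a1 = c1 a1, c b = c2 b2 &
    curve_length c a1 b = curve_length c1 a1 b1 + curve_length c2 a2 b2].
Proof.
move=> c1b c2b c12; have ab1 := broken_lt c1b; have ab2 := broken_lt c2b.
pose s := a2 - b1; have [c2s L2] := broken_shift s c2b.
have a2s : a2 - s = b1 by rewrite /s opprB addrC subrK.
rewrite a2s in c2s L2.
pose c t := if t <= b1 then c1 t else c2 (t + s).
have cc1 : {in `[a1, b1], c1 =1 c}.
  by move=> t; rewrite in_itv /= /c => /andP[_ ->].
have cc2 : {in `[b1, b2 - s], (fun t : R => c2 (t + s)) =1 c}.
  move=> t; rewrite in_itv /= /c => /andP[b1t _]; case: leP => tb1; last by reflexivity.
  have -> : t = b1 by apply/eqP; rewrite eq_le tb1.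
  by rewrite c12 /s addrC subrK.
have bs : b1 < b2 - s by exact: broken_lt c2s.
have cab : broken c a1 (b2 - s).
  apply: broken_cat (eq_broken cc1 c1b) (eq_broken cc2 c2s).
exists c, (b2 - s); split; first exact: cab.
- by rewrite /c ltW.
- by rewrite /c leNgt bs /= subrK.
rewrite (length_cat cab (ltW ab1) (ltW bs)).
by rewrite (eq_broken_length cc1 c1b) (eq_broken_length cc2 c2s) L2.
Qed.

End Isometries.

(** * The distance of two sets as an infimum of lengths *)

Section SetDist.
Context {R : realType} {n : nat} {M : riemannianType R n}.
Implicit Types (A B C : set M) (c : R -> M).

(** The infimum of an empty set of reals is 0 by default; this predicate excludes that case wherever
    nearly minimal curves are needed. *)
Definition joined A B := exists c (a b : R), [/\ broken c a b, A (c a) & B (c b)].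

Lemma set_dist_le A B c (a b : R) : broken c a b -> A (c a) -> B (c b) ->
  set_dist A B <= curve_length c a b.
Proof.
move=> cab Aa Bb; apply: ge_inf.
  exists 0 => l [c' [a' [b' [_ _ _ _ ->]]]]; exact: length_ge0.
exists c, a, b; split => //; first exact: broken_lt cab.
exact: broken_piecewise.
Qed.

Lemma set_dist_adherent A B (e : R) : 0 < e -> joined A B ->
  exists c (a b : R), [/\ broken c a b, A (c a), B (c b) &
    curve_length c a b < set_dist A B + e].
Proof.
move=> e0 [c [a [b [cab Aa Bb]]]].
have hi : has_inf [set l | exists (c : R -> M) (a b : R),
    [/\ a < b, piecewise_smooth c a b, A (c a), B (c b) &
        l = curve_length c a b]].
  split.
    exists (curve_length c a b), c, a, b; split => //; first exact: broken_lt cab.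
    exact: broken_piecewise.
  by exists 0 => l [c' [a' [b' [_ _ _ _ ->]]]]; exact: length_ge0.
have [l [c' [a' [b' [ab' c's Aa' Bb' ->]]]] ll] := inf_adherent e0 hi.
by exists c', a', b'; split => //; exact: piecewise_broken.
Qed.

Lemma le_set_dist A B (l : R) : joined A B ->
  (forall c (a b : R), broken c a b -> A (c a) -> B (c b) ->
    l <= curve_length c a b) -> l <= set_dist A B.
Proof.
move=> AB lc; apply/ler_addgt0Pr => e e0.
have [c [a [b [cab Aa Bb /ltW]]]] := set_dist_adherent e0 AB.
exact/le_trans/lc.
Qed.

End SetDist.

(** * The triangle inequality in the orbit space *)

Section Orbits.
Context {R : realType} {n k : nat} {M : riemannianType R n}
  {G : lieGroupType R k} {act : G -> M -> M}.
Hypothesis GM : complete_riemannian_G_manifold act.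
Implicit Types x y z : M.

Lemma act1 x : act 1%g x = x. Proof. exact: Gmfd_act1. Qed.

Lemma actM g h x : act (g * h)%g x = act g (act h x).
Proof. exact: Gmfd_actM. Qed.

Lemma actK g x : act g^-1%g (act g x) = x.
Proof. by rewrite -actM mulVg act1. Qed.

Lemma actVK g x : act g (act g^-1%g x) = x.
Proof. by rewrite -actM mulgV act1. Qed.

Lemma act_isometry g : riemannian_isometry (act g).
Proof. exact: Gmfd_isometry. Qed.

Lemma Gorbit_refl x : Gorbit act x x.
Proof. by exists 1%g => //; exact: act1. Qed.

Lemma Gorbit_act g x y : Gorbit act x y -> Gorbit act x (act g y).
Proof. by move=> [h _ <-]; exists (g * h)%g => //; exact: actM. Qed.

(** Two nearly minimal curves meet the middle orbit at different points. An element of G carries the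
    second curve to the end of the first, keeping its length and the orbit of its final point. *)
Lemma orbit_triangle x y z :
  joined (Gorbit act x) (Gorbit act y) -> joined (Gorbit act y) (Gorbit act z) ->
  set_dist (Gorbit act x) (Gorbit act z) <=
  set_dist (Gorbit act x) (Gorbit act y) + set_dist (Gorbit act y) (Gorbit act z).
Proof.
move=> xy yz; apply/ler_addgt0Pr => e e0; have e2 : 0 < e / 2 by rewrite divr_gt0.
have [c1 [a1 [b1 [c1b xa1 [g1 _ yb1] l1]]]] := set_dist_adherent e2 xy.
have [c2 [a2 [b2 [c2b [g2 _ ya2] zb2 l2]]]] := set_dist_adherent e2 yz.
(* The junction points are [act g1 y] and [act g2 y]; [g] sends the latter to the former. *)
pose g := (g1 * g2^-1)%g.
have [gc2 gl2] := isometry_broken (act_isometry g) c2b.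
have glue : c1 b1 = (act g \o c2) a2 by rewrite /= -ya2 -yb1 /g actM actK.
have [c [b [cb ca1 cb2 cl]]] := broken_concat c1b gc2 glue.
apply: (@le_trans _ _ (curve_length c a1 b)).
  apply: set_dist_le cb _ _; first by rewrite ca1.
  by rewrite cb2; exact: Gorbit_act.
by apply/ltW; rewrite cl gl2 [in ltRHS](splitr e) addrACA; exact: ltrD.
Qed.

End Orbits.

(** * The distance in a chart *)

Section Confinement.
Context {R : realType}.

(** If P failed at t, the supremum of the initial segments of [a, t] on which P holds could be
    passed by [right], P being true at the supremum itself by [left]. *)
Lemma real_induction (P : R -> Prop) (a b : R) : P a ->
  (forall t, a <= t -> t < b -> (forall s, a <= s -> s <= t -> P s) ->
    exists2 d : R, 0 < d & forall s, t < s -> s < t + d -> s <= b -> P s) ->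
  (forall t, a < t -> t <= b -> (forall s, a <= s -> s < t -> P s) -> P t) ->
  forall t, a <= t -> t <= b -> P t.
Proof.
move=> Pa right left t a_t t_b; apply: contrapT => nPt.
pose S : set R := [set u | a <= u <= t /\ forall s, a <= s -> s <= u -> P s].
have Sa : S a.
  split; first by rewrite lexx.
  by move=> s as_ sa; have -> : s = a by apply/eqP; rewrite eq_le as_ sa.
have Sub : ubound S t by move=> u [/andP[_ ut] _].
have hS : has_sup S by split; [exists a|exists t].
pose m := sup S.
have am : a <= m by exact: (sup_upper_bound hS Sa).
have mt : m <= t by apply: ge_sup => //; exists a.
have Pm' s : a <= s -> s < m -> P s.
  move=> as_ sm; have e0 : 0 < m - s by rewrite subr_gt0.
  have [u [uat uP] su] := sup_adherent e0 hS.
  by apply: uP => //; apply: ltW; move: su; rewrite -/m opprB addrC subrK.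
have Pm : P m.
  have [<-//|a_m] := eqVneq a m.
  by apply: left => //; [rewrite lt_neqAle a_m|exact: le_trans mt t_b].
have Pm'' s : a <= s -> s <= m -> P s.
  move=> as_; rewrite le_eqVlt => /predU1P[->//|]; exact: Pm'.
have [mE|m_t] := eqVneq m t; first by apply: nPt; rewrite -mE.
have ltmt : m < t by rewrite lt_neqAle m_t.
have [d d0 dP] := right m am (lt_le_trans ltmt t_b) Pm''.
pose u := Num.min t (m + d / 2).
have mu_ : m < u by rewrite lt_min ltmt ltrDl divr_gt0.
have : S u.
  split; first by rewrite (le_trans am (ltW mu_))/= ge_min lexx.
  move=> s as_ su; have [sm|ms] := leP s m; first exact: Pm''.
  apply: dP => //.
    apply: (le_lt_trans su); rewrite gt_min; apply/orP; right.
    by rewrite ltrD2l ltr_pdivrMr// ltr_pMr// ltr1n.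
  by apply: (le_trans su); rewrite ge_min t_b.
move=> /(sup_upper_bound hS); rewrite -/m leNgt.
by rewrite mu_.
Qed.

(** Bootstrap: as long as the curve stays in the open set U, the estimate [step] puts it in the
    smaller closed set K, so it never leaves K. Continuity is required in the relative form given by
    [broken_continuous]. *)
Lemma confined (T : topologicalType) (c : R -> T) (a b : R) (K U : set T) :
  closed K -> open U -> K `<=` U ->
  (forall t A, t \in `[a, b] -> nbhs (c t) A -> exists2 d : R, 0 < d &
    forall s, s \in `[a, b] -> `|s - t| < d -> A (c s)) ->
  K (c a) ->
  (forall t, t \in `[a, b] -> (forall s, s \in `[a, t] -> U (c s)) -> K (c t)) ->
  forall t, t \in `[a, b] -> K (c t).
Proof.
move=> Kc Uo KU cc Ka step t; rewrite in_itv /= => /andP[a_t t_b].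
move: t a_t t_b; apply: real_induction => //.
  move=> t a_t t_b Kt; have tab : t \in `[a, b] by rewrite in_itv /= a_t ltW.
  have nU : nbhs (c t) U.
    by apply: open_nbhs_nbhs; split => //; apply: KU; exact: Kt.
  have [d d0 dU] := cc t U tab nU; exists d => // s ts sd sb.
  apply: step.
    by rewrite in_itv /= sb andbT (le_trans a_t)// ltW.
  move=> r; rewrite in_itv /= => /andP[ar rs].
  have [rt|tr] := leP r t; first by apply: KU; exact: Kt.
  apply: dU; first by rewrite in_itv /= ar (le_trans rs).
  rewrite gtr0_norm ?subr_gt0//.
  by rewrite ltrBlDl (le_lt_trans rs).
move=> t a_t t_b Ks; apply: contrapT => nK.
have tab : t \in `[a, b] by rewrite in_itv /= ltW.
have nU : nbhs (c t) (~` K) by apply: open_nbhs_nbhs; split => //; exact: closed_openC.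
have [d d0 dK] := cc t _ tab nU.
pose s := Num.max a (t - d / 2).
have st : s < t by rewrite gt_max a_t /= ltrBlDr ltrDl divr_gt0.
have as_ : a <= s by rewrite le_max lexx.
apply: (dK s); last exact: Ks.
  by rewrite in_itv /= as_ (le_trans (ltW st)).
rewrite distrC gtr0_norm ?subr_gt0// ltrBlDr -ltrBlDl lt_max; apply/orP; right.
by rewrite ltrD2l ltrN2 ltr_pdivrMr// ltr_pMr// ltr1n.
Qed.

(** Time reversal t -> a + b - t, for curves whose final point is the one known to lie in K. *)
Lemma confined_rev (T : topologicalType) (c : R -> T) (a b : R) (K U : set T) :
  closed K -> open U -> K `<=` U ->
  (forall t A, t \in `[a, b] -> nbhs (c t) A -> exists2 d : R, 0 < d &
    forall s, s \in `[a, b] -> `|s - t| < d -> A (c s)) ->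
  K (c b) ->
  (forall t, t \in `[a, b] -> (forall s, s \in `[t, b] -> U (c s)) -> K (c t)) ->
  forall t, t \in `[a, b] -> K (c t).
Proof.
move=> Kc Uo KU cc Kb step t tab; pose h (t : R) := a + b - t.
have hI s : (h s \in `[a, b]) = (s \in `[a, b]).
  by rewrite !in_itv /= /h; apply/idP/idP => /andP[s1 s2]; apply/andP; split; lra.
have hK : h (h t) = t by rewrite /h; ring.
rewrite -hK; apply: (@confined _ (c \o h) a b K U) => //.
- move=> s A sab nA; have hs : h s \in `[a, b] by rewrite hI.
  have [d d0 dA] := cc _ _ hs nA; exists d => // r rab rs.
  apply: dA; first by rewrite hI.
  by rewrite (_ : h r - h s = - (r - s)) ?normrN// /h; ring.
- by rewrite /= /h (_ : a + b - a = b)//; ring.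
- move=> s sab Us; apply: step; first by rewrite hI.
  move=> r; rewrite in_itv /= => /andP[r1 r2].
  rewrite (_ : r = h (h r)); last by rewrite /h; ring.
  apply: Us; rewrite in_itv /=; apply/andP; split; rewrite /h in r1 *; lra.
- by rewrite hI.
Qed.

End Confinement.

(** * Coordinate balls *)

Section ChartBalls.
Context {R : realType} {n : nat} {M : manifoldType R n}.
Implicit Types (phi : chart R n M) (x : M).

Lemma mx_normP m (u v : 'rV[R]_m) (d : R) : ball u d v <-> `|v - u| < d.
Proof. by rewrite mx_norm_ball /ball_ /= distrC. Qed.

Lemma compact_chart_ball phi (p : 'rV[R]_n) (r : R) :
  (forall y, `|y - p| <= r -> chart_img phi y) ->
  compact [set z | chart_dom phi z /\ `|phi z - p| <= r].
Proof.
move=> rP; pose B : set 'rV[R]_n := [set y | `|y - p| <= r].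
have -> : [set z | chart_dom phi z /\ `|phi z - p| <= r] = chart_inv phi @` B.
  apply/seteqP; split=> [z [pz zr]|_ [y yB <-]].
    by exists (phi z) => //; rewrite chart_funK.
  split; first by apply: chart_dom_inv; exact: rP.
  by rewrite chart_invK//; exact: rP.
apply: continuous_compact.
  apply: continuous_in_subspaceT => y /[1!inE] yB.
  by apply: chart_inv_continuous; exact: rP.
apply: bounded_closed_compact.
  exists (r + `|p|); split; first exact: num_real.
  move=> s rs y yB; apply: le_trans (ltW rs).
  rewrite -[X in `|X|](subrK p) (le_trans (ler_normD _ _))// lerD2r.
  exact: yB.
rewrite (_ : B = (fun y => `|y - p|) @^-1` [set t | t <= r])//.
apply: closed_comp => [y _|].
  apply: continuous_comp; last exact: norm_continuous.
  apply: differentiable_continuous; exact: differentiableB.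
exact: closed_le.
Qed.

Lemma closed_chart_ball phi (p : 'rV[R]_n) (r : R) :
  (forall y, `|y - p| <= r -> chart_img phi y) ->
  closed [set z | chart_dom phi z /\ `|phi z - p| <= r].
Proof.
move=> rP; apply: compact_closed; first exact: manifold_hausdorff.
exact: compact_chart_ball.
Qed.

Lemma open_chart_ball phi (p : 'rV[R]_n) (r : R) :
  open [set z | chart_dom phi z /\ `|phi z - p| < r].
Proof.
rewrite openE => z [pz zr].
have : \forall w \near z, `|phi w - p| < r.
  have : (fun w => `|phi w - p|) w @[w --> z] --> `|phi z - p|.
    apply: cvg_norm; apply: cvgB; last exact: cvg_cst.
    exact: chart_continuous.
  by move=> /(_ [set s | s < r]); apply; exact: lt_nbhsl.
exact: filterI (near_chart_dom pz).
Qed.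

Lemma chart_img_ball phi x : chart_dom phi x ->
  exists2 r : R, 0 < r & forall y, `|y - phi x| <= r -> chart_img phi y.
Proof.
move=> px; have : \forall y \near phi x, chart_img phi y.
  by apply: open_nbhs_nbhs; split; [exact: chart_img_open|exists x].
move=> /nbhs_ballP[r /= r0 rP]; exists (r / 2); first by rewrite divr_gt0.
move=> y yr; apply: rP; apply/mx_normP; apply: le_lt_trans yr _.
by rewrite ltr_pdivrMr// ltr_pMr// ltr1n.
Qed.

End ChartBalls.

(** * Comparison of lengths with coordinate distances *)

Section ChartDistance.
Context {R : realType} {n : nat} {M : riemannianType R n}.
Implicit Types (phi psi : chart R n M) (x : M) (c : R -> M).
Notation norm_at phi y u := (Num.sqrt (bilin (gram phi y) u u)).

Lemma gram_near phi x (e : R) : atlas phi -> chart_dom phi x -> 0 < e ->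
  exists2 d : R, 0 < d & forall y, `|y - phi x| < d -> chart_img phi y /\
    forall u, norm_at phi y u <= (1 + e) * norm_at phi (phi x) u /\
              norm_at phi (phi x) u <= (1 + e) * norm_at phi y u.
Proof.
move=> aphi px e0; have ix : chart_img phi (phi x) by exists x.
have e1 : 0 < 1 + e by rewrite addr_gt0.
(* Since 1 - e / (1 + e) = 1 / (1 + e), this relative error gives the factor 1 + e in both
   directions. It is valid for the squares, and survives the square root because 1 + e is at most
   its own square. *)
have e'0 : 0 < e / (1 + e) by rewrite divr_gt0.
have gpos w : w != 0 -> 0 < bilin (gram phi (phi x)) w w by exact: gram_pos.
have := near_bilin (gram_continuous aphi ix) gpos e'0.
move=> /nbhs_ballP[d1 /= d10 d1P].
have : \forall y \near phi x, chart_img phi y.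
  by apply: open_nbhs_nbhs; split => //; exact: chart_img_open.
move=> /nbhs_ballP[d2 /= d20 d2P].
exists (Num.min d1 d2); first by rewrite lt_min d10.
move=> y; rewrite lt_min => /andP[yd1 yd2].
have iy := d2P y ((mx_normP _ _ _).2 yd2).
have hy := d1P y ((mx_normP _ _ _).2 yd1).
split => // u; have {hy} := hy u.
have b0 := bilin_gram_ge0 u aphi ix; have by0 := bilin_gram_ge0 u aphi iy.
move: b0 by0; set p := bilin _ u u; set q := bilin _ u u => p0 q0 pq.
have e1e : e / (1 + e) <= e by rewrite ler_pdivrMr// ler_peMr ?ltW// ltrDl.
have sq (r s : R) : 0 <= r -> 0 <= s -> r <= (1 + e) * s ->
    Num.sqrt r <= (1 + e) * Num.sqrt s.
  move=> r0 s0 rs; rewrite -[X in X * _](ger0_norm (ltW e1)) -sqrtr_sqr.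
  rewrite -sqrtrM ?sqr_ge0// ler_wsqrtr// (le_trans rs)// ler_wpM2r//.
  by rewrite expr2 ler_peMr ?ltW// ltrDl.
move: pq; rewrite ler_norml => /andP[h1 h2]; split; apply: sq => //.
  by have := ler_wpM2r p0 e1e; lra.
have : (1 + e) * (q - p) >= (1 + e) * - (e / (1 + e) * p) by rewrite ler_pM2l.
have -> : (1 + e) * - (e / (1 + e) * p) = - (e * p) by field; rewrite gt_eqF.
rewrite mulrBr; have -> : (1 + e) * p = p + e * p by ring.
by rewrite lerBrDr addrCA addNr addr0.
Qed.

Lemma gram_coord phi x : atlas phi -> chart_dom phi x ->
  exists2 C : R, 0 < C & exists2 d : R, 0 < d &
    forall y, `|y - phi x| < d -> chart_img phi y /\
    forall u : 'rV[R]_n, `|u| <= C * norm_at phi y u.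
Proof.
move=> aphi px; have ix : chart_img phi (phi x) by exists x.
have gpos w : w != 0 -> 0 < bilin (gram phi (phi x)) w w by exact: gram_pos.
have [l l0 lP] := bilin_lower_bound gpos.
have [d d0 dP] := gram_near aphi px ltr01.
have sl : 0 < Num.sqrt l by rewrite sqrtr_gt0.
exists (2 / Num.sqrt l); first by rewrite divr_gt0.
exists d => // y /dP[iy yP]; split => // u.
have [_ h] := yP u; rewrite mulrAC ler_pdivlMr//.
apply: le_trans (_ : norm_at phi (phi x) u <= _); last first.
  by apply: le_trans h _.
rewrite -[X in X * _](normr_id) -(sqrtr_sqr `|u|) -sqrtrM ?sqr_ge0//.
by rewrite ler_wsqrtr// mulrC.
Qed.

Lemma chart_lipschitz phi c (s t C : R) : atlas phi -> broken c s t ->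
  (forall r, r \in `[s, t] -> chart_dom phi (c r)) ->
  (forall r (u : 'rV[R]_n), r \in `[s, t] -> `|u| <= C * norm_at phi (phi (c r)) u) ->
  0 <= C -> `|phi (c t) - phi (c s)| <= C * curve_length c s t.
Proof.
move=> aphi cst cp cC C0; apply: mx_norm_le => [|i j].
  by rewrite mulr_ge0// length_ge0.
have coordE (u : 'rV[R]_n) (e : R) : (u *m (e *: (delta_mx j 0 : 'cV[R]_n))) 0 0 = e * u i j.
  rewrite -scalemxAr mxE; congr (_ * _); rewrite mxE (bigD1 j)//= big1 ?addr0.
    by rewrite mxE !eqxx mulr1 (ord1 i).
  by move=> l lj; rewrite mxE (negbTE lj) mulr0.
have h (e : R) : `|e| = 1 ->
    e * (phi (c t) - phi (c s)) i j <= C * curve_length c s t.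
  move=> e1; rewrite -coordE; apply: length_functional => // r u rI.
  rewrite coordE; apply: le_trans (cC _ _ rI).
  by rewrite (le_trans (ler_norm _))// normrM e1 mul1r coord_le_norm.
rewrite ler_norml; apply/andP; split.
  by rewrite lerNl -mulN1r; apply: h; rewrite normrN1.
by rewrite -[X in X <= _]mul1r; apply: h; rewrite normr1.
Qed.

(** Length controls the displacement in coordinates only while the curve stays in the chart, so the
    confinement is obtained by bootstrap. The constant [C] precedes r, so that later tolerances
    depending on [C] may determine r. *)
Lemma short_curve phi x : atlas phi -> chart_dom phi x ->
  exists2 C : R, 0 < C & forall r : R, 0 < r -> exists2 d : R, 0 < d &
    forall c (a b t0 : R), broken c a b -> t0 = a \/ t0 = b ->
      chart_dom phi (c t0) -> `|phi (c t0) - phi x| < d ->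
      curve_length c a b < d ->
      [/\ forall t, t \in `[a, b] -> chart_dom phi (c t) /\ `|phi (c t) - phi x| < r
        & `|phi (c b) - phi (c a)| <= C * curve_length c a b].
Proof.
move=> aphi px; have [C C0 [d1 d10 d1P]] := gram_coord aphi px.
exists C => // r r0; pose r1 := Num.min r d1.
have r10 : 0 < r1 by rewrite lt_min r0.
have C1 : 0 < 1 + C by rewrite addr_gt0.
(* Chosen so that d + C d = r1 / 2: the initial offset and the displacement together stay in the
   closed ball K. *)
pose d := r1 / (1 + C) / 2; have d0 : 0 < d by rewrite !divr_gt0.
exists d => // c a b t0 cab t0E pt0 t0d ld.
pose r2 := r1 / 2; have r20 : 0 < r2 by rewrite divr_gt0.
have r21 : r2 < r1 by rewrite ltr_pdivrMr// ltr_pMr// ltr1n.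
have r1d : r1 <= d1 by rewrite ge_min lexx orbT.
pose K := [set z : M | chart_dom phi z /\ `|phi z - phi x| <= r2].
pose U := [set z : M | chart_dom phi z /\ `|phi z - phi x| < r1].
have Kc : closed K.
  apply: closed_chart_ball => y yr; have [] // := d1P y.
  exact: le_lt_trans yr (lt_le_trans r21 r1d).
have Uo : open U by exact: open_chart_ball.
have KU : K `<=` U by move=> z [pz zr]; split => //; exact: le_lt_trans r21.
have dC : d + C * d = r2.
  by rewrite -{1}[d]mul1r -mulrDl /d mulrA mulrCA divff ?mulr1 ?gt_eqF.
have lip s t : a <= s -> s <= t -> t <= b ->
    (forall q, q \in `[s, t] -> U (c q)) ->
    `|phi (c t) - phi (c s)| <= C * curve_length c s t.
  move=> as_ st tb cU; have [<-|s_t] := eqVneq s t.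
    by rewrite subrr normr0 mulr_ge0 ?length_ge0// ltW.
  have ltst : s < t by rewrite lt_neqAle s_t.
  apply: chart_lipschitz => //; last exact: ltW.
  - exact: broken_sub cab as_ ltst tb.
  - by move=> q /cU[].
  move=> q u /cU[pq qr]; have [|_] := d1P (phi (c q)); last exact.
  exact: lt_le_trans qr r1d.
have len s t : a <= s -> s <= t -> t <= b -> C * curve_length c s t <= C * d.
  by move=> as_ st tb; rewrite ler_pM2l// (le_trans (length_le cab _ _ _))// ltW.
have cc t A : t \in `[a, b] -> nbhs (c t) A -> exists2 d : R, 0 < d &
    forall s, s \in `[a, b] -> `|s - t| < d -> A (c s).
  by move=> tab nA; exact: broken_continuous cab tab nA.
have Kt0 : K (c t0).
  split => //; apply: ltW; apply: (lt_le_trans t0d); rewrite -dC lerDl.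
  by rewrite mulr_ge0 ?ltW.
have near t : `|phi (c t) - phi (c t0)| <= C * d -> `|phi (c t) - phi x| <= r2.
  move=> h; rewrite -(subrK (phi (c t0)) (phi (c t))) -addrA.
  by rewrite (le_trans (ler_normD _ _))// -dC [leRHS]addrC lerD// ltW.
have cK t : t \in `[a, b] -> K (c t).
  case: t0E => t0E.
    apply: (@confined _ _ c a b K U) => //; first by rewrite -t0E.
    move=> s /[1!in_itv] /= /andP[as_ sb] cU; split.
      by have [] := cU s; rewrite // in_itv /= as_ lexx.
    apply: near; rewrite t0E (le_trans (lip _ _ _ _ _ cU))// len//.
  apply: (@confined_rev _ _ c a b K U) => //; first by rewrite -t0E.
  move=> s /[1!in_itv] /= /andP[as_ sb] cU; split.
    by have [] := cU s; rewrite // in_itv /= sb lexx.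
  by apply: near; rewrite t0E distrC (le_trans (lip _ _ _ _ _ cU))// len.
have ab := ltW (broken_lt cab); split.
  move=> t /cK[pt tr]; split => //; apply: le_lt_trans tr _.
  by apply: (lt_le_trans r21); rewrite ge_min lexx.
by apply: lip => // q /cK/KU.
Qed.

(** Calibration by the covector dual to [v] at x. By Cauchy-Schwarz its norm is that of [v], and the
    variation of the metric costs the factor 1 + e. *)
Lemma length_lower phi x (v : 'rV[R]_n) (e : R) :
  atlas phi -> chart_dom phi x -> 0 < e ->
  exists2 d : R, 0 < d &
    forall c (a b : R), broken c a b ->
      (forall t, t \in `[a, b] -> chart_dom phi (c t) /\ `|phi (c t) - phi x| < d) ->
      bilin (gram phi (phi x)) (phi (c b) - phi (c a)) v <=
      (1 + e) * norm_at phi (phi x) v * curve_length c a b.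
Proof.
move=> aphi px e0; have ix : chart_img phi (phi x) by exists x.
have [d d0 dP] := gram_near aphi px e0; exists d => // c a b cab cd.
pose w := gram phi (phi x) *m v^T.
have wE u : bilin (gram phi (phi x)) u v = (u *m w) 0 0.
  by rewrite /bilin /w mulmxA.
rewrite wE; apply: length_functional => // [t /cd[]//|t u /cd[_ /dP[it tP]]].
rewrite -wE; apply: (le_trans (bilin_CS _ _ _ _)).
- exact: gram_sym.
- by move=> z; exact: bilin_gram_ge0.
rewrite [leRHS]mulrAC ler_wpM2r ?sqrtr_ge0//.
by have [_] := tP u.
Qed.

Lemma short_segment phi x (e : R) : atlas phi -> chart_dom phi x -> 0 < e ->
  exists2 d : R, 0 < d & forall y z, `|y - phi x| < d -> `|z - phi x| < d ->
    exists c, [/\ broken c 0 1, c 0 = chart_inv phi y, c 1 = chart_inv phi z &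
      curve_length c 0 1 <= (1 + e) * norm_at phi (phi x) (z - y)].
Proof.
move=> aphi px e0; have [d d0 dP] := gram_near aphi px e0.
(* The segment is prolonged to parameters in ]-1, 2[; as d / 6 + 2 (d / 3) < d, it stays where the
   metric is controlled. *)
have d6 : 0 < d / 6 by rewrite divr_gt0.
exists (d / 6) => // y z yd zd.
have zyd : `|z - y| < d / 3.
  have -> : z - y = (z - phi x) - (y - phi x) by rewrite opprB addrA subrK.
  apply: (le_lt_trans (ler_normB _ _)); have := ltrD zd yd.
  by rewrite (_ : d / 6 + d / 6 = d / 3)//; field.
have seg (t : R) : `]0 - 1, 1 + 1[%classic t -> `|y + t *: (z - y) - phi x| < d.
  rewrite /= in_itv /= => /andP[t1 t2].
  have tn : `|t| <= 2 by rewrite ler_norml; apply/andP; split; lra.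
  rewrite addrAC; apply: (le_lt_trans (ler_normD _ _)); rewrite normrZ.
  have := ler_pM (normr_ge0 _) (normr_ge0 _) tn (ltW zyd); lra.
have iseg t : `]0 - 1, 1 + 1[%classic t -> chart_img phi (y + t *: (z - y)).
  by move=> /seg/dP[].
pose c (t : R) := chart_inv phi (y + t *: (z - y)).
have cs : smooth_curve `]0 - 1, 1 + 1[ c.
  by apply: chart_segment_smooth => //; exact: interval_open.
have c01 : broken c 0 1.
  by apply: broken_one => //; exists c, 1.
exists c; split; first exact: c01.
- by rewrite /c scale0r addr0.
- by rewrite /c scale1r addrC subrK.
set K := (X in _ <= X).
have -> : K = \int[lebesgue_measure]_(t in `[0 : R, 1]) cst K t.
  by rewrite Rintegral_cst//= lebesgue_measure_itv/= lte_fin ltr01 oppr0 addr0 mulr1.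
apply: le_Rintegral => //.
- exact: broken_integrable.
- apply: continuous_compact_integrable; first exact: segment_compact.
  by apply: continuous_in_subspaceT => t _; exact: cvg_cst.
move=> t t01; have tI := mem_widen ltr01 t01.
have pt : chart_dom phi (c t) by apply: chart_dom_inv; exact: iseg.
have [dc _ _] := smooth_curve_chart cs aphi tI pt.
rewrite (speed_chart aphi (smooth_curve_continuous cs tI) pt dc).
have -> : derive1 (phi \o c) t = z - y.
  rewrite -(derive1_affine y (z - y) t) !derive1E; apply: near_eq_derive.
  have : \forall s \near t, `]0 - 1, 1 + 1[%classic s.
    by apply: open_nbhs_nbhs; split => //; exact: interval_open.
  by apply: filterS => s sI /=; rewrite /c chart_invK//; exact: iseg.
rewrite /c chart_invK; last exact: iseg.
by have [_ /(_ (z - y))[]] := dP _ (seg _ tI).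
Qed.

End ChartDistance.

(** * Orbits near a point *)

Section SmoothMap2.
Context {R : realType}.

Lemma row_mx_norm p q (u : 'rV[R]_p) (v : 'rV[R]_q) :
  `|row_mx u v| <= Num.max `|u| `|v|.
Proof.
apply: mx_norm_le => [|i j]; first by rewrite le_max normr_ge0.
case: (split_ordP j) => l ->.
  by rewrite row_mxEl le_max coord_le_norm.
by rewrite row_mxEr le_max coord_le_norm orbT.
Qed.

(** Strict differentiability in charts: both argument pairs vary, so increments of a product or of
    an action can be compared at two different base points near (x1, x2). *)
Lemma smooth_map2_strict m1 m2 n (M1 : manifoldType R m1)
    (M2 : manifoldType R m2) (N : manifoldType R n) (f : M1 -> M2 -> N)
    (phi1 : chart R m1 M1) (phi2 : chart R m2 M2) (psi : chart R n N) x1 x2 :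
  smooth_map2 f -> atlas phi1 -> atlas phi2 -> atlas psi ->
  chart_dom phi1 x1 -> chart_dom phi2 x2 -> chart_dom psi (f x1 x2) ->
  exists2 D : {linear 'rV[R]_(m1 + m2) -> 'rV[R]_n},
    exists2 C : R, 0 < C & forall u, `|D u| <= C * `|u| &
  forall e : R, 0 < e -> exists2 d : R, 0 < d & forall y1 y2 z1 z2,
    chart_dom phi1 y1 -> chart_dom phi2 y2 -> chart_dom phi1 z1 -> chart_dom phi2 z2 ->
    `|phi1 y1 - phi1 x1| < d -> `|phi2 y2 - phi2 x2| < d ->
    `|phi1 z1 - phi1 x1| < d -> `|phi2 z2 - phi2 x2| < d ->
    [/\ chart_dom psi (f y1 y2), chart_dom psi (f z1 z2) &
    `|psi (f y1 y2) - psi (f z1 z2) -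
      D (row_mx (phi1 y1 - phi1 z1) (phi2 y2 - phi2 z2))| <=
    e * Num.max `|phi1 y1 - phi1 z1| `|phi2 y2 - phi2 z2|].
Proof.
move=> [fc fs] a1 a2 a p1 p2 p.
pose F (y : 'rV[R]_(m1 + m2)) :=
  psi (f (chart_inv phi1 (lsubmx y)) (chart_inv phi2 (rsubmx y))).
pose U := smooth2_dom f phi1 phi2 psi.
have Uo : open U by exact: smooth2_dom_open.
have FE y1 y2 : chart_dom phi1 y1 -> chart_dom phi2 y2 ->
    F (row_mx (phi1 y1) (phi2 y2)) = psi (f y1 y2).
  by move=> q1 q2; rewrite /F row_mxKl row_mxKr !chart_funK.
pose p0 := row_mx (phi1 x1) (phi2 x2).
have Up : U p0 by exists (x1, x2).
have F1 : Ck 1 U F by exact: (fs _ _ _ a1 a2 a 1%N).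
have dF : differentiable F p0 by case: F1 => + _; exact.
exists ('d F p0).
  by have [C C0 CP] := linear_lipschitz (diff_continuous dF); exists C.
move=> e e0; have [d d0 dP] := Ck1_strict Uo Up F1 e0.
have rB q r (u u' : 'rV[R]_q) (v v' : 'rV[R]_r) :
    row_mx u v - row_mx u' v' = row_mx (u - u') (v - v').
  by rewrite opp_row_mx add_row_mx.
have near y1 y2 : `|phi1 y1 - phi1 x1| < d -> `|phi2 y2 - phi2 x2| < d ->
    `|row_mx (phi1 y1) (phi2 y2) - p0| < d.
  by move=> h1 h2; rewrite rB (le_lt_trans (row_mx_norm _ _))// gt_max h1.
have domU y1 y2 : chart_dom phi1 y1 -> chart_dom phi2 y2 ->
    U (row_mx (phi1 y1) (phi2 y2)) -> chart_dom psi (f y1 y2).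
  move=> q1 q2 [[z1 z2] /= [r1 r2 r]] /eq_row_mx[g1 g2].
  by rewrite -(chart_funK q1) -(chart_funK q2) -g1 -g2 !chart_funK.
exists d => // y1 y2 z1 z2 q1 q2 r1 r2 yd1 yd2 zd1 zd2.
have [Uy Uz] := dP _ _ (near _ _ yd1 yd2) (near _ _ zd1 zd2).
rewrite FE// FE// rB => le1; split; [exact: domU|exact: domU|].
by apply: (le_trans le1); rewrite ler_wpM2l ?(ltW e0)// row_mx_norm.
Qed.

Lemma smooth_map2_left m1 m2 n (M1 : manifoldType R m1)
    (M2 : manifoldType R m2) (N : manifoldType R n) (f : M1 -> M2 -> N) y :
  smooth_map2 f -> continuous (f^~ y).
Proof.
move=> [fc _] x A /(fc (x, y)).
have k1 : z @[z --> x] --> x by exact: cvg_id.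
have k2 : (cst y : M1 -> M2) z @[z --> x] --> y by exact: cvg_cst.
by move=> /(cvg_pair k1 k2).
Qed.

End SmoothMap2.

(** * First-order structure of an orbit at x *)

Section OrbitTangent.
Context {R : realType} {n k : nat} {M : riemannianType R n}
  {G : lieGroupType R k} {act : G -> M -> M}.
Hypothesis GM : complete_riemannian_G_manifold act.
Implicit Types (x y z : M) (g h : G).

Let chi : chart R k G := chart_at (1%g : G).
Let e0 : 'rV[R]_k := chi 1%g.

Let achi : atlas chi. Proof. exact: chart_at_atlas. Qed.
Let chi1 : chart_dom chi 1%g. Proof. exact: chart_at_dom. Qed.

Definition gball (d : R) g := chart_dom chi g /\ `|chi g - e0| < d.

Lemma gball_open (d : R) : open (gball d).
Proof. exact: open_chart_ball. Qed.

Lemma gball1 (d : R) : 0 < d -> gball d 1%g.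
Proof. by move=> d0; split => //; rewrite subrr normr0. Qed.

(** The increments from (1, h) to (g, h) and from (1, 1) to (g, 1) have the same linear part, each
    up to e / 2. The error is relative to the size of g alone, so it can be summed along powers of
    g. *)
Lemma mul_near (e : R) : 0 < e -> exists2 d : R, 0 < d & forall g h,
  gball d g -> gball d h -> chart_dom chi (g * h)%g /\
  `|chi (g * h)%g - chi h - (chi g - e0)| <= e * `|chi g - e0|.
Proof.
move=> e_gt0; have p11 : chart_dom chi (1 * 1)%g by rewrite mulg1.
have [D _ DP] := smooth_map2_strict (@lie_mul_smooth R k G) achi achi achi chi1 chi1 p11.
have e2 : 0 < e / 2 by rewrite divr_gt0.
have [d d0 dP] := DP _ e2; exists d => // g h [pg gd] [ph hd].
have [_ ud] := gball1 d0.
have [pgh _ le1] := dP _ _ _ _ pg ph chi1 ph gd hd ud hd.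
have [_ _ le2] := dP _ _ _ _ pg chi1 chi1 chi1 gd ud ud ud.
split; first exact: pgh.
move: le1 le2; rewrite !mul1g mulg1 !subrr normr0 max_l ?normr_ge0//.
rewrite -/e0; set X := chi g - e0; set Y := D _; set Z := _ - chi h => le1 le2.
have gen (u v w : 'rV[R]_k) : u - v = (u - w) - (v - w).
  by rewrite opprB addrA subrK.
rewrite (gen Z X Y).
by apply: (le_trans (ler_normB _ _)); rewrite (splitr e) mulrDl lerD.
Qed.

Lemma div_near (d : R) : 0 < d -> exists2 d' : R, 0 < d' & forall g h,
  gball d' g -> gball d' h -> gball d (g * h^-1)%g.
Proof.
move=> d0; have [mc _] := @lie_mul_smooth R k G.
have [ic _] := @lie_inv_smooth R k G.
have n1 : nbhs ((1%g : G), (1%g : G)) (fun p : G * G => gball d (p.1 * p.2^-1)%g).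
  have h1 : p.1 @[p --> ((1%g : G), (1%g : G))] --> (1%g : G) by exact: cvg_fst.
  have h2 : (p.2^-1)%g @[p --> ((1%g : G), (1%g : G))] --> (1^-1%g : G).
    by apply: (cvg_comp _ _ cvg_snd); exact: ic.
  have := mc ((1%g : G), (1^-1)%g) (gball d).
  rewrite /= invg1 mulg1 => /(_ (open_nbhs_nbhs (conj (gball_open d) (gball1 d0)))).
  by rewrite invg1 in h2; move=> /(cvg_pair h1 h2).
have [[A B] /= [nA nB] AB] := n1.
have toball (V : set G) : nbhs (1%g : G) V ->
    exists2 d' : R, 0 < d' & forall g, gball d' g -> V g.
  move=> nV; have i1 : chart_img chi e0 by exists 1%g.
  have : \forall y \near e0, V (chart_inv chi y).
    by apply: (chart_inv_continuous i1); rewrite chart_funK.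
  move=> /nbhs_ballP[r /= r0 rP]; exists r => // g [pg gr].
  by rewrite -(chart_funK pg); apply: rP; apply/mx_normP.
have [d1 d10 d1P] := toball _ nA; have [d2 d20 d2P] := toball _ nB.
exists (Num.min d1 d2); first by rewrite lt_min d10.
move=> g h [pg]; rewrite lt_min => /andP[g1 _] [ph]; rewrite lt_min => /andP[_ h2].
by apply: (AB (g, h)); split; [exact: d1P|exact: d2P].
Qed.

Variable x : M.
Let phi : chart R n M := chart_at x.
Let x0 : 'rV[R]_n := phi x.
Let aphi : atlas phi. Proof. exact: chart_at_atlas. Qed.
Let phix : chart_dom phi x. Proof. exact: chart_at_dom. Qed.

(** [A] is the differential at 1 of the orbit map g -> g x, recorded with its homogeneity. The
    second part says that elements near 1 spread nearby points away from the image of x by a bounded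
    factor. *)
Lemma act_strict :
  exists2 A : 'rV[R]_k -> 'rV[R]_n,
    (forall e : R, 0 < e -> exists2 d : R, 0 < d & forall g, gball d g ->
      chart_dom phi (act g x) /\
      `|phi (act g x) - x0 - A (chi g - e0)| <= e * `|chi g - e0|) /\
    (forall (a : R) u, A (a *: u) = a *: A u) &
  exists2 C : R, 0 < C & exists2 d : R, 0 < d & forall g y, gball d g ->
    chart_dom phi y -> `|phi y - x0| < d -> chart_dom phi (act g y) /\
    `|phi (act g y) - phi (act g x)| <= C * `|phi y - x0|.
Proof.
have p1 : chart_dom phi (act 1%g x) by rewrite (act1 GM).
have [D [C C0 CP] DP] := smooth_map2_strict (Gmfd_smooth GM) achi aphi aphi chi1 phix p1.
exists (fun u => D (row_mx u 0)).
  split=> [e e_gt0|a u].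
    have [d d0 dP] := DP _ e_gt0; exists d => // g [pg gd].
    have ud := (gball1 d0).2; have xd : `|phi x - x0| < d by rewrite subrr normr0.
    have [pgx _] := dP _ _ _ _ pg phix chi1 phix gd xd ud xd.
    rewrite (act1 GM) subrr normr0 max_l ?normr_ge0//.
  transitivity (D (a *: row_mx u 0)); last by rewrite linearZ.
  by rewrite scale_row_mx scaler0.
exists (C + 1); first by rewrite addr_gt0.
have [d d0 dP] := DP _ ltr01; exists d => // g y [pg gd] py yd.
have xd : `|phi x - x0| < d by rewrite subrr normr0.
have [pgy _] := dP _ _ _ _ pg py pg phix gd yd gd xd.
rewrite subrr normr0 max_r ?normr_ge0// => le1; split; first exact: pgy.
rewrite -(subrK (D (row_mx 0 (phi y - phi x))) (_ - _)).
apply: (le_trans (ler_normD _ _)); rewrite addrC mulrDl lerD//.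
apply: (le_trans (CP _)); rewrite ler_wpM2l ?(ltW C0)//.
by apply: (le_trans (row_mx_norm _ _)); rewrite normr0 max_r ?normr_ge0.
Qed.

(** By properness the g with g x in a coordinate ball form a compact set. Those which no right
    factor from the stabilizer brings into [gball d] form a compact subset on which the displacement
    of x has a positive minimum; closer to x, only g near 1 are required. *)
Lemma orbit_near (d : R) : 0 < d -> exists2 r : R, 0 < r & forall y,
  Gorbit act x y -> chart_dom phi y -> `|phi y - x0| < r ->
  exists2 g, gball d g & y = act g x.
Proof.
move=> d0; have [r r0 rP] := chart_img_ball phix.
pose K0 := [set z : M | chart_dom phi z /\ `|phi z - x0| <= r].
have K0c : compact K0 by exact: compact_chart_ball.
have Kc : compact (K0 `*` [set x]) by apply: compact_setX => //; exact: compact_set1.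
have := Gmfd_proper GM Kc; set S1 := [set gx | _] => S1c.
pose S := [set g : G | K0 (act g x)].
have SE : S = fst @` S1.
  apply/seteqP; split=> [g Sg|_ [[g z] [/= h zx] <-]]; first by exists (g, x).
  by rewrite /S /= -zx.
have Sc : compact S.
  rewrite SE; apply: continuous_compact => //.
  by apply: continuous_subspaceT => -[a b]; exact: cvg_fst.
pose S0 := S `&` [set g | forall h, act h x = x -> ~ gball d (g * h^-1)%g].
have S0c : compact S0.
  apply: compact_closedI => //.
  rewrite (_ : [set g | _] = ~` (\bigcup_(h in [set h | act h x = x])
     ((fun g : G => (g * h^-1)%g) @^-1` gball d))); last first.
    apply/seteqP; split=> [g gP [h hx hg]|g gP h hx hg]; first exact: gP hx hg.
    by apply: gP; exists h.
  apply: open_closedC; apply: bigcup_open => h hx; apply: open_comp => [g _|].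
    exact: smooth_map2_left (@lie_mul_smooth R k G) _.
  exact: gball_open.
have actc : continuous (act^~ x) by exact: smooth_map2_left (Gmfd_smooth GM).
have [S00|/set0P S0n] := eqVneq S0 set0.
  exists r => // y [g _ <-] py yr; apply: contrapT => nex.
  suff : S0 g by rewrite S00.
  split; first by split; [exact: py|exact: ltW].
  move=> h hx gh; apply: nex; exists (g * h^-1)%g => //.
  by rewrite (actM GM) -[in RHS]hx (actK GM).
have Nc : {within S0, continuous (fun g => `|phi (act g x) - x0|)}.
  apply: continuous_in_subspaceT => g /set_mem[[pg _] _].
  apply: cvg_norm; apply: cvgB; last exact: cvg_cst.
  by apply: (@continuous_comp _ _ _ (act^~ x) phi); [exact: actc|exact: chart_continuous].
have [g0 /[1!inE] S0g0 gmin] := compact_EVT_min S0n S0c Nc.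
have [[p0 _] g0P] := S0g0.
pose m := `|phi (act g0 x) - x0|.
have m0 : 0 < m.
  (* If [g0] fixed x, it could serve as its own right factor, and the quotient 1 lies in the
     ball. *)
  rewrite normr_gt0 subr_eq0; apply/eqP => E; apply: (g0P g0).
    by rewrite -(chart_funK p0) E chart_funK.
  by rewrite mulgV; exact: gball1.
exists (Num.min r m); first by rewrite lt_min r0.
move=> y [g _ <-] py; rewrite lt_min => /andP[yr ym].
apply: contrapT => nex.
suff /mem_set/gmin : S0 g by rewrite leNgt ym.
split; first by split; [exact: py|exact: ltW].
move=> h hx gh; apply: nex; exists (g * h^-1)%g => //.
by rewrite (actM GM) -[in RHS]hx (actK GM).
Qed.

(** The elements to be excluded: they move x much less than their size, although no element of the
    chart with the same effect on x is at most half as large. The last clause prevents the defect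
    from being due to a factor in the stabilizer. *)
Definition adapted (eta : R) g := [/\ chart_dom chi g,
  0 < `|chi g - e0| < eta, chart_dom phi (act g x),
  `|phi (act g x) - x0| <= eta * `|chi g - e0| &
  forall h, chart_dom chi h -> act h x = act g x ->
    `|chi g - e0| < 2 * `|chi h - e0| ].

(** The normalized coordinates of adapted elements, taken for eta = 1 / (i + 1), accumulate on the
    compact unit sphere. *)
Lemma adapted_direction : (forall eta : R, 0 < eta -> exists g, adapted eta g) ->
  exists2 u : 'rV[R]_k, `|u| = 1 & forall eta e : R, 0 < eta -> 0 < e ->
    exists2 g, adapted eta g & `|chi g - e0 - `|chi g - e0| *: u| <= e * `|chi g - e0|.
Proof.
move=> ex; pose S : set 'rV[R]_k := [set u | `|u| = 1].
have Sc : compact S by exact: compact_sphere.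
pose eta (i : nat) : R := i.+1%:R^-1.
have eta0 i : 0 < eta i by rewrite invr_gt0.
have [g_ gP] := choice (fun i => ex _ (eta0 i)).
pose u_ i := `|chi (g_ i) - e0|^-1 *: (chi (g_ i) - e0).
have Su i : S (u_ i).
  have [_ /andP[n0 _] _ _ _] := gP i.
  by rewrite /S /u_ /= normrZ normfV normr_id mulVf// gt_eqF.
have SF : (u_ @ \oo) S by exists 0%N => // i _; exact: Su.
have [u [u1 uc]] := Sc _ _ SF.
exists u => // eta' e eta'0 e_gt0.
have [N etaN] : exists N : nat, forall i, (N <= i)%N -> eta i < eta'.
  exists (Num.truncn eta'^-1) => i Ni; rewrite /eta invf_plt ?posrE//.
  apply: (@lt_le_trans _ _ (Num.truncn eta'^-1).+1%:R); last by rewrite ler_nat ltnS.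
  by rewrite truncnS_gt// invr_ge0 ltW.
have tail : (u_ @ \oo) [set v | exists2 i, (N <= i)%N & v = u_ i].
  by exists N => // i Ni /=; exists i.
have nu : nbhs u (ball u e) by exact: nbhsx_ballx.
have [_ [[i Ni ->] /mx_normP ui]] := uc _ _ tail nu.
have [p /andP[n0 n1] q h1 h2] := gP i.
exists (g_ i).
  split => //; first by rewrite n0 (lt_trans n1)// etaN.
  by apply: (le_trans h1); rewrite ler_wpM2r// ltW// etaN.
rewrite -[X in `|X - _|](scale1r) -(divff (lt0r_neq0 n0)) -scalerA -scalerBr.
by rewrite normrZ normr_id mulrC ler_wpM2r// ltW.
Qed.

(** In coordinates g^m is m times g, as the errors of [mul_near] add up; the displacement of x grows
    at most linearly in m, by the uniform bound of [act_strict]. *)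
Lemma iterate_near (e : R) : 0 < e -> e <= 1 -> exists2 d : R, 0 < d &
  exists2 C : R, 0 < C & forall g (m : nat), chart_dom chi g ->
    chart_dom phi (act g x) -> `|phi (act g x) - x0| < d ->
    2 * m%:R * `|chi g - e0| < d -> `|chi g - e0| < d ->
    [/\ chart_dom chi (g ^+ m)%g,
      `|chi (g ^+ m)%g - e0 - m%:R *: (chi g - e0)| <= e * (m%:R * `|chi g - e0|),
      chart_dom phi (act (g ^+ m)%g x) &
      `|phi (act (g ^+ m)%g x) - x0| <= C * m%:R * `|phi (act g x) - x0| ].
Proof.
move=> e_gt0 e1; have [d1 d10 d1P] := mul_near e_gt0.
have [_ _ [C C0 [d2 d20 d2P]]] := act_strict.
exists (Num.min d1 d2); first by rewrite lt_min d10.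
exists C => // g + pg pgx; move=> m xd.
have {}xd : `|phi (act g x) - x0| < d2 by move: xd; rewrite lt_min => /andP[].
rewrite !lt_min => md /andP[gd1 gd2]; move: md.
elim: m => [|m IH] /andP[md1 md2].
  rewrite expg0 (act1 GM) scale0r subr0 !mul0r !mulr0 mul0r !subrr !normr0.
  by split.
have mm : 2 * m%:R * `|chi g - e0| <= 2 * m.+1%:R * `|chi g - e0|.
  by rewrite ler_wpM2r// ler_pM2l// ler_nat.
have [|pm le1 pmx le2] := IH.
  by rewrite (le_lt_trans mm md1) (le_lt_trans mm md2).
set X := `|chi g - e0| in gd1 gd2 md1 md2 mm le1 *.
have X0 : 0 <= X by exact: normr_ge0.
(* As e <= 1, a power is at most twice its linear approximation; the factor 2 in the smallness
   hypothesis keeps it in the balls. *)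
have hm : `|chi (g ^+ m)%g - e0| <= 2 * m%:R * X.
  rewrite -(subrK (m%:R *: (chi g - e0)) (_ - _)).
  apply: (le_trans (ler_normD _ _)); rewrite normrZ normr_nat -/X.
  have : e * (m%:R * X) <= m%:R * X by rewrite ler_piMl// mulr_ge0.
  have -> : 2 * m%:R * X = m%:R * X + m%:R * X by ring.
  by move=> h; apply: lerD => //; exact: le_trans h.
have gm1 : gball d1 (g ^+ m)%g by split => //; apply: le_lt_trans hm (le_lt_trans mm md1).
have gm2 : gball d2 (g ^+ m)%g by split => //; apply: le_lt_trans hm (le_lt_trans mm md2).
have [pS leS] := d1P g (g ^+ m)%g (conj pg gd1) gm1.
have [pSx leSx] := d2P _ _ gm2 pgx xd.
(* The coordinates use g times g^m, adding one small step on the left; the displacement uses g^m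
   times g, comparing the images of g x and x under g^m. *)
have SE : (g ^+ m.+1 = g ^+ m * g)%g by rewrite expgSr.
split; first by rewrite expgS.
- rewrite expgS -natr1 scalerDl scale1r.
  have gen (a b p q : 'rV[R]_k) :
      a - e0 - (p + q) = (a - b - q) + (b - e0 - p).
    by apply/matrixP => i j; rewrite !mxE; ring.
  rewrite (gen _ (chi (g ^+ m)%g)).
  apply: (le_trans (ler_normD _ _)).
  by rewrite mulrDl mul1r mulrDr [leRHS]addrC lerD.
- by rewrite SE (actM GM).
rewrite SE (actM GM) -(subrKA (phi (act (g ^+ m)%g x))).
apply: (le_trans (ler_normD _ _)).
by rewrite -natr1 mulrDr mulr1 mulrDl [leRHS]addrC lerD.
Qed.

(* The powers g^m of adapted elements approximate the one-parameter group in the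
   limit direction; they move x very little, so limits of them fix x. *)
Lemma stabilizer_direction (u : 'rV[R]_k) : `|u| = 1 ->
  (forall eta e : R, 0 < eta -> 0 < e -> exists2 g, adapted eta g &
    `|chi g - e0 - `|chi g - e0| *: u| <= e * `|chi g - e0|) ->
  forall e : R, 0 < e -> exists2 s0 : R, 0 < s0 & forall s : R, 0 < s -> s < s0 ->
    exists h, [/\ act h x = x, chart_dom chi h & `|chi h - (e0 + s *: u)| <= e * s].
Proof.
move=> u1 dir e e_gt0.
(* Three errors of size e' s occur below: powers, direction, and rounding of m. *)
pose e' := Num.min e 1 / 4; have e'0 : 0 < e' by rewrite divr_gt0// lt_min e_gt0 ltr01.
have e'1 : e' <= 1.
  by rewrite ler_pdivrMr// mul1r ge_min; apply/orP; right; lra.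
have e'e : e' * 4 <= e by rewrite divfK// ge_min lexx.
have [d1 d10 [C C0 iter]] := iterate_near e'0 e'1.
have [A [actA _] _] := act_strict; have [d2 d20 d2P] := actA _ ltr01.
have [r r0 rP] := chart_img_ball chi1.
pose d := Num.min d1 (Num.min d2 r); have d0 : 0 < d by rewrite !lt_min d10 d20.
have [dd1 dd2 ddr] : [/\ d <= d1, d <= d2 & d <= r].
  by split; rewrite !ge_min lexx ?orbT.
pose s0 := d / (2 * (1 + e)); have e1 : 0 < 2 * (1 + e) by rewrite mulr_gt0// addr_gt0.
exists s0; first by rewrite divr_gt0.
move=> s s_gt0; rewrite ltr_pdivlMr// => ss0.
have es : 0 < e * s by rewrite mulr_gt0.
have s2 : 2 * s < d by have := ss0; nra.
have ses : s + e * s < d by have := ss0; nra.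
(* Compact set of candidates. If none of them fixes x, the displacement of x is at least some [mu_]
   > 0 on it, while a suitable power of an adapted element lies in it and moves x by less. *)
pose Z := [set h : G | chart_dom chi h /\ `|chi h - (e0 + s *: u)| <= e * s].
have near (y : 'rV[R]_k) : `|y - (e0 + s *: u)| <= e * s -> `|y - e0| < d.
  move=> h; have -> : y - e0 = (y - (e0 + s *: u)) + s *: u by rewrite opprD addrA subrK.
  apply: (le_lt_trans (ler_normD _ _)); rewrite normrZ u1 mulr1 gtr0_norm//.
  by rewrite addrC; apply: le_lt_trans ses; rewrite lerD2l.
have Zc : compact Z.
  by apply: compact_chart_ball => y /near yd; apply: rP; rewrite ltW// (lt_le_trans yd).
have Zb h : Z h -> gball d h by move=> [ph /near].
apply: contrapT => none.
have noneP h : Z h -> act h x <> x by move=> [ph hz] hx; apply: none; exists h.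
have actc : continuous (act^~ x) by exact: smooth_map2_left (Gmfd_smooth GM).
have Zx h : Z h -> chart_dom phi (act h x).
  move=> /Zb[ph hd]; have [] // := d2P h; split => //; exact: lt_le_trans dd2.
have [mu_ mu0 muP] : exists2 mu_ : R, 0 < mu_ &
    forall h, Z h -> mu_ <= `|phi (act h x) - x0|.
  have [Z0|/set0P Zn] := eqVneq Z set0; first by exists 1 => // h; rewrite Z0.
  have Nc : {within Z, continuous (fun g => `|phi (act g x) - x0|)}.
    apply: continuous_in_subspaceT => h /[1!inE] Zh.
    apply: cvg_norm; apply: cvgB; last exact: cvg_cst.
    apply: (@continuous_comp _ _ _ (act^~ x) phi); first exact: actc.
    by apply: chart_continuous; exact: Zx.
  have [h0 /[1!inE] Zh0 hmin] := compact_EVT_min Zn Zc Nc.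
  exists `|phi (act h0 x) - x0|; last by move=> h /mem_set/hmin.
  rewrite normr_gt0 subr_eq0; apply/eqP => E; apply: (noneP _ Zh0).
  by rewrite -(chart_funK (Zx _ Zh0)) E chart_funK.
(* The first bound makes the rounding error, at most the size X of g, negligible; the second makes
   the displacement C s eta smaller than [mu_]. *)
pose eta := Num.min (Num.min (e' * s) (mu_ / (C * s + 1))) (Num.min 1 d1).
have Cs : 0 < C * s + 1 by rewrite addr_gt0// mulr_gt0.
have eta0 : 0 < eta.
  by rewrite !lt_min (mulr_gt0 e'0 s_gt0) (divr_gt0 mu0 Cs) ltr01 d10.
have [eta1 eta2 eta3 eta4] : [/\ eta <= e' * s, eta <= mu_ / (C * s + 1), eta <= 1 & eta <= d1].
  by split; rewrite !ge_min lexx ?orbT.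
have [g [pg /andP[X0 Xeta] pgx gx _] gu] := dir eta e' eta0 e'0.
set X := `|chi g - e0| in X0 Xeta gx gu.
(* The power whose linear approximation comes closest to s from below: m X <= s < m X + X. *)
pose m := Num.truncn (s / X).
have mX : m%:R * X <= s.
  by rewrite -ler_pdivlMr// /m truncn_le; exact: ltW (divr_gt0 _ _).
have sX : s < m%:R * X + X.
  rewrite -[X in _ + X]mul1r -mulrDl natr1 -ltr_pdivrMr//.
  by apply: truncnS_gt; exact: ltW (divr_gt0 _ _).
have m0 : 0 <= m%:R :> R by [].
have gxX : `|phi (act g x) - x0| <= X by apply: (le_trans gx); rewrite ler_piMl// ltW.
have Xd1 : X < d1 by exact: lt_le_trans eta4.
have [pm le1 pmx le2] : [/\ chart_dom chi (g ^+ m)%g,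
      `|chi (g ^+ m)%g - e0 - m%:R *: (chi g - e0)| <= e' * (m%:R * X),
      chart_dom phi (act (g ^+ m)%g x) &
      `|phi (act (g ^+ m)%g x) - x0| <= C * m%:R * `|phi (act g x) - x0| ].
  apply: iter => //; first exact: le_lt_trans Xd1.
  rewrite -mulrA; apply: lt_le_trans dd1; apply: le_lt_trans s2.
  by rewrite ler_pM2l.
have Zm : Z (g ^+ m)%g.
  split => //.
  have gen (a b : 'rV[R]_k) (p : R) : a - (e0 + s *: u) =
      (a - e0 - p *: b) + (p *: (b - X *: u) + (p * X - s) *: u).
    by apply/matrixP => i j; rewrite !mxE; ring.
  rewrite (gen _ (chi g - e0) m%:R).
  apply: (le_trans (ler_normD _ _)).
  apply: (@le_trans _ _ (e' * (m%:R * X) + (m%:R * (e' * X) + X))).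
    apply: lerD => //; apply: (le_trans (ler_normD _ _)); rewrite !normrZ u1 mulr1.
    apply: lerD; first by rewrite normr_nat ler_wpM2l.
    by rewrite distrC ger0_norm ?subr_ge0// lerBlDr addrC ltW.
  have h1 : e' * (m%:R * X) <= e' * s by rewrite ler_pM2l.
  have h2 : m%:R * (e' * X) <= e' * s by rewrite mulrCA.
  have h3 : X <= e' * s by rewrite (le_trans (ltW Xeta)).
  have h4 : e' * 4 * s <= e * s by rewrite ler_pM2r.
  lra.
have := muP _ Zm; apply/negP; rewrite -ltNge.
apply: (le_lt_trans le2).
have h1 : C * m%:R * `|phi (act g x) - x0| <= C * s * eta.
  apply: (@le_trans _ _ (C * m%:R * (eta * X))).
    by rewrite ler_wpM2l// mulr_ge0// ltW.
  rewrite -!mulrA ler_pM2l// mulrCA [leRHS]mulrC ler_wpM2l// ltW//.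
apply: (le_lt_trans h1).
have : eta * (C * s + 1) <= mu_ by rewrite -ler_pdivlMr.
rewrite mulrDr mulr1 mulrC; lra.
Qed.

(** An adapted g has almost the same coordinates as some h in the stabilizer. Then w = g h^-1 has
    the same effect on x as g but at most half its size, against the last clause of [adapted]. *)
Lemma no_adapted : exists2 eta : R, 0 < eta & forall g, ~ adapted eta g.
Proof.
apply: contrapT => none.
have ex (eta : R) : 0 < eta -> exists g, adapted eta g.
  move=> eta0; apply: contrapT => nex; apply: none; exists eta => // g gP.
  by apply: nex; exists g.
have [u u1 dir] := adapted_direction ex.
(* Two errors of 1/8 put h within X / 4 of g; with tolerance 1/2 in [mul_near] this gives |w| <= X /
   4 + |w| / 2, that is |w| <= X / 2. *)
have e8 : 0 < 8^-1 :> R by rewrite invr_gt0.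
have [s0 s00 s0P] := stabilizer_direction u1 dir e8.
have e2 : 0 < 2^-1 :> R by rewrite invr_gt0.
have [d1 d10 d1P] := mul_near e2.
have [d2 d20 d2P] := div_near d10.
pose eta := Num.min s0 (Num.min d1 d2 / 2).
have d12 : 0 < Num.min d1 d2 / 2 by rewrite divr_gt0// lt_min d10.
have eta0 : 0 < eta by rewrite lt_min s00.
have [g [pg /andP[X0 Xeta] pgx gx gmin] gu] := dir eta _ eta0 e8.
set X := `|chi g - e0| in X0 Xeta gx gu gmin.
move: Xeta; rewrite lt_min => /andP[Xs0]; rewrite ltr_pdivlMr// lt_min => /andP[Xd1 Xd2].
have [h [hx ph hu]] := s0P X X0 Xs0.
have hd : `|chi h - e0| <= 2 * X.
  have -> : chi h - e0 = (chi h - (e0 + X *: u)) + X *: u.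
    by rewrite opprD addrA subrK.
  apply: (le_trans (ler_normD _ _)); rewrite normrZ u1 mulr1 gtr0_norm//.
  lra.
have gh : `|chi g - chi h| <= 4^-1 * X.
  have gen (a b : 'rV[R]_k) : a - b = (a - e0 - X *: u) - (b - (e0 + X *: u)).
    by apply/matrixP => i j; rewrite !mxE; ring.
  rewrite (gen (chi g)).
  by apply: (le_trans (ler_normB _ _)); lra.
have g2 : gball d2 g by split => //; rewrite -/X; lra.
have h2 : gball d2 h by split => //; apply: le_lt_trans hd _; rewrite mulrC.
have h1 : gball d1 h by split => //; apply: le_lt_trans hd _; rewrite mulrC.
have w1 := d2P _ _ g2 h2; set w := (g * h^-1)%g in w1.
have wh : (w * h = g)%g by rewrite /w -mulgA mulVg mulg1.
have [_] := d1P w h w1 h1; rewrite wh => le1.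
have wx : act w x = act g x by rewrite /w (actM GM) -[in LHS]hx (actK GM).
have := gmin w w1.1 wx; apply/negP; rewrite -leNgt.
have : `|chi w - e0| <= `|chi g - chi h| + 2^-1 * `|chi w - e0|.
  rewrite -[X in X <= _]normrN.
  rewrite (_ : - (chi w - e0) = (chi g - chi h - (chi w - e0)) - (chi g - chi h)).
    by apply: (le_trans (ler_normB _ _)); rewrite addrC lerD2l.
  by rewrite addrAC subrr add0r.
by move: gh X0; set a := `|chi g - chi h|; set b := `|chi w - e0|; lra.
Qed.

(** Among the elements sending x to y, one of size below twice the infimum satisfies the last clause
    of [adapted]. Were its size larger than |y - x| / eta, it would be adapted; hence C = 1 /
    eta. *)
Lemma orbit_section : exists2 C : R, 0 < C & forall d : R, 0 < d ->
  exists2 r : R, 0 < r & forall y,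
    Gorbit act x y -> chart_dom phi y -> `|phi y - x0| < r ->
    exists g, [/\ gball d g, y = act g x & `|chi g - e0| <= C * `|phi y - x0|].
Proof.
have [eta eta0 noad] := no_adapted; exists eta^-1; first by rewrite invr_gt0.
move=> d d0; pose d1 := Num.min d eta / 2.
have d10 : 0 < d1 by rewrite divr_gt0// lt_min d0.
have [r r0 rP] := orbit_near d10; exists r => // y xy py yr.
have [g0 [pg0 g0d] yE] := rP y xy py yr.
have [yx|ynx] := eqVneq y x.
  exists 1%g; split; first exact: gball1.
    by rewrite (act1 GM).
  by rewrite yx !subrr !normr0 mulr0.
pose S : set R := [set t | exists h, [/\ chart_dom chi h, act h x = y & t = `|chi h - e0| ]].
have S0 : S `|chi g0 - e0| by exists g0; rewrite yE.
have Slb : lbound S 0 by move=> t [h [_ _ ->]].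
have hS : has_inf S.
  by split; last (exists 0); first by exists `|chi g0 - e0|.
have infd : inf S < d1 by apply: le_lt_trans g0d; apply: (inf_lbound hS.2).
apply: contrapT => none.
have big h : chart_dom chi h -> act h x = y -> `|chi h - e0| < d ->
    eta^-1 * `|phi y - x0| < `|chi h - e0|.
  move=> ph hx hd; rewrite ltNge; apply/negP => le1; apply: none.
  by exists h; split.
have yp : 0 < `|phi y - x0|.
  rewrite normr_gt0 subr_eq0; apply: contra ynx => /eqP E.
  by rewrite -(chart_funK py) E chart_funK.
have dd1 : d1 < d.
  rewrite ltr_pdivrMr//; apply: (@le_lt_trans _ _ d); first by rewrite ge_min lexx.
  by rewrite ltr_pMr// ltr1n.
(* Positivity is needed to find an element strictly below twice the infimum. Every candidate has
   size at least d or, by [big], more than |y - x| / eta. *)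
have inf0 : 0 < inf S.
  have : Num.min d (eta^-1 * `|phi y - x0|) <= inf S.
    apply: lb_le_inf; first by exists `|chi g0 - e0|.
    move=> t [h [ph hx ->]]; rewrite ge_min.
    have [hd|dh] := ltP `|chi h - e0| d; last by [].
    by rewrite (ltW (big h ph hx hd)) orbT.
  by apply: lt_le_trans; rewrite lt_min d0 mulr_gt0// invr_gt0.
have [t [g [pg gx ->]] gt] := inf_adherent inf0 hS.
have g2 : `|chi g - e0| < 2 * inf S by move: gt; rewrite mulr_natl mulr2n.
have gdd : `|chi g - e0| < Num.min d eta.
  by apply: (lt_trans g2); move: infd; rewrite ltr_pdivlMr// mulrC.
move: gdd; rewrite lt_min => /andP[gd geta].
have gbig := big g pg gx gd.
apply: (noad g); split.
- exact: pg.
- by rewrite geta andbT; apply: lt_trans gbig; rewrite mulr_gt0// invr_gt0.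
- by rewrite gx.
- by rewrite gx -ler_pdivrMl// ltW.
move=> h ph hx; apply: (lt_le_trans g2); rewrite ler_pM2l//.
by apply: (inf_lbound hS.2); exists h; rewrite hx gx.
Qed.

(** The curve is obtained by letting the coordinate line e0 + t u of the group act on x; homogeneity
    of [A] turns the first-order expansion into the velocity [A u] at 0. *)
Lemma orbit_tangent (A : 'rV[R]_k -> 'rV[R]_n) (u : 'rV[R]_k) :
  (forall e : R, 0 < e -> exists2 d : R, 0 < d & forall g, gball d g ->
      chart_dom phi (act g x) /\
      `|phi (act g x) - x0 - A (chi g - e0)| <= e * `|chi g - e0|) ->
  (forall (a : R) u, A (a *: u) = a *: A u) ->
  tangent_to (Gorbit act x) x (A u).
Proof.
move=> actA AZ; have [r r0 rP] := chart_img_ball chi1.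
pose q := r / (1 + `|u|); have u1 : 0 < 1 + `|u| by rewrite ltr_wpDr.
have q0 : 0 < q by rewrite divr_gt0.
have img (t : R) : `]- q, q[%classic t -> chart_img chi (e0 + t *: u).
  rewrite /= in_itv /= -ltr_norml => tq; apply: rP.
  rewrite addrAC subrr add0r normrZ.
  have : `|t| * (1 + `|u|) <= r by rewrite -ler_pdivlMr// ltW.
  by rewrite mulrDr mulr1; apply: le_trans; rewrite lerDr.
pose c (t : R) := act (chart_inv chi (e0 + t *: u)) x.
have oI : open `]- q, q[%classic by exact: interval_open.
have cs : smooth_curve `]- q, q[ c.
  apply: (smooth_map2_curve oI (Gmfd_smooth GM)).
    exact: chart_segment_smooth.
  exact: (smooth_curve_cst x oI).
have c0 : c 0 = x by rewrite /c scale0r addr0 chart_funK// (act1 GM).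
exists c, q; split => //; first by move=> t _; exists (chart_inv chi (e0 + t *: u)).
have I0 : `]- q, q[%classic 0 by rewrite /= in_itv /= oppr_lt0 q0.
rewrite /velocity c0 -/phi.
have pc0 : chart_dom phi (c 0) by rewrite c0.
have [dc _ _] := smooth_curve_chart cs aphi I0 pc0.
have da := @differentiable_affine R _ x0 (A u) 0.
have approx (e : R) : 0 < e -> \forall t \near (0 : R),
    `|phi (c t) - (x0 + t *: A u)| <= e * `|t|.
  move=> e_gt0; have e' : 0 < e / (1 + `|u|) by rewrite divr_gt0.
  have [d d0 dP] := actA _ e'.
  have dq : 0 < Num.min q (d / (1 + `|u|)) by rewrite lt_min q0 divr_gt0.
  have : \forall t \near (0 : R), ball (0 : R) (Num.min q (d / (1 + `|u|))) t.
    exact: nbhsx_ballx.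
  apply: filterS => t; rewrite /ball /= sub0r normrN lt_min => /andP[tq td].
  have ti : chart_img chi (e0 + t *: u) by apply: img; rewrite /= in_itv /= -ltr_norml.
  have tu : `|t| * `|u| <= `|t| * (1 + `|u|) by rewrite ler_wpM2l// lerDr.
  have E : chi (chart_inv chi (e0 + t *: u)) - e0 = t *: u.
    by rewrite chart_invK// addrAC subrr add0r.
  have [|_] := dP (chart_inv chi (e0 + t *: u)).
    split; first exact: chart_dom_inv.
    by rewrite E normrZ (le_lt_trans tu)// -ltr_pdivlMr.
  rewrite E AZ opprD addrA => h; apply: (le_trans h).
  rewrite normrZ mulrAC ler_pdivrMr// -mulrA ler_pM2l//.
apply/esym; rewrite /derive1; apply: cvg_lim => //.
apply/cvgrPdist_le => e e_gt0; near=> t.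
have t0 : t != 0 by near: t; exact: nbhs_dnbhs_neq.
have at_ : `|phi (c t) - (x0 + t *: A u)| <= e * `|t|.
  by near: t; apply: cvg_within; exact: approx.
rewrite /= addr0 c0 -[X in `|X - _|](scale1r) -(mulVf t0) -scalerA -scalerBr normrZ.
rewrite normfV ler_pdivrMl ?normr_gt0// mulrC.
by apply: le_trans at_; rewrite -normrN opprB -addrA -opprD addrC.
Unshelve. all: by end_near. Qed.

End OrbitTangent.

Lemma near_at_right (R : realType) (a : R) (P : R -> Prop) :
  (\forall t \near a, P t) -> \forall t \near a^'+, P t.
Proof. by move=> h; rewrite near_withinE; apply: filterS h. Qed.

(** * First variation of the distance and absence of corners *)

Section Minimality.
Context {R : realType} {n k : nat} {M : riemannianType R n}
  {G : lieGroupType R k} {act : G -> M -> M}.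
Hypothesis GM : complete_riemannian_G_manifold act.

Variable x : M.
Let phi : chart R n M := chart_at x.
Let x0 : 'rV[R]_n := phi x.
Let g0 := gram phi x0.
Let aphi : atlas phi. Proof. exact: chart_at_atlas. Qed.
Let phix : chart_dom phi x. Proof. exact: chart_at_dom. Qed.
Let ix : chart_img phi x0. Proof. by exists x. Qed.
Let gs : g0^T = g0. Proof. exact: gram_sym. Qed.
Let gge0 w : 0 <= bilin g0 w w. Proof. exact: bilin_gram_ge0. Qed.

(** By [orbit_section], y = g x with g of size O(|y - x|), so the remainder of the orbit map is o(|y
    - x|); its linear part is tangent to the orbit, hence orthogonal to v. *)
Lemma orbit_first_order (v : 'rV[R]_n) (e : R) :
  (forall w, tangent_to (Gorbit act x) x w -> inner x v w = 0) -> 0 < e ->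
  exists2 r : R, 0 < r & forall y, Gorbit act x y -> chart_dom phi y ->
    `|phi y - x0| < r -> `|bilin g0 v (phi y - x0)| <= e * `|phi y - x0|.
Proof.
move=> vn e_gt0; have [A [actA AZ] _] := act_strict GM x.
have [C C0 CP] := orbit_section GM x.
pose K := (n * n)%:R * `|g0| * `|v| + 1.
have K0 : 0 < K by rewrite ltr_wpDl// !mulr_ge0.
have e' : 0 < e / (K * C) by rewrite divr_gt0// mulr_gt0.
have [d d0 dP] := actA _ e'; have [r r0 rP] := CP d d0.
exists r => // y xy py yr; have [g [gd yE gC]] := rP y xy py yr.
have [_ h] := dP g gd; rewrite -yE -/phi -/x0 in h.
have vA : bilin g0 v (A (chart_at (1%g : G) g - chart_at (1%g : G) 1%g)) = 0.
  by apply: vn; exact: orbit_tangent.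
set a := A _ in h vA.
have -> : bilin g0 v (phi y - x0) = bilin g0 v (phi y - x0 - a).
  by rewrite [RHS]bilinDr bilinNr vA subr0.
apply: (le_trans (bilin_norm _ _ _)).
apply: (@le_trans _ _ (K * (e / (K * C) * (C * `|phi y - x0|)))).
  apply: ler_pM => //; first by rewrite lerDl.
  by apply: (le_trans h); rewrite ler_wpM2l// ltW.
rewrite (_ : K * _ = e * `|phi y - x0|)//.
by field; rewrite !gt_eqF.
Qed.

(** Calibrating by v, a curve between w h and a point y of the orbit satisfies (1 + e1) |v| length
    >= <w h - x, v> - <y - x, v>. The first product is h |v|^2 + o(h); the second is o(h), since y
    is within O(h) of x. Both orientations occur in [no_corner]. *)
Lemma orbit_dist_lower (w : R -> M) (v : 'rV[R]_n) (e : R) :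
  (forall u, tangent_to (Gorbit act x) x u -> inner x v u = 0) ->
  {for 0, continuous w} -> w 0 = x ->
  (forall e : R, 0 < e -> \forall h \near (0 : R),
      `|phi (w h) - x0 - h *: v| <= e * `|h|) ->
  0 < e -> exists2 r : R, 0 < r & forall h : R, 0 < h -> h < r ->
    forall c (a b : R), broken c a b ->
     (c a = w h /\ Gorbit act x (c b)) \/ (Gorbit act x (c a) /\ c b = w h) ->
     h * (Num.sqrt (bilin g0 v v) - e) <= curve_length c a b.
Proof.
move=> vn wc w0 wv e_gt0; pose nv := Num.sqrt (bilin g0 v v).
have nv2 : bilin g0 v v = nv * nv by rewrite -expr2 sqr_sqrtr.
have nv0 : 0 <= nv by exact: sqrtr_ge0.
have [nvE|nvn0] := eqVneq nv 0.
  exists 1 => // h h0 _ c a b _ _; apply: le_trans (length_ge0 _ _ _).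
  by rewrite -/nv nvE sub0r mulrN oppr_le0 mulr_ge0// ltW.
have nvp : 0 < nv by rewrite lt0r nvn0.
have [C C0 CP] := short_curve aphi phix.
pose K := (n * n)%:R * `|g0| * `|v| + 1.
have K0 : 0 < K by rewrite ltr_wpDl// !mulr_ge0.
(* [L] bounds |y - x| / h. The tolerances [e2] and [e3] cost h e |v| / 4 each, and [e1] turns |v|
   (|v| - e) into |v|^2 - 3 e |v| / 4 - e^2 / 4, which is still too small. *)
pose L := `|v| + 1 + C * nv; have L0 : 0 < L.
  by rewrite ltr_pwDl// ?ltr_wpDl// mulr_ge0// ltW.
pose e1 := e / (4 * nv); have e10 : 0 < e1 by rewrite divr_gt0// mulr_gt0.
pose e2 := Num.min 1 (e * nv / (4 * K)).
have e20 : 0 < e2 by rewrite lt_min ltr01 divr_gt0// mulr_gt0.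
pose e3 := e * nv / (4 * L); have e30 : 0 < e3 by rewrite divr_gt0// mulr_gt0.
have [d1 d10 d1P] := length_lower v aphi phix e10.
have [d3 d30 d3P] := orbit_first_order vn e30.
(* For curves running from w h to the orbit the calibrating covector changes sign. *)
have [d4 d40 d4P] := length_lower (- v) aphi phix e10.
pose dm := Num.min (Num.min d1 d4) d3.
have dm0 : 0 < dm by rewrite !lt_min d10 d40.
have [dm1 dm4 dm3] : [/\ dm <= d1, dm <= d4 & dm <= d3].
  by split; rewrite !ge_min lexx ?orbT.
have [d2 d20 d2P] := CP _ dm0.
have nearw : \forall h \near (0 : R), chart_dom phi (w h).
  by apply: wc; rewrite w0; exact: near_chart_dom.
have [r1 /= r10 r1P] : \forall h \near (0 : R), chart_dom phi (w h) /\
    `|phi (w h) - x0 - h *: v| <= e2 * `|h| := filterI nearw (wv _ e20).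
pose r := Num.min r1 (d2 / (L + nv)).
have Ln : 0 < L + nv by rewrite addr_gt0.
exists r; first by rewrite lt_min r10 divr_gt0.
move=> h h0; rewrite lt_min => /andP[hr1]; rewrite ltr_pdivlMr// => hd2.
have [pw wh] : chart_dom phi (w h) /\ `|phi (w h) - x0 - h *: v| <= e2 * `|h|.
  by apply: r1P; rewrite /ball /= sub0r normrN gtr0_norm.
rewrite gtr0_norm// in wh.
have wn : `|phi (w h) - x0| <= h * (`|v| + 1).
  rewrite -(subrK (h *: v) (_ - _)); apply: (le_trans (ler_normD _ _)).
  rewrite normrZ gtr0_norm// mulrDr mulr1 addrC lerD2l (le_trans wh)//.
  by rewrite ler_piMl ?(ltW h0)// ge_min lexx.
(* A counterexample is shorter than h |v|, which is what confines it to the chart. *)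
move=> c a b cab ends; rewrite leNgt; apply/negP => short; rewrite -/nv in short.
have lnv : curve_length c a b < h * nv.
  by apply: (lt_le_trans short); rewrite ler_pM2l// gerBl ltW.
have ld2 : curve_length c a b < d2.
  by apply: (lt_trans lnv); apply: le_lt_trans hd2; rewrite ler_pM2l// lerDr ltW.
have wd2 : `|phi (w h) - x0| < d2.
  apply: (le_lt_trans wn); apply: le_lt_trans hd2; rewrite ler_pM2l//.
  by rewrite /L -addrA lerDl addr_ge0// mulr_ge0// ltW.
have ab := ltW (broken_lt cab).
have aI : a \in `[a, b] by rewrite in_itv /= lexx.
have bI : b \in `[a, b] by rewrite in_itv /= lexx ab.
have key (y : M) : Gorbit act x y -> chart_dom phi y -> `|phi y - x0| < d3 ->
    `|phi (w h) - phi y| <= C * curve_length c a b ->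
    bilin g0 (phi (w h) - phi y) v <= (1 + e1) * nv * curve_length c a b -> False.
  move=> xy py yd3 wy le1.
  have yn : `|phi y - x0| <= h * L.
    rewrite (_ : phi y - x0 = (phi (w h) - x0) - (phi (w h) - phi y)); last first.
      by rewrite opprB [RHS]addrC subrKA.
    apply: (le_trans (ler_normB _ _)); rewrite /L mulrDr lerD//.
    by apply: (le_trans wy); rewrite mulrCA ler_pM2l// ltW.
  have h1 : bilin g0 v (phi y - x0) <= h * (e * nv / 4).
    apply: (le_trans (ler_norm _)); apply: (le_trans (d3P _ xy py yd3)).
    apply: (@le_trans _ _ (e3 * (h * L))); first by rewrite ler_pM2l.
    by rewrite (_ : e3 * (h * L) = h * (e * nv / 4))// /e3; field; rewrite gt_eqF.
  have h2 : h * (nv * nv) - h * (e * nv / 4) <= bilin g0 v (phi (w h) - x0).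
    rewrite -(subrK (h *: v) (phi (w h) - x0)) bilinDr bilinZr nv2 addrC lerD2r lerNl.
    apply: (le_trans (ler_norm _)); rewrite normrN.
    apply: (le_trans (bilin_norm _ _ _)).
    apply: (@le_trans _ _ (K * (e2 * h))).
      by apply: ler_pM => //; rewrite lerDl.
    apply: (@le_trans _ _ (K * (e * nv / (4 * K) * h))).
      by rewrite ler_pM2l// ler_pM2r// ge_min lexx orbT.
    by rewrite (_ : K * _ = h * (e * nv / 4))//; field; rewrite gt_eqF.
  have h3 : h * (nv * nv) - h * (e * nv / 2) <= (1 + e1) * nv * curve_length c a b.
    apply: le_trans le1; rewrite bilinC//.
    rewrite (_ : phi (w h) - phi y = (phi (w h) - x0) - (phi y - x0)); last first.
      by rewrite opprB addrA subrK.
    rewrite bilinDr bilinNr.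
    rewrite (_ : h * (e * nv / 2) = h * (e * nv / 4) + h * (e * nv / 4)); last by field.
    by rewrite opprD addrA lerB.
  have h4 : (1 + e1) * nv * curve_length c a b < (1 + e1) * nv * (h * (nv - e)).
    by rewrite ltr_pM2l// mulr_gt0// addr_gt0.
  have := le_lt_trans h3 h4; apply/negP; rewrite -leNgt.
  rewrite (_ : (1 + e1) * nv * (h * (nv - e)) =
    h * (nv * nv) - h * (e * nv / 2) - h * (e * nv / 4 + e * e / 4)); last first.
    by rewrite /e1; field; rewrite gt_eqF.
  by rewrite gerBl mulr_ge0 ?ltW// addr_gt0// !divr_gt0// mulr_gt0.
case: ends => -[].
  move=> ca xb; have [in_ lip] : [/\ forall t, t \in `[a, b] ->
      chart_dom phi (c t) /\ `|phi (c t) - phi x| < dm &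
      `|phi (c b) - phi (c a)| <= C * curve_length c a b].
    by apply: (d2P c a b a) => //; [left|rewrite ca|rewrite ca].
  have [pb bd] := in_ b bI; apply: (key _ xb pb (lt_le_trans bd dm3)).
    by rewrite -ca distrC.
  rewrite -ca -[phi (c a) - _]opprB bilinNl -bilinNr.
  have nvN : Num.sqrt (bilin g0 (- v) (- v)) = nv.
    by rewrite bilinNl bilinNr opprK.
  rewrite -nvN; apply: d4P => // t /in_[pt td]; split => //.
  exact: lt_le_trans dm4.
move=> xa cb; have [in_ lip] : [/\ forall t, t \in `[a, b] ->
    chart_dom phi (c t) /\ `|phi (c t) - phi x| < dm &
    `|phi (c b) - phi (c a)| <= C * curve_length c a b].
  by apply: (d2P c a b b) => //; [right|rewrite cb|rewrite cb].
have [pa ad] := in_ a aI; apply: (key _ xa pa (lt_le_trans ad dm3)).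
  by rewrite -cb.
rewrite -cb; apply: d1P => // t /in_[pt td]; split => //.
exact: lt_le_trans dm1.
Qed.

(* A minimal connection through x and its image under an isometry fixing x
   cannot form a corner at x: cutting the corner would shorten it. *)
Lemma no_corner (w1 w2 : R -> M) (v1 v2 : 'rV[R]_n) :
  (forall u, tangent_to (Gorbit act x) x u -> inner x v1 u = 0) ->
  (forall u, tangent_to (Gorbit act x) x u -> inner x v2 u = 0) ->
  {for 0, continuous w1} -> {for 0, continuous w2} -> w1 0 = x -> w2 0 = x ->
  (forall e : R, 0 < e -> \forall h \near (0 : R),
      `|phi (w1 h) - x0 - h *: v1| <= e * `|h|) ->
  (forall e : R, 0 < e -> \forall h \near (0 : R),
      `|phi (w2 h) - x0 - h *: v2| <= e * `|h|) ->
  (\forall h \near 0^'+,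
    [/\ joined (Gorbit act (w1 h)) (Gorbit act x),
       joined (Gorbit act x) (Gorbit act (w2 h)) &
       set_dist (Gorbit act (w1 h)) (Gorbit act x) +
       set_dist (Gorbit act x) (Gorbit act (w2 h)) <=
       set_dist (Gorbit act (w1 h)) (Gorbit act (w2 h))]) ->
  bilin g0 v1 v1 = bilin g0 v2 v2 -> v1 = - v2.
Proof.
move=> vn1 vn2 wc1 wc2 w10 w20 wv1 wv2 min v12.
pose nv := Num.sqrt (bilin g0 v1 v1); pose nd := Num.sqrt (bilin g0 (v2 - v1) (v2 - v1)).
have nv0 : 0 <= nv by exact: sqrtr_ge0.
have nd0 : 0 <= nd by exact: sqrtr_ge0.
have main : 2 * nv <= nd.
  apply/ler_addgt0Pr => e e_gt0.
  have e4 : 0 < e / 4 by rewrite divr_gt0.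
  pose K := Num.sqrt ((n * n)%:R * `|g0|) + 1.
  have K0 : 0 < K by rewrite ltr_wpDl// sqrtr_ge0.
  (* Error budget: each of the two lower bounds loses e / 4, [e1 * nd] is at most e / 4, and [e2] is
     chosen so that the remainders of [w1] and [w2] contribute e / 4. *)
  pose e1 := e / (4 * (nd + 1)).
  have nd1 : 0 < nd + 1 by rewrite ltr_wpDl.
  have e10 : 0 < e1 by rewrite divr_gt0// mulr_gt0.
  pose e2 := e / (4 * K * 2 * (1 + e1)).
  have e11 : 0 < 1 + e1 by rewrite addr_gt0.
  have e20 : 0 < e2 by rewrite divr_gt0// !mulr_gt0.
  have [r1 r10 r1P] := orbit_dist_lower vn1 wc1 w10 wv1 e4.
  have [r2 r20 r2P] := orbit_dist_lower vn2 wc2 w20 wv2 e4.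
  have [d d0 dP] := short_segment aphi phix e10.
  have near1 (w : R -> M) (v : 'rV[R]_n) : {for 0, continuous w} -> w 0 = x ->
      \forall h \near 0^'+, chart_dom phi (w h) /\ `|phi (w h) - x0| < d.
    move=> wc w0; have nb : nbhs (w 0) [set z | chart_dom phi z /\ `|phi z - x0| < d].
      apply: open_nbhs_nbhs; split; first exact: open_chart_ball.
      by rewrite w0; split => //; rewrite subrr normr0.
    have hn : \forall h \near (0 : R), chart_dom phi (w h) /\ `|phi (w h) - x0| < d.
      exact: wc _ nb.
    exact: near_at_right.
  near (0 : R)^'+ => h.
  have h0 : 0 < h by near: h; exact: nbhs_right_gt.
  have hr1 : h < r1 by near: h; exact: nbhs_right_lt.
  have hr2 : h < r2 by near: h; exact: nbhs_right_lt.
  have [j1 j2 tri] : [/\ joined (Gorbit act (w1 h)) (Gorbit act x),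
       joined (Gorbit act x) (Gorbit act (w2 h)) &
       set_dist (Gorbit act (w1 h)) (Gorbit act x) +
       set_dist (Gorbit act x) (Gorbit act (w2 h)) <=
       set_dist (Gorbit act (w1 h)) (Gorbit act (w2 h))] by near: h.
  have [p1 wd1] : chart_dom phi (w1 h) /\ `|phi (w1 h) - x0| < d.
    by near: h; exact: near1.
  have [p2 wd2] : chart_dom phi (w2 h) /\ `|phi (w2 h) - x0| < d.
    by near: h; exact: near1.
  have a1 : `|phi (w1 h) - x0 - h *: v1| <= e2 * h.
    by rewrite -[X in _ <= _ * X](gtr0_norm h0); near: h; apply: near_at_right; exact: wv1.
  have a2 : `|phi (w2 h) - x0 - h *: v2| <= e2 * h.
    by rewrite -[X in _ <= _ * X](gtr0_norm h0); near: h; apply: near_at_right; exact: wv2.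
  (* The curve may start at another point of the orbit of [w1 h]; an isometry from G moves it back
     and keeps the orbit of x. *)
  have l1 : h * (nv - e / 4) <= set_dist (Gorbit act (w1 h)) (Gorbit act x).
    apply: le_set_dist => // c a b cab [g _ gca] xb.
    have [cab' <-] := isometry_broken (act_isometry GM g^-1%g) cab.
    apply: (r1P h h0 hr1 _ _ _ cab'); left; split; first by rewrite /= -gca (actK GM).
    exact: Gorbit_act.
  have l2 : h * (nv - e / 4) <= set_dist (Gorbit act x) (Gorbit act (w2 h)).
    apply: le_set_dist => // c a b cab xa [g _ gcb].
    have [cab' <-] := isometry_broken (act_isometry GM g^-1%g) cab.
    rewrite /nv v12; apply: (r2P h h0 hr2 _ _ _ cab'); right.
    split; last by rewrite /= -gcb (actK GM).
    exact: Gorbit_act.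
  have [c [c01 c0 c1 cl]] := dP _ _ wd1 wd2.
  rewrite chart_funK// in c0; rewrite chart_funK// in c1.
  have u : set_dist (Gorbit act (w1 h)) (Gorbit act (w2 h)) <=
      (1 + e1) * Num.sqrt (bilin g0 (phi (w2 h) - phi (w1 h)) (phi (w2 h) - phi (w1 h))).
    by apply: le_trans cl; apply: set_dist_le c01 _ _; rewrite ?c0 ?c1; exact: Gorbit_refl.
  have sqD (p q : 'rV[R]_n) : Num.sqrt (bilin g0 (p + q) (p + q)) <=
      Num.sqrt (bilin g0 p p) + Num.sqrt (bilin g0 q q).
    rewrite -[leRHS]ger0_norm ?addr_ge0 ?sqrtr_ge0// -sqrtr_sqr ler_wsqrtr//.
    rewrite sqrrD !sqr_sqrtr// !bilinDl !bilinDr (bilinC q p gs) mulr2n.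
    have := bilin_CS p q gs gge0.
    move: (bilin g0 p p) (bilin g0 q q) (bilin g0 p q) (_ * _) => A B C D; lra.
  have sqK (p : 'rV[R]_n) : Num.sqrt (bilin g0 p p) <= K * `|p|.
    apply: (@le_trans _ _ (Num.sqrt ((n * n)%:R * `|g0|) * `|p|)).
      rewrite -[X in _ * X]normr_id -sqrtr_sqr -sqrtrM ?mulr_ge0// ler_wsqrtr//.
      by rewrite (le_trans (ler_norm _))// (le_trans (bilin_norm _ _ _))// expr2 mulrA.
    by rewrite ler_wpM2r// lerDl.
  have up : Num.sqrt (bilin g0 (phi (w2 h) - phi (w1 h)) (phi (w2 h) - phi (w1 h))) <=
      h * nd + K * (2 * e2 * h).
    rewrite (_ : phi (w2 h) - phi (w1 h) = h *: (v2 - v1) +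
       ((phi (w2 h) - x0 - h *: v2) - (phi (w1 h) - x0 - h *: v1))); last first.
      by apply/matrixP => i j; rewrite !mxE; ring.
    apply: (le_trans (sqD _ _)); apply: lerD.
      rewrite bilinZl bilinZr mulrA -expr2 sqrtrM ?sqr_ge0// sqrtr_sqr gtr0_norm//.
    apply: (le_trans (sqK _)); rewrite ler_pM2l//.
    apply: (le_trans (ler_normB _ _)); rewrite -mulrA mulr_natl mulr2n.
    exact: lerD.
  have tot : h * (nv - e / 4) + h * (nv - e / 4) <= (1 + e1) * (h * nd + K * (2 * e2 * h)).
    apply: (le_trans (lerD l1 l2)); apply: (le_trans tri); apply: (le_trans u).
    by rewrite ler_pM2l.
  have E : (1 + e1) * (h * nd + K * (2 * e2 * h)) = h * (nd + e1 * nd + e / 4).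
    by rewrite /e2; field; rewrite !gt_eqF.
  have E1 : e1 * nd <= e / 4.
    rewrite /e1 invfM mulrA mulrAC ler_pdivrMr// ler_pM2l//.
    by rewrite lerDl.
  move: tot; rewrite E -mulrDr ler_pM2l//; lra.
have : (2 * nv) ^+ 2 <= nd ^+ 2 by rewrite ler_sqr ?nnegrE// mulr_ge0.
rewrite exprMn !sqr_sqrtr// => le1.
(* Parallelogram law for vectors of equal length: |v2 - v1| >= 2 |v1| leaves nothing for |v1 +
   v2|. *)
have pd : bilin g0 (v2 - v1) (v2 - v1) + bilin g0 (v1 + v2) (v1 + v2) =
    4 * bilin g0 v1 v1.
  by rewrite !bilinDl !bilinDr !bilinNl !bilinNr -v12; ring.
have [h|h] := eqVneq (v1 + v2) 0; first by apply/eqP; rewrite -addr_eq0 h.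
have p : 0 < bilin g0 (v1 + v2) (v1 + v2) by exact: gram_pos.
exfalso; move: le1 pd p.
move: (bilin g0 (v2 - v1) _) (bilin g0 (v1 + v2) _) (bilin g0 v1 v1) => A B C; lra.
Unshelve. all: by end_near. Qed.

End Minimality.

(** * Geodesics *)

Section GeodesicEquation.
Context {R : realType} {n : nat}.
Implicit Types (y z c : R -> 'rV[R]_n) (t : R) (u v w p : 'rV[R]_n).

Lemma is_derive_bilin (A : R -> 'M[R]_n) (u v : R -> 'rV[R]_n) t :
  differentiable A t -> differentiable u t -> differentiable v t ->
  is_derive t 1 (fun s => bilin (A s) (u s) (v s))
    (bilin (derive1 A t) (u t) (v t) + bilin (A t) (derive1 u t) (v t) +
     bilin (A t) (u t) (derive1 v t)).
Proof.
move=> dA du dv.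
have -> : (fun s => bilin (A s) (u s) (v s)) =
    \sum_i \sum_j (fun s => u s 0 j * A s j i * v s 0 i).
  apply/funext => s; rewrite bilinE fct_sumE; apply: eq_bigr => i _.
  by rewrite fct_sumE.
have term (i j : 'I_n) : is_derive t (1 : R) (fun s => u s 0 j * A s j i * v s 0 i)
    (u t 0 j * derive1 A t j i * v t 0 i + derive1 u t 0 j * A t j i * v t 0 i +
     u t 0 j * A t j i * derive1 v t 0 i).
  have h1 := is_derive_coord 0 j du; have h2 := is_derive_coord j i dA.
  have h3 := is_derive_coord 0 i dv.
  have h12 := @is_deriveM R R (fun s => u s 0 j) (fun s => A s j i) t 1 _ _ h1 h2.
  have h := @is_deriveM R R (fun s => u s 0 j * A s j i) (fun s => v s 0 i) t 1 _ _ h12 h3.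
  apply: is_derive_eq h _.
  move: (u t 0 j) (A t j i) (v t 0 i) (derive1 u t 0 j) (derive1 A t j i)
    (derive1 v t 0 i) => a b d e f g; rewrite /GRing.scale /=; ring.
have h : is_derive t (1 : R)
    (\sum_i \sum_j (fun s => u s 0 j * A s j i * v s 0 i))
    (\sum_i \sum_j
    (u t 0 j * derive1 A t j i * v t 0 i + derive1 u t 0 j * A t j i * v t 0 i +
     u t 0 j * A t j i * derive1 v t 0 i)).
  by apply: is_derive_sum => i; apply: is_derive_sum => j; exact: term.
apply: is_derive_eq h _.
rewrite !bilinE -!big_split /=; apply: eq_bigr => i _.
by rewrite -!big_split.
Qed.

Lemma derive1_along m q (f : 'rV[R]_n -> 'M[R]_(m, q)) c t :
  differentiable c t -> differentiable f (c t) ->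
  differentiable (f \o c) t /\ derive1 (f \o c) t = 'D_(derive1 c t) f (c t).
Proof.
move=> dc df; split; first exact: differentiable_comp.
by rewrite derive1_comp_diff// deriveE.
Qed.

(** The second difference [Dl] is symmetric in its two directions. It equals h^2 'D_a ('D_b f) +
    o(h^2), by the mean value theorem in direction b and strict differentiability of 'D_b f at p. *)
Lemma schwarz m q (U : set 'rV[R]_n) (f : 'rV[R]_n -> 'M[R]_(m, q)) p u v :
  open U -> U p -> Ck 2 U f -> 'D_u ('D_v f) p = 'D_v ('D_u f) p.
Proof.
move=> Uo Up [fd fk].
pose Dl (a b : 'rV[R]_n) (h : R) : 'M[R]_(m, q) :=
  f (p + h *: a + h *: b) - f (p + h *: a) - (f (p + h *: b) - f p).
have main (a b : 'rV[R]_n) (e : R) : 0 < e -> exists2 d : R, 0 < d &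
    forall h : R, 0 < h -> h < d ->
      `|Dl a b h - (h * h) *: 'D_a ('D_b f) p| <= e * (h * h) * `|a|.
  move=> e_gt0; have [d d0 dP] := Ck1_strict Uo Up (fk b) e_gt0.
  have ab : 0 < `|a| + `|b| + 1 by rewrite ltr_wpDl// addr_ge0.
  exists (d / (`|a| + `|b| + 1)); first by rewrite divr_gt0.
  move=> h h0; rewrite ltr_pdivlMr// => hd.
  have in_d (s r : R) : 0 <= s <= h -> 0 <= r <= h ->
      `|p + s *: a + r *: b - p| < d.
    move=> /andP[s0 sh] /andP[r0 rh];
    have -> : p + s *: a + r *: b - p = s *: a + r *: b.
      by rewrite -[p + _ + _]addrA addrAC subrr add0r.
    apply: le_lt_trans hd; apply: (le_trans (ler_normD _ _)).
    rewrite !normrZ !ger0_norm// !mulrDr mulr1.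
    apply: (@le_trans _ _ (h * `|a| + h * `|b|)).
      by apply: lerD; apply: ler_wpM2r.
    by rewrite lerDl ltW.
  have dfd : differentiable ('D_b f) p by have [+ _] := fk b; exact.
  apply: mx_norm_le => [|i j]; first by rewrite !mulr_ge0// ltW.
  pose F (r : R) : 'M[R]_(m, q) := f (p + h *: a + r *: b) - f (p + 0 *: a + r *: b).
  have h00 : 0 <= h <= h by rewrite lexx ltW.
  have z0h : 0 <= (0 : R) <= h by rewrite lexx ltW.
  have dF (r : R) : 0 <= r <= h -> is_derive r 1 (fun r => F r i j)
      (('D_b f (p + h *: a + r *: b) - 'D_b f (p + 0 *: a + r *: b)) i j).
    move=> rh.
    have one (s : R) : 0 <= s <= h ->
        is_derive r 1 (fun r : R => f (p + s *: a + r *: b) i j)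
          ('D_b f (p + s *: a + r *: b) i j).
      move=> sh; have dc := @differentiable_affine R _ (p + s *: a) b r.
      have [U1 _ _] := dP _ _ (in_d _ _ sh rh) (in_d _ _ sh rh).
      have [dfc E] := derive1_along dc (fd _ U1).
      rewrite derive1_affine in E; rewrite -E.
      exact: (is_derive_coord i j dfc).
    have h1 := one _ h00; have h2 := one _ z0h.
    have hB := @is_deriveB _ _ _ _ _ r 1 _ _ h1 h2.
    rewrite (_ : (fun r => F r i j) = (fun r : R => f (p + h *: a + r *: b) i j) -
      (fun r : R => f (p + 0 *: a + r *: b) i j)); last first.
      by apply/funext => r'; rewrite /F !mxE.
    by apply: is_derive_eq hB _; rewrite !mxE.
  pose F' (r : R) := ('D_b f (p + h *: a + r *: b) - 'D_b f (p + 0 *: a + r *: b)) i j.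
  have [r rI FE] : exists2 r, r \in `[0, h] & F h i j - F 0 i j = F' r * (h - 0).
    apply: (@MVT_segment _ (fun r => F r i j) F' 0 h (ltW h0)).
      move=> r; rewrite in_itv/= => /andP[r0 rh]; apply: dF.
      by rewrite !ltW.
    apply: derivable_within_continuous => r; rewrite in_itv/= => rI.
    by have [] := dF r rI.
  rewrite in_itv/= in rI.
  have [_ _ st] := dP _ _ (in_d _ _ h00 rI) (in_d _ _ z0h rI).
  have -> : (Dl a b h - (h * h) *: 'D_a ('D_b f) p) i j =
      h * (F' r - h * 'D_a ('D_b f) p i j).
    have -> : (Dl a b h - (h * h) *: 'D_a ('D_b f) p) i j =
        F h i j - F 0 i j - h * h * 'D_a ('D_b f) p i j.
      by rewrite /Dl /F scale0r !addr0 scale0r !addr0 !mxE; ring.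
    by rewrite FE subr0; ring.
  rewrite normrM gtr0_norm//.
  rewrite (_ : e * (h * h) * `|a| = h * (e * (h * `|a|))); last by ring.
  rewrite ler_pM2l//.
  have <- : `|p + h *: a + r *: b - (p + 0 *: a + r *: b)| = h * `|a|.
    rewrite scale0r addr0 (_ : _ - _ = h *: a) ?normrZ ?gtr0_norm//.
    by rewrite [p + _ + _]addrAC [LHS]addrC addKr.
  apply: le_trans st; apply: le_trans (coord_le_norm _ i j).
  rewrite le_eqVlt; apply/orP; left; apply/eqP; congr `|_|.
  rewrite /F' -deriveE//.
  have -> : p + h *: a + r *: b - (p + 0 *: a + r *: b) = h *: a.
    by rewrite scale0r addr0 [p + _ + _]addrAC [LHS]addrC addKr.
  have Dz : 'D_(h *: a) ('D_b f) p = h *: 'D_a ('D_b f) p.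
    by rewrite (deriveE (h *: a) dfd) (deriveE a dfd); exact: linearZ.
  by rewrite Dz !mxE.
have sym h : Dl u v h = Dl v u h.
  rewrite /Dl (addrAC p (h *: v)) opprB !opprD !opprK.
  move: (f (p + h *: u + h *: v)) (f (p + h *: u)) (f (p + h *: v)) (f p) => A B C D.
  by apply/matrixP => i j; rewrite !mxE; ring.
apply/eqP; rewrite -subr_eq0 -normr_le0; apply/ler_addgt0Pr => e e_gt0.
have uv : 0 < `|u| + `|v| + 1 by rewrite ltr_wpDl// addr_ge0.
have e1 : 0 < e / (`|u| + `|v| + 1) by rewrite divr_gt0.
have [d1 d10 d1P] := main u v _ e1; have [d2 d20 d2P] := main v u _ e1.
pose h := Num.min d1 d2 / 2; have h0 : 0 < h by rewrite divr_gt0// lt_min d10.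
have hlt : h < Num.min d1 d2.
  by rewrite ltr_pdivrMr// ltr_pMr ?ltr1n// lt_min d10.
move: hlt; rewrite lt_min => /andP[h1 h2].
have := lerD (d1P h h0 h1) (d2P h h0 h2); rewrite -sym -mulrDr.
set X := 'D_u _ _; set Y := 'D_v _ _ => le1.
have le2 : (h * h) * `|X - Y| <= (h * h) * (e / (`|u| + `|v| + 1) * (`|u| + `|v|)).
  have -> : h * h * `|X - Y| = `|(h * h) *: (X - Y)|.
    by rewrite normrZ gtr0_norm//; exact: mulr_gt0.
  have gen (a b D : 'M[R]_(m, q)) (r : R) : r *: (a - b) = (D - r *: b) - (D - r *: a).
    by rewrite scalerBr opprB [RHS]addrC subrKA.
  rewrite (gen X Y (Dl u v h)).
  apply: (le_trans (ler_normB _ _)); rewrite addrC; apply: (le_trans le1).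
  by rewrite le_eqVlt; apply/orP; left; apply/eqP; ring.
have hh : 0 < h * h by exact: mulr_gt0.
rewrite add0r; move: le2; rewrite (ler_pM2l hh) => le2.
apply: (le_trans le2); rewrite mulrAC ler_pdivrMr// ler_pM2l//.
by rewrite lerDl.
Qed.

(** Weak Euler-Lagrange equation of the energy: d/dt G(y)(y', w) = 1/2 (D_w G)(y', y') for every
    constant w, with the left side expanded. It involves no inverse of G. *)
Definition geo_eq (G : 'rV[R]_n -> 'M[R]_n) y t := forall w,
  bilin (G (y t)) (derive1 (derive1 y) t) w =
  2^-1 * bilin ('D_w G (y t)) (derive1 y t) (derive1 y t) -
  bilin ('D_(derive1 y t) G (y t)) (derive1 y t) w.

(* The geodesic equation is the Euler-Lagrange equation of the energy, hence it
   is preserved by maps that preserve the metric; the second derivatives of the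
   map cancel by Schwarz' theorem. *)
Lemma geo_eq_covariant (G H : 'rV[R]_n -> 'M[R]_n) (U V : set 'rV[R]_n)
    (T : 'rV[R]_n -> 'rV[R]_n) y (O : set R) t :
  open U -> Ck 2 U T -> open O -> O t ->
  (forall s, O s -> U (y s) /\ differentiable y s) ->
  differentiable (derive1 y) t -> (forall p, U p -> differentiable G p) ->
  (forall p, V p -> differentiable H p) -> (forall p, U p -> V (T p)) ->
  (forall p, U p -> (H (T p))^T = H (T p)) ->
  (forall p u v, U p -> bilin (G p) u v = bilin (H (T p)) ('D_u T p) ('D_v T p)) ->
  (forall w', exists w, 'D_w T (y t) = w') ->
  geo_eq G y t -> geo_eq H (T \o y) t.
Proof.
move=> Uo /[dup] T2 [Td Tk] Oo Ot yO d'y Gd Hd UV Hs iso surj gy w'.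
have [w wE] := surj w'; have [Uy dy] := yO t Ot.
pose z := T \o y; pose v := derive1 y t.
have zE s : O s -> differentiable z s /\ derive1 z s = 'D_(derive1 y s) T (y s).
  by move=> /yO[Us ds]; apply: derive1_along => //; exact: Td.
have [dz zt] := zE t Ot.
have Tk1 u : differentiable ('D_u T) (y t) by have [+ _] := Tk u; exact.
have nO : \forall s \near t, O s by exact: open_nbhs_nbhs.
have Dlin s : O s -> 'D_(derive1 y s) T (y s) =
    \sum_i derive1 y s 0 i *: 'D_(delta_mx 0 i) T (y s).
  by move=> /yO[Us ds]; apply: derive_basis; exact: Td.
have d'z : differentiable (derive1 z) t.
  have h : differentiable (\sum_(i < n) (fun s => derive1 y s 0 i *:
      'D_(delta_mx 0 i) T (y s))) t.
    apply: differentiable_sum => i; apply/differentiable_mxP => a b.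
    have -> : (fun s => (derive1 y s 0 i *: 'D_(delta_mx 0 i) T (y s)) a b) =
      (fun s => derive1 y s 0 i) * (fun s => 'D_(delta_mx 0 i) T (y s) a b).
      by apply/funext => s; rewrite mxE.
    apply: differentiableM.
      by have /differentiable_mxP := d'y; apply.
    have /differentiable_mxP := differentiable_comp dy (Tk1 (delta_mx 0 i)).
    by apply.
  apply: near_eq_differentiable h; apply: filterS nO => s Os.
  by rewrite fct_sumE (zE s Os).2 Dlin.
have [dHz HzE] : differentiable (H \o z) t /\
    derive1 (H \o z) t = 'D_(derive1 z t) H (z t).
  by apply: derive1_along => //; apply: Hd; exact: UV.
have [dGy GyE] : differentiable (G \o y) t /\
    derive1 (G \o y) t = 'D_(derive1 y t) G (y t).
  by apply: derive1_along => //; exact: Gd.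
have [dTw TwE] := derive1_along dy (Tk1 w).
(* Derivative along the curve of G(y)(y', w) = H(z)(z', D_w T(y)) with w constant. *)
have P : bilin (derive1 (G \o y) t) v w + bilin (G (y t)) (derive1 (derive1 y) t) w =
   bilin (derive1 (H \o z) t) (derive1 z t) w' +
   bilin (H (z t)) (derive1 (derive1 z) t) w' +
   bilin (H (z t)) (derive1 z t) (derive1 ('D_w T \o y) t).
  have [_ e1] := is_derive_bilin dGy d'y (@differentiable_cst _ _ _ w t).
  have [_ e2] := is_derive_bilin dHz d'z dTw.
  rewrite /= wE in e2; rewrite -e2.
  have c0 : derive1 (cst w : R -> 'rV[R]_n) t = 0 by rewrite derive1_cst.
  rewrite c0 bilin0r addr0 in e1; rewrite -e1.
  apply: near_eq_derive; apply: filterS nO => s Os /=.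
  have [Us _] := yO s Os; rewrite (iso _ _ _ Us) (zE s Os).2.
  exact: erefl.
(* Derivative at r = 0 of the invariance identity for the pair v, v along the line y t + r w. *)
have Q : bilin ('D_w G (y t)) v v =
   bilin ('D_w' H (z t)) (derive1 z t) (derive1 z t) +
   2 * bilin (H (z t)) (derive1 z t) ('D_w ('D_v T) (y t)).
  pose l (r : R) := y t + r *: w.
  have l0 : l 0 = y t by rewrite /l scale0r addr0.
  have dl : differentiable l 0 by exact: differentiable_affine.
  have dl1 : derive1 l 0 = w by exact: derive1_affine.
  have al m q (f : 'rV[R]_n -> 'M[R]_(m, q)) : differentiable f (y t) ->
      differentiable (f \o l) 0 /\ derive1 (f \o l) 0 = 'D_w f (y t).
    move=> df; have df' : differentiable f (l 0) by rewrite l0.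
    have [h1 h2] := derive1_along dl df'; rewrite dl1 l0 in h2.
    by split; [exact: h1|exact: h2].
  have [dG' G'E] := al _ _ G (Gd _ Uy).
  have [dT' T'E] := al _ _ T (Td _ Uy).
  have [dV' V'E] := al _ _ ('D_v T) (Tk1 v).
  have [dH' H'E] : differentiable (H \o (T \o l)) 0 /\
      derive1 (H \o (T \o l)) 0 = 'D_w' H (z t).
    have dHT : differentiable H ((T \o l) 0) by rewrite /= l0; apply: Hd; exact: UV.
    have [h1 h2] := derive1_along dT' dHT.
    split; [exact: h1|rewrite h2 T'E wE /= l0; exact: erefl].
  have cv := @differentiable_cst _ _ _ v (0 : R).
  have [_ e1] := is_derive_bilin dG' cv cv.
  have [_ e2] := is_derive_bilin dH' dV' dV'.
  have c0 : derive1 (cst v : R -> 'rV[R]_n) 0 = 0 by rewrite derive1_cst.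
  rewrite c0 bilin0r bilin0l !addr0 G'E in e1.
  rewrite -e1 zt; rewrite H'E V'E /= l0 in e2.
  rewrite (bilinC _ ('D_v T (y t))) in e2; last exact: Hs.
  rewrite -addrA -mulr2n -mulr_natl in e2; rewrite -e2.
  apply: near_eq_derive.
  have : \forall r \near (0 : R), U (l r).
    have lc : {for 0, continuous l} by exact: differentiable_continuous.
    have nb : nbhs (l 0) U.
      by rewrite l0; apply: open_nbhs_nbhs; split; [exact: Uo|exact: Uy].
    exact: lc _ nb.
  by apply: filterS => r Ur /=; rewrite (iso _ _ _ Ur).
have S : 'D_w ('D_v T) (y t) = derive1 ('D_w T \o y) t.
  by rewrite TwE; exact: schwarz T2.
move: P; rewrite gy -/v GyE HzE addrC subrK Q S -/z.
set A := bilin _ _ _; set B := bilin (H _) _ w'; set C := bilin _ _ w'.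
set D := bilin _ _ _ => P.
have -> : B = 2^-1 * (A + 2 * D) - C - D by rewrite P; ring.
by field.
Qed.

End GeodesicEquation.

(** * Uniqueness for the geodesic equation *)

Section GeodesicUniqueness.
Context {R : realType} {n : nat}.
Implicit Types (y z c : R -> 'rV[R]_n) (t : R) (u v w p : 'rV[R]_n).

Lemma near_all (P : 'I_n -> R -> Prop) :
  (forall i (d d' : R), 0 < d' -> d' <= d -> P i d -> P i d') ->
  (forall i, exists2 d : R, 0 < d & P i d) ->
  exists2 d : R, 0 < d & forall i, P i d.
Proof.
move=> Pmon Pex; have ex i : exists d : R, 0 < d /\ P i d by have [d d0 Pd] := Pex i; exists d.
have [d_ d_P] := @choice _ _ (fun i d => 0 < d /\ P i d) ex.
exists (\big[Num.min/1]_i d_ i).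
  by elim/big_ind: _ => // [a b a0 b0|i _]; [rewrite lt_min a0|have [] := d_P i].
move=> i; apply: (Pmon i (d_ i)).
- by elim/big_ind: _ => // [a b a0 b0|j _]; [rewrite lt_min a0|have [] := d_P j].
- exact: bigmin_le.
- by have [] := d_P i.
Qed.

Lemma Ck1_lipschitz m q (U : set 'rV[R]_n) (f : 'rV[R]_n -> 'M[R]_(m, q)) x :
  open U -> U x -> Ck 1 U f -> exists2 C : R, 0 < C & exists2 d : R, 0 < d &
    forall p p', `|p - x| < d -> `|p' - x| < d ->
      U p /\ `|f p - f p'| <= C * `|p - p'| /\ `|f p| <= C.
Proof.
move=> Uo Ux f1; have dfx : differentiable f x by case: f1 => + _; exact.
have [C C0 CP] := linear_lipschitz (diff_continuous dfx).
have [d d0 dP] := Ck1_strict Uo Ux f1 ltr01.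
pose K := C + 1 + `|f x|; have C1 : 0 < C + 1 by rewrite addr_gt0.
have K0 : 0 < K by rewrite ltr_pwDl.
have lip p p' : `|p - x| < d -> `|p' - x| < d -> `|f p - f p'| <= (C + 1) * `|p - p'|.
  move=> pd p'd; have [_ _ h] := dP _ _ pd p'd.
  rewrite -(subrK ('d f x (p - p')) (f p - f p')).
  apply: (le_trans (ler_normD _ _)); rewrite addrC mulrDl.
  by apply: lerD; [exact: CP|exact: h].
exists K => //; exists (Num.min d 1); first by rewrite lt_min d0 ltr01.
move=> p p'; rewrite !lt_min => /andP[pd p1] /andP[p'd p'1].
have xd : `|x - x| < d by rewrite subrr normr0.
have [Up _ _] := dP _ _ pd p'd; split => //; split.
  by apply: (le_trans (lip _ _ pd p'd)); rewrite ler_wpM2r// lerDl.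
rewrite -(subrK (f x) (f p)); apply: (le_trans (ler_normD _ _)); rewrite lerD2r.
apply: (le_trans (lip _ _ pd xd)); rewrite ger_pMr//; exact: ltW.
Qed.

Lemma gronwall (N : R -> R) (C t d : R) : 0 < d -> N t = 0 ->
  (forall s, `|s - t| < d -> 0 <= N s) ->
  (forall s, `|s - t| < d -> derivable N s 1 /\ `|derive1 N s| <= C * N s) ->
  forall s, `|s - t| < d -> N s = 0.
Proof.
move=> d0 Nt N0 dN s sd; apply/eqP; rewrite eq_le N0// andbT.
have dE (a r : R) : `|r - t| < d ->
    is_derive r 1 (fun r => expR (a * r) * N r)
      (expR (a * r) * (derive1 N r + a * N r)).
  move=> rd; have [dNr _] := dN r rd.
  have h1 : is_derive r 1 N (derive1 N r).
    by apply: DeriveDef => //; rewrite derive1E.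
  have h0 : is_derive r 1 (fun r : R => a * r) a.
    apply: is_derive_eq (@is_deriveM R R (cst a) id r 1 _ _
      (is_derive_cst _ _ _) (is_derive_id _ _)) _.
    by rewrite /GRing.scale /=; ring.
  have h2 := @is_derive1_comp R expR (fun r : R => a * r) r _ _ (is_derive_expR _) h0.
  have h := @is_deriveM R R (expR \o (fun r : R => a * r)) N r 1 _ _ h2 h1.
  apply: is_derive_eq h _; rewrite /GRing.scale /=; ring.
have pos (a r : R) : 0 < expR (a * r) by exact: expR_gt0.
have conv (r q u : R) : `|r - t| < d -> `|q - t| < d -> r <= u -> u <= q -> `|u - t| < d.
  rewrite !ltr_norml => /andP[r1 r2] /andP[q1 q2] ru uq; apply/andP; split; lra.
have td : `|t - t| < d by rewrite subrr normr0.
pose h (a r : R) := expR (a * r) * N r.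
have mvt (a u v : R) : `|u - t| < d -> `|v - t| < d -> u < v ->
    exists2 r, `|r - t| < d &
      h a v - h a u = expR (a * r) * (derive1 N r + a * N r) * (v - u).
  move=> ud vd uv.
  have inI r : r \in `]u, v[ -> `|r - t| < d.
    by rewrite in_itv/= => /andP[ur rv]; apply: (conv u v); rewrite // ltW.
  have cI r : r \in `[u, v] -> `|r - t| < d.
    by rewrite in_itv/= => /andP[ur rv]; exact: (conv u v).
  have [||r /inI] := @MVT _ (h a) (fun r => expR (a * r) * (derive1 N r + a * N r)) u v uv.
  - by move=> r /inI; exact: dE.
  - by apply: derivable_within_continuous => r /cI/(dE a)[].
  by exists r.
have [ts|st|ts] := ltgtP t s; last by rewrite -ts Nt.
- (* e^(-C r) N r is nonincreasing *)
  have [r rd hE] := mvt (- C) t s td sd ts; have [_ dle] := dN r rd.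
  have : h (- C) s - h (- C) t <= 0.
    rewrite hE mulr_le0_ge0 ?subr_ge0 ?(ltW ts)// mulr_ge0_le0 ?(ltW (pos _ _))//.
    by rewrite mulNr subr_le0 (le_trans (ler_norm _)).
  by rewrite /h Nt mulr0 subr0 pmulr_rle0.
(* To the left of t it is e^(C r) N r that is monotone, nondecreasing up to its value 0 at t. *)
have [r rd hE] := mvt C s t sd td st; have [_ dle] := dN r rd.
have : 0 <= h C t - h C s.
  rewrite hE mulr_ge0 ?subr_ge0 ?(ltW st)// mulr_ge0 ?(ltW (pos _ _))//.
  by rewrite -lerBlDr sub0r; move: dle; rewrite ler_norml => /andP[].
by rewrite /h Nt mulr0 sub0r oppr_ge0 pmulr_rle0.
Qed.

(** Gronwall for the sum of squares of the coordinates of e and e', used instead of the sup norm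
    because it is differentiable; its root dominates |e| and |e'|. *)
Lemma second_order_unique (e : R -> 'rV[R]_n) (K t d : R) : 0 < d -> 0 <= K ->
  e t = 0 -> derive1 e t = 0 ->
  (forall s, `|s - t| < d -> [/\ differentiable e s, differentiable (derive1 e) s &
     `|derive1 (derive1 e) s| <= K * (`|e s| + `|derive1 e s|)]) ->
  forall s, `|s - t| < d -> e s = 0.
Proof.
move=> d0 K0 et e't eP.
pose N (s : R) := \sum_i (e s 0 i * e s 0 i + derive1 e s 0 i * derive1 e s 0 i).
have Nge s : 0 <= N s.
  by apply: sumr_ge0 => i _; rewrite addr_ge0// -expr2 sqr_ge0.
have term i s : e s 0 i * e s 0 i + derive1 e s 0 i * derive1 e s 0 i <= N s.
  rewrite /N (bigD1 i)//= lerDl; apply: sumr_ge0 => j _.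
  by rewrite addr_ge0// -expr2 sqr_ge0.
have eN s : `|e s| <= Num.sqrt (N s).
  apply: mx_norm_le => [|i j]; first exact: sqrtr_ge0.
  rewrite (ord1 i) -sqrtr_sqr ler_wsqrtr// (le_trans _ (term j s))// expr2 lerDl.
  by rewrite -expr2 sqr_ge0.
have e'N s : `|derive1 e s| <= Num.sqrt (N s).
  apply: mx_norm_le => [|i j]; first exact: sqrtr_ge0.
  rewrite (ord1 i) -sqrtr_sqr ler_wsqrtr// (le_trans _ (term j s))// expr2 lerDr.
  by rewrite -expr2 sqr_ge0.
have dN s : `|s - t| < d -> is_derive s 1 N
    (\sum_i (2 * e s 0 i * derive1 e s 0 i +
             2 * derive1 e s 0 i * derive1 (derive1 e) s 0 i)).
  move=> /eP[de de' _].
  have -> : N = \sum_i (fun s => e s 0 i * e s 0 i + derive1 e s 0 i * derive1 e s 0 i).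
    by apply/funext => r; rewrite fct_sumE.
  apply: is_derive_sum => i.
  have h1 := is_derive_coord 0 i de; have h2 := is_derive_coord 0 i de'.
  have p1 := @is_deriveM R R (fun s => e s 0 i) (fun s => e s 0 i) s 1 _ _ h1 h1.
  have p2 := @is_deriveM R R (fun s => derive1 e s 0 i) (fun s => derive1 e s 0 i) s 1 _ _ h2 h2.
  have p := @is_deriveD R R R (fun s => e s 0 i * e s 0 i)
    (fun s => derive1 e s 0 i * derive1 e s 0 i) s 1 _ _ p1 p2.
  apply: is_derive_eq p _; rewrite /GRing.scale /=.
  move: (e s 0 i) (derive1 e s 0 i) (derive1 (derive1 e) s 0 i) => a b c; ring.
(* Each coordinate contributes at most 2 N + 2 sqrt N (K (2 sqrt N)). *)
pose C := n%:R * (2 + 4 * K).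
have key s : `|s - t| < d -> N s = 0.
  apply: (@gronwall N C t d d0) => // [|r rd].
    rewrite /N big1// => i _.
    by rewrite et e't !mxE mulr0 addr0.
  have [dNr E] := dN r rd; split; first exact: dNr.
  rewrite derive1E E; apply: (le_trans (ler_norm_sum _ _ _)).
  apply: (@le_trans _ _ (\sum_(i < n) (2 + 4 * K) * N r)); last first.
    by rewrite sumr_const card_ord -[leLHS]mulr_natl /C mulrA.
  apply: ler_sum => i _; have [_ _ le2] := eP r rd.
  set q := Num.sqrt (N r).
  have q0 : 0 <= q by exact: sqrtr_ge0.
  have qq : q * q = N r by rewrite -expr2 sqr_sqrtr.
  have a1 : `|e r 0 i| <= q by exact: le_trans (coord_le_norm _ _ _) (eN r).
  have a2 : `|derive1 e r 0 i| <= q by exact: le_trans (coord_le_norm _ _ _) (e'N r).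
  have a3 : `|derive1 (derive1 e) r 0 i| <= K * (q + q).
    apply: (le_trans (coord_le_norm _ _ _)); apply: (le_trans le2).
    by rewrite ler_wpM2l// lerD// ?eN ?e'N.
  apply: (le_trans (ler_normD _ _)); rewrite !normrM (@ger0_norm _ 2)//.
  rewrite (_ : (2 + 4 * K) * N r = 2 * (q * q) + 2 * (q * (K * (q + q)))); last first.
    by rewrite -qq; ring.
  by rewrite -!mulrA; apply: lerD; rewrite ler_pM2l// ler_pM.
move=> s sd; apply/eqP; rewrite -normr_le0 (le_trans (eN s))//.
by rewrite key// sqrtr0.
Qed.

(** Telescoping of the difference of two geodesic equations tested on b, with p = y', q = z', r =
    z''. Every group on the right vanishes when positions and velocities coincide. *)
Lemma bilin_split (b p q r : 'rV[R]_n) (Gz Gy Daz Day Dzz Dzy Dyy : 'M[R]_n) :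
  bilin Gz r b = 2^-1 * bilin Daz q q - bilin Dzz q b ->
  bilin Gy r b - (2^-1 * bilin Day p p - bilin Dyy p b) =
  2^-1 * ((bilin Daz q q - bilin Day q q) +
          (bilin Day (q - p) q + bilin Day p (q - p))) -
  ((bilin Dzz q b - bilin Dzy q b) +
   (bilin Dzy (q - p) b + bilin (Dzy - Dyy) p b)) - bilin (Gz - Gy) r b.
Proof.
move=> E; rewrite !bilinBmx !bilinDl !bilinNl !bilinDr !bilinNr E; ring.
Qed.

(** Testing both equations on the second derivative a of z - y bounds G(y)(a, a) by a constant times
    (|z - y| + |z' - y'|) |a|. Positivity of G removes one factor |a|, which gives the hypothesis of
    [second_order_unique] without solving for the second derivatives. *)
Lemma geo_eq_unique (G : 'rV[R]_n -> 'M[R]_n) (U : set 'rV[R]_n) y z t (r : R) :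
  open U -> Ck 2 U G -> U (y t) -> 0 < r ->
  (forall w, w != 0 -> 0 < bilin (G (y t)) w w) ->
  (forall s, `|s - t| < r -> [/\ differentiable y s, differentiable (derive1 y) s,
     geo_eq G y s, {for s, continuous (derive1 y)} & U (y s) ]) ->
  (forall s, `|s - t| < r -> [/\ differentiable z s, differentiable (derive1 z) s,
     geo_eq G z s, {for s, continuous (derive1 z)} & U (z s) ]) ->
  {for t, continuous (derive1 (derive1 z))} ->
  y t = z t -> derive1 y t = derive1 z t ->
  \forall s \near t, y s = z s.
Proof.
move=> Uo G2 Uy r0 Gpos yP zP z''c yz y'z'; set x := y t in Uy Gpos yz.
have [Gd Gk] := G2.
have [C0 C00 [d0 d00 d0P]] := Ck1_lipschitz Uo Uy (CkW G2).
(* one radius d, whose inverse serves as a common Lipschitz constant *)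
pose P (i : 'I_n) (d : R) := forall p p', `|p - x| < d -> `|p' - x| < d ->
  U p /\ `|'D_(delta_mx 0 i) G p - 'D_(delta_mx 0 i) G p'| <= d^-1 * `|p - p'| /\
  `|'D_(delta_mx 0 i) G p| <= d^-1.
have [d1 d10 d1P] : exists2 d : R, 0 < d & forall i, P i d.
  apply: near_all => [i d d' d'0 d'd Pd p p' pd p'd|i].
    have [Up [h1 h2]] := Pd p p' (lt_le_trans pd d'd) (lt_le_trans p'd d'd).
    have dd : d^-1 <= d'^-1 by rewrite lef_pV2// posrE (lt_le_trans d'0).
    split; [exact: Up|split]; last exact: le_trans dd.
    by apply: (le_trans h1); rewrite ler_wpM2r.
  have [C C1 [d d_0 dP]] := Ck1_lipschitz Uo Uy (Gk (delta_mx 0 i)).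
  have m0 : 0 < Num.min d C^-1 by rewrite lt_min d_0 invr_gt0.
  have Cm : C <= (Num.min d C^-1)^-1.
    by rewrite -[leLHS]invrK lef_pV2 ?posrE ?invr_gt0// ge_min lexx orbT.
  exists (Num.min d C^-1) => // p p'; rewrite !lt_min => /andP[pd _] /andP[p'd _].
  have [Up [h1 h2]] := dP p p' pd p'd; split; [exact: Up|split].
    by apply: (le_trans h1); rewrite ler_wpM2r.
  exact: le_trans Cm.
pose L := d1^-1; have L0 : 0 < L by rewrite invr_gt0.
pose N : R := (n * n)%:R * (n%:R * L).
have N0 : 0 <= N by rewrite mulr_ge0// mulr_ge0// ltW.
have DG p w : U p -> 'D_w G p = \sum_i w 0 i *: 'D_(delta_mx 0 i) G p.
  by move=> Up; apply: derive_basis; exact: Gd.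
have sumb (w : 'rV[R]_n) (A : 'I_n -> 'M[R]_n) (q : R) : (forall i, `|A i| <= q) ->
    `|\sum_i w 0 i *: A i| <= n%:R * q * `|w|.
  move=> Aq; apply: (le_trans (ler_norm_sum _ _ _)).
  apply: (@le_trans _ _ (\sum_(i < n) q * `|w|)).
    apply: ler_sum => i _; rewrite normrZ mulrC.
    by apply: ler_pM => //; exact: coord_le_norm.
  by rewrite sumr_const card_ord -[leLHS]mulr_natl mulrA.
have Qb p u v w : `|p - x| < d1 -> `|bilin ('D_w G p) u v| <= N * `|u| * `|v| * `|w|.
  (* [d1P] gives information only through an index, so n = 0 is treated apart; the bilinear form is
     then an empty sum. *)
  move=> pd; have [i0|n0] := posnP n.
    rewrite /bilin mxE big_pred0; last by move=> j; case: j; rewrite i0.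
    by rewrite normr0; do ![apply: mulr_ge0 => //].
  have Up : U p by have [] := d1P (Ordinal n0) p p pd pd.
  apply: (le_trans (bilin_norm _ _ _)).
  have h : `|'D_w G p| <= n%:R * L * `|w|.
    by rewrite DG//; apply: sumb => i; have [_ []] := d1P i p p pd pd.
  rewrite /N; have := ler_wpM2l (_ : 0 <= (n * n)%:R * `|u| * `|v|) h.
  move=> /(_ (mulr_ge0 (mulr_ge0 (ler0n _ _) (normr_ge0 _)) (normr_ge0 _))).
  by congr (_ <= _); ring.
have Ql p p' u v w : `|p - x| < d1 -> `|p' - x| < d1 ->
    `|bilin ('D_w G p) u v - bilin ('D_w G p') u v| <= N * `|p - p'| * `|u| * `|v| * `|w|.
  move=> pd p'd; have [i0|n0] := posnP n.
    rewrite -bilinBmx /bilin mxE big_pred0; last by move=> j; case: j; rewrite i0.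
    by rewrite normr0; do ![apply: mulr_ge0 => //].
  have Up : U p by have [] := d1P (Ordinal n0) p p pd pd.
  have Up' : U p' by have [] := d1P (Ordinal n0) p' p' p'd p'd.
  rewrite -bilinBmx; apply: (le_trans (bilin_norm _ _ _)).
  have h : `|'D_w G p - 'D_w G p'| <= n%:R * (L * `|p - p'|) * `|w|.
    rewrite !DG// -sumrB; under eq_bigr do rewrite -scalerBr.
    by apply: sumb => i; have [_ []] := d1P i p p' pd p'd.
  rewrite /N; have := ler_wpM2l (_ : 0 <= (n * n)%:R * `|u| * `|v|) h.
  move=> /(_ (mulr_ge0 (mulr_ge0 (ler0n _ _) (normr_ge0 _)) (normr_ge0 _))).
  by congr (_ <= _); ring.
have [l l0 lP] := bilin_lower_bound Gpos.
have Gc : {for x, continuous G} by apply: differentiable_continuous; exact: Gd.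
have half : 0 < 2^-1 :> R by rewrite invr_gt0.
have := near_bilin Gc Gpos half.
move=> /nbhs_ballP[d2 /= d20 d2P].
pose d := Num.min d0 (Num.min d1 d2); have dpos : 0 < d by rewrite !lt_min d00 d10.
have [dd0 dd1 dd2] : [/\ d <= d0, d <= d1 & d <= d2].
  by split; rewrite !ge_min lexx ?orbT.
have tr : `|t - t| < r by rewrite subrr normr0.
have [dyt d'yt _ y'c _] := yP t tr; have [dzt d'zt _ z'c _] := zP t tr.
have near_pos (c : R -> 'rV[R]_n) : {for t, continuous c} -> c t = x ->
    exists2 q : R, 0 < q & forall s, `|s - t| < q -> `|c s - x| < d.
  move=> cc ct; have /cvgrPdist_lt /(_ _ dpos) := cc.
  move=> /nbhs_ballP[q /= q0 qP]; exists q => // s sq.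
  by rewrite -ct distrC; apply: qP; rewrite /ball /= distrC.
have near_bd (c : R -> 'rV[R]_n) : {for t, continuous c} ->
    exists2 q : R, 0 < q & forall s, `|s - t| < q -> `|c s| <= `|c t| + 1.
  move=> cc; have /cvgrPdist_lt /(_ _ ltr01) := cc.
  move=> /nbhs_ballP[q /= q0 qP]; exists q => // s sq.
  have /ltW h : `|c t - c s| < 1 by apply: qP; rewrite /ball /= distrC.
  rewrite -[c s](subrK (c t)) addrC (le_trans (ler_normD _ _))// lerD2l.
  by rewrite distrC.
have [q1 q10 q1P] := near_pos _ (differentiable_continuous dyt) erefl.
have [q2 q20 q2P] := near_pos _ (differentiable_continuous dzt) (esym yz).
have [q3 q30 q3P] := near_bd _ y'c; have [q4 q40 q4P] := near_bd _ z'c.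
have [q5 q50 q5P] := near_bd _ z''c.
pose B := `|derive1 y t| + 1 + (`|derive1 z t| + 1) + (`|derive1 (derive1 z) t| + 1).
have p1 (u : 'rV[R]_n) : 0 < `|u| + 1 by rewrite ltr_wpDl.
have B0 : 0 < B := addr_gt0 (addr_gt0 (p1 _) (p1 _)) (p1 _).
pose q := Num.min r (Num.min q1 (Num.min q2 (Num.min q3 (Num.min q4 q5)))).
have q0 : 0 < q by rewrite !lt_min r0 q10 q20 q30 q40.
have dBr (c1 c2 : R -> 'rV[R]_n) s : differentiable c1 s -> differentiable c2 s ->
    differentiable (fun s => c1 s - c2 s) s /\
    derive1 (fun s => c1 s - c2 s) s = derive1 c1 s - derive1 c2 s.
  move=> h1 h2; split; first exact: differentiableB.
  rewrite !derive1E (_ : (fun s => c1 s - c2 s) = c1 - c2)//.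
  exact: (@deriveB _ _ _ c1 c2 s 1 (@diff_derivable _ _ _ c1 s 1 h1) (@diff_derivable _ _ _ c2 s 1 h2)).
pose e (s : R) := z s - y s.
have e1 s : `|s - t| < r -> differentiable e s /\ derive1 e s = derive1 z s - derive1 y s.
  by move=> sr; apply: dBr; [have [] := zP s sr|have [] := yP s sr].
have ne s : `|s - t| < r -> {near s, (fun s => derive1 z s - derive1 y s) =1 derive1 e}.
  move=> sr; have : \forall u \near s, `|u - t| < r.
    have cn : {for s, continuous (fun u : R => `|u - t|)}.
      by apply: cvg_norm; apply: cvgB; [exact: cvg_id|exact: cvg_cst].
    have nb : nbhs `|s - t| [set u | u < r] by exact: lt_nbhsl.
    exact: cn _ nb.
  by apply: filterS => u /e1[_ ->].
have e2 s : `|s - t| < r -> differentiable (derive1 e) s /\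
    derive1 (derive1 e) s = derive1 (derive1 z) s - derive1 (derive1 y) s.
  move=> sr; have [_ h1 _ _ _] := zP s sr; have [_ h2 _ _ _] := yP s sr.
  have [h3 h4] := dBr _ _ _ h1 h2; split.
    by apply: near_eq_differentiable h3; exact: ne.
  rewrite -h4 !derive1E; apply: near_eq_derive.
  by apply: filterS (ne s sr) => u ->.
clearbody N.
pose K1 := 2 * (N * B * B + 2 * N * B) + (n * n)%:R * C0 * B.
have K10 : 0 <= K1.
  have h1 : 0 <= N * B * B := mulr_ge0 (mulr_ge0 N0 (ltW B0)) (ltW B0).
  have h2 : 0 <= 2 * N * B := mulr_ge0 (mulr_ge0 (ler0n _ 2) N0) (ltW B0).
  have h3 : 0 <= (n * n)%:R * C0 * B := mulr_ge0 (mulr_ge0 (ler0n _ _) (ltW C00)) (ltW B0).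
  exact: addr_ge0 (mulr_ge0 (ler0n _ 2) (addr_ge0 h1 h2)) h3.
(* From l |a|^2 <= G(x)(a, a) <= 2 G(y)(a, a), the 2 being due to the relative error 1/2 in
   [near_bilin]. *)
pose K := 2 * K1 / l; have K0 : 0 <= K by rewrite divr_ge0 ?mulr_ge0// ltW.
have et : e t = 0 by rewrite /e -yz subrr.
have e't : derive1 e t = 0 by rewrite (e1 t tr).2 y'z' subrr.
have fin s : `|s - t| < q -> e s = 0.
  apply: (@second_order_unique e K t q q0 K0 et e't) => {}s.
  rewrite !lt_min => /andP[sr /andP[s1 /andP[s2 /andP[s3 /andP[s4 s5]]]]].
  have [de e'E] := e1 s sr; have [de' e''E] := e2 s sr; split => //.
  have [_ _ gy _ Uys] := yP s sr; have [_ _ gz _ Uzs] := zP s sr.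
  have yd := q1P s s1; have zd := q2P s s2.
  have y'B : `|derive1 y s| <= B.
    by apply: (le_trans (q3P s s3)); rewrite /B -addrA lerDl addr_ge0// addr_ge0.
  have z'B : `|derive1 z s| <= B.
    by apply: (le_trans (q4P s s4)); rewrite /B addrAC lerDr addr_ge0// addr_ge0.
  have z''B : `|derive1 (derive1 z) s| <= B.
    by apply: (le_trans (q5P s s5)); rewrite /B lerDr addr_ge0// addr_ge0.
  have yd1 := lt_le_trans yd dd1; have zd1 := lt_le_trans zd dd1.
  have [_ [Glip _]] := d0P _ _ (lt_le_trans zd dd0) (lt_le_trans yd dd0).
  have Gy2 := d2P (y s); rewrite -[ball _ _ _]/(ball x d2 (y s)) in Gy2.
  have {}Gy2 : forall u, `|bilin (G (y s)) u u - bilin (G x) u u| <= 2^-1 * bilin (G x) u u.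
    by apply: Gy2; rewrite mx_norm_ball /ball_ /= distrC; exact: lt_le_trans dd2.
  rewrite e''E; move: e'E Glip gy gz y'B z'B z''B Gy2 yd1 zd1 Uys Uzs {yd zd}.
  rewrite /geo_eq; set a := derive1 (derive1 z) s - _; set y' := derive1 y s.
  set z' := derive1 z s; set y'' := derive1 (derive1 y) s.
  set z'' := derive1 (derive1 z) s; rewrite -/a.
  move=> -> Glip gy gz y'B z'B z''B Gy2 yd1 zd1 Uys Uzs.
  have aE : a = z'' - y'' by [].
  clearbody a y'' z'' y' z'.
  pose S := `|e s| + `|z' - y'|; have S0 : 0 <= S by rewrite addr_ge0.
  have eS : `|z s - y s| <= S by rewrite /S lerDl.
  have e'S : `|z' - y'| <= S by rewrite /S lerDr.
  have aa : bilin (G (y s)) a a <= K1 * S * `|a|.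
    pose Q p u v w := bilin ('D_w G p) u v.
    have Dadd w1 w2 : 'D_(w1 - w2) G (y s) = 'D_w1 G (y s) - 'D_w2 G (y s).
      have dG := Gd _ Uys.
      by rewrite (deriveE (w1 - w2) dG) (deriveE w1 dG) (deriveE w2 dG); exact: linearB.
    have E : bilin (G (y s)) a a =
        2^-1 * ((Q (z s) z' z' a - Q (y s) z' z' a) +
                (Q (y s) (z' - y') z' a + Q (y s) y' (z' - y') a)) -
        ((Q (z s) z' a z' - Q (y s) z' a z') +
         (Q (y s) (z' - y') a z' + Q (y s) y' a (z' - y'))) -
        bilin (G (z s) - G (y s)) z'' a.
      have -> : bilin (G (y s)) a a = bilin (G (y s)) z'' a - bilin (G (y s)) y'' a.
        by rewrite {1}aE bilinDl bilinNl.
      rewrite (gy a) /Q (Dadd z' y').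
      exact: (@bilin_split a y' z' z'' (G (z s)) (G (y s)) ('D_a G (z s)) ('D_a G (y s))
        ('D_z' G (z s)) ('D_z' G (y s)) ('D_y' G (y s)) (gz a)).
    have m3 (b1 b2 b3 c1 c2 c3 : R) : 0 <= b1 -> 0 <= b2 -> 0 <= b3 ->
        b1 <= c1 -> b2 <= c2 -> b3 <= c3 -> b1 * b2 * b3 <= c1 * c2 * c3.
      move=> *; apply: ler_pM => //; first exact: mulr_ge0.
      exact: ler_pM.
    have Q1 (u v w : 'rV[R]_n) (k1 k2 k3 : R) : `|u| <= k1 -> `|v| <= k2 -> `|w| <= k3 ->
        `|Q (y s) u v w| <= N * (k1 * k2 * k3).
      move=> h1 h2 h3; apply: (le_trans (Qb _ u v w yd1)).
      rewrite -!mulrA; apply: (ler_wpM2l N0); rewrite !mulrA.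
      exact: (m3 _ _ _ _ _ _ (normr_ge0 _) (normr_ge0 _) (normr_ge0 _) h1 h2 h3).
    have Q2 (u v w : 'rV[R]_n) (k1 k2 k3 : R) : `|u| <= k1 -> `|v| <= k2 -> `|w| <= k3 ->
        `|Q (z s) u v w - Q (y s) u v w| <= N * S * (k1 * k2 * k3).
      move=> h1 h2 h3; apply: (le_trans (Ql _ _ u v w zd1 yd1)).
      rewrite -!mulrA; apply: (ler_wpM2l N0).
      apply: (ler_pM (normr_ge0 _) _ eS); first by rewrite !mulr_ge0.
      rewrite !mulrA.
      exact: (m3 _ _ _ _ _ _ (normr_ge0 _) (normr_ge0 _) (normr_ge0 _) h1 h2 h3).
    have t1 := Q2 z' z' a _ _ _ z'B z'B (lexx _).
    have t2 := Q1 (z' - y') z' a _ _ _ e'S z'B (lexx _).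
    have t3 := Q1 y' (z' - y') a _ _ _ y'B e'S (lexx _).
    have t4 := Q2 z' a z' _ _ _ z'B (lexx _) z'B.
    have t5 := Q1 (z' - y') a z' _ _ _ e'S (lexx _) z'B.
    have t6 := Q1 y' a (z' - y') _ _ _ y'B (lexx _) e'S.
    have t7 : `|bilin (G (z s) - G (y s)) z'' a| <= (n * n)%:R * (C0 * S * B * `|a|).
      apply: (le_trans (bilin_norm _ _ _)); rewrite -!mulrA ler_wpM2l//.
      rewrite !mulrA ler_wpM2r//; apply: ler_pM => //; apply: (le_trans Glip).
      by rewrite ler_pM2l.
    rewrite {}E; move: t1 t2 t3 t4 t5 t6 t7; rewrite /K1.
    move: (Q (z s) z' z' a - _) (Q (y s) (z' - y') z' a) (Q (y s) y' (z' - y') a)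
      (Q (z s) z' a z' - _) (Q (y s) (z' - y') a z') (Q (y s) y' a (z' - y'))
      (bilin _ z'' a) => T1 T2 T3 T4 T5 T6 T7.
    rewrite !ler_norml => /andP[_ t1] /andP[_ t2] /andP[_ t3] /andP[t4 _] /andP[t5 _]
      /andP[t6 _] /andP[t7 _].
    have b1 : 0 <= N * S * (B * B * `|a|) by rewrite !mulr_ge0// ltW.
    have b2 : 0 <= N * (S * B * `|a|) by rewrite !mulr_ge0// ltW.
    have -> : (2 * (N * B * B + 2 * N * B) + (n * n)%:R * C0 * B) * S * `|a| =
      2 * (N * S * (B * B * `|a|)) + 4 * (N * (S * B * `|a|)) +
      (n * n)%:R * (C0 * S * B * `|a|) by ring.
    have m1' : N * (B * S * `|a|) = N * (S * B * `|a|) by ring.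
    have m2' : N * S * (B * `|a| * B) = N * S * (B * B * `|a|) by ring.
    have m3' : N * (S * `|a| * B) = N * (S * B * `|a|) by ring.
    have m4' : N * (B * `|a| * S) = N * (S * B * `|a|) by ring.
    rewrite m1' in t3; rewrite m2' in t4; rewrite m3' in t5; rewrite m4' in t6.
    move: (N * S * (B * B * `|a|)) (N * (S * B * `|a|)) ((n * n)%:R * _)
      t1 t2 t3 t4 t5 t6 t7 b1 b2 => X1 X2 X3; clear; lra.
  have la : l * `|a| ^+ 2 <= 2 * (K1 * S * `|a|).
    apply: (le_trans (lP a)); have := Gy2 a; rewrite ler_norml => /andP[h _].
    move: h aa; move: (bilin (G (y s)) a a) (bilin (G x) a a) (K1 * S * `|a|) => X1 X2 X3.
    clear; lra.
  rewrite -/S /K; have [->|a0] := eqVneq a 0; first by rewrite normr0 !mulr_ge0// invr_ge0 ltW.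
  have ap : 0 < `|a| by rewrite normr_gt0.
  rewrite mulrAC ler_pdivlMr// mulrC -(ler_pM2r ap) -!mulrA.
  by move: la; rewrite expr2 -!mulrA.
apply/nbhs_ballP; exists q => // s sq.
apply/eqP; rewrite eq_sym -subr_eq0; apply/eqP; apply: fin.
by move: sq; rewrite /ball /= distrC.
Qed.

End GeodesicUniqueness.

(** * Geodesics and isometries *)

Section Geodesics.
Context {R : realType} {n : nat} {M : riemannianType R n}.
Implicit Types (phi psi : chart R n M) (c : R -> M) (x : M).

Lemma gram_unit phi y : atlas phi -> chart_img phi y -> gram phi y \in unitmx.
Proof.
move=> aphi iy; rewrite -row_free_unit -kermx_eq0; apply/eqP/row_matrixP => i.
rewrite row0; apply/eqP; apply: contraT => r0.
have := gram_pos phi y (row i (kermx (gram phi y))) aphi iy r0.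
by rewrite /bilin -row_mul mulmx_ker row0 mul0mx mxE ltxx.
Qed.

(** Multiplying by the Gram matrix lowers the index and cancels the inverse in the Christoffel
    symbols; of the three derivative terms the first two agree after exchanging the summation
    indices. *)
Lemma geodesic_geo_eq phi c (U : set R) t : geodesic U c -> atlas phi -> open U ->
  U t -> chart_dom phi (c t) -> geo_eq (gram phi) (phi \o c) t.
Proof.
move=> [cs ce] aphi Uo Ut pt w.
have [dy y'c d'y] := smooth_curve_chart cs aphi Ut pt.
set y := phi \o c in dy y'c d'y *.
have iy : chart_img phi (y t) by exists (c t).
set G := gram phi; set y' := derive1 y t; set y'' := derive1 (derive1 y) t.
pose d i j l := dgram phi (y t) i j l.
have dG : differentiable G (y t).
  exact: (smooth_on_differentiable (gram_smooth phi aphi) iy).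
have DG u : 'D_u G (y t) = \sum_i u 0 i *: 'D_(delta_mx 0 i) G (y t) := derive_basis u dG.
have dE i j l : d i j l = 'D_(delta_mx 0 i) G (y t) j l.
  by rewrite /d /dgram derive_coord//; exact: diff_derivable.
have Gsym : (G (y t))^T = G (y t) by exact: gram_sym.
have coordE : forall k, derive1 (fun s => phi (c s) 0 k) t = y' 0 k.
  by move=> k; rewrite -(derive1_coord 0 k dy).
have coord2E : forall k, derive1 (derive1 (fun s => phi (c s) 0 k)) t = y'' 0 k.
  move=> k; rewrite /y'' -(derive1_coord 0 k d'y) !derive1E.
  have Oo := open_preimage_on Uo (chart_open phi) (fun s sU => smooth_curve_continuous cs sU).
  apply: near_eq_derive.
  have : \forall s \near t, (U `&` c @^-1` chart_dom phi) s by exact: open_nbhs_nbhs.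
  apply: filterS => s [Us ps]; have [dys _ _] := smooth_curve_chart cs aphi Us ps.
  by rewrite -(derive1_coord 0 k dys).
pose S (l : 'I_n) := \sum_(i < n) \sum_(j < n) (d i j l + d j i l - d l i j) * (y' 0 i * y' 0 j).
have eqk k : y'' 0 k = - (2^-1 * \sum_(l < n) invmx (G (y t)) k l * S l).
  have ck := ce phi t aphi Ut pt k; rewrite /= coord2E in ck.
  apply/eqP; rewrite -addr_eq0; apply/eqP; rewrite -[RHS]ck; congr (_ + _).
  rewrite mulr_sumr.
  transitivity (\sum_(i < n) \sum_(j < n) \sum_(l < n) 2^-1 * (invmx (G (y t)) k l *
     ((d i j l + d j i l - d l i j) * (y' 0 i * y' 0 j)))).
    under [RHS]eq_bigr do rewrite exchange_big /=.
    rewrite [RHS]exchange_big /=; apply: eq_bigr => l _.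
    rewrite /S !mulr_sumr; apply: eq_bigr => i _.
    by rewrite !mulr_sumr; apply: eq_bigr => j _.
  apply: eq_bigr => i _; apply: eq_bigr => j _; rewrite !coordE /christoffel.
  have hlp (a b e : R) (F : 'I_n -> R) : a * (\sum_l F l) * b * e = \sum_l a * F l * b * e.
    by rewrite mulr_sumr !mulr_suml.
  apply: etrans (esym (hlp _ _ _ _)); apply: eq_bigr => l _.
  by rewrite /d /y /= /G; ring.
have Sw : bilin (G (y t)) y'' w = - (2^-1 * \sum_l w 0 l * S l).
  rewrite (bilinC _ _ Gsym) /bilin -mulmxA mxE mulr_sumr -sumrN.
  have -> : G (y t) *m y''^T = \col_l (- (2^-1 * S l)).
    have -> : y''^T = invmx (G (y t)) *m (\col_l (- (2^-1 * S l))).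
      apply/matrixP => k j; rewrite !mxE (ord1 j) eqk mulr_sumr -sumrN.
      by apply: eq_bigr => l _; rewrite mxE; ring.
    by rewrite mulmxA mulmxV ?mul1mx//; exact: gram_unit.
  by apply: eq_bigr => l _; rewrite mxE; ring.
have DGE u j l : ('D_u G (y t)) j l = \sum_i u 0 i * d i j l.
  by rewrite DG summxE; apply: eq_bigr => i _; rewrite mxE dE.
have E1 : bilin ('D_y' G (y t)) y' w =
    \sum_l w 0 l * \sum_i \sum_j d i j l * (y' 0 i * y' 0 j).
  rewrite bilinE; apply: eq_bigr => l _.
  rewrite [in RHS]exchange_big /= mulr_sumr; apply: eq_bigr => j _.
  rewrite DGE mulr_sumr mulr_suml [RHS]mulr_sumr; apply: eq_bigr => i _.
  ring.
have E2 : bilin ('D_w G (y t)) y' y' =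
    \sum_l w 0 l * \sum_i \sum_j d l i j * (y' 0 i * y' 0 j).
  transitivity (\sum_a \sum_b \sum_l w 0 l * (d l b a * (y' 0 b * y' 0 a))).
    rewrite bilinE; apply: eq_bigr => a _; apply: eq_bigr => b _.
    by rewrite DGE mulr_sumr mulr_suml; apply: eq_bigr => l _; ring.
  rewrite exchange_big /=.
  under eq_bigr do rewrite exchange_big /=.
  rewrite exchange_big /=; apply: eq_bigr => l _.
  by rewrite mulr_sumr; apply: eq_bigr => i _; rewrite mulr_sumr.
have SE l : S l = 2 * (\sum_i \sum_j d i j l * (y' 0 i * y' 0 j)) -
    \sum_i \sum_j d l i j * (y' 0 i * y' 0 j).
  have e1 : \sum_i \sum_j d j i l * (y' 0 i * y' 0 j) =
      \sum_i \sum_j d i j l * (y' 0 i * y' 0 j).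
    rewrite exchange_big /=; apply: eq_bigr => i _; apply: eq_bigr => j _.
    by rewrite (mulrC (y' 0 j)).
  rewrite mulr_natl mulr2n -{2}e1 /S -!big_split /= -sumrB; apply: eq_bigr => i _.
  rewrite -!big_split /= -sumrB; apply: eq_bigr => j _; ring.
rewrite -/y' -/y'' Sw E1 E2.
have -> : \sum_l w 0 l * S l = 2 * (\sum_l w 0 l * \sum_i \sum_j d i j l * (y' 0 i * y' 0 j)) -
    \sum_l w 0 l * \sum_i \sum_j d l i j * (y' 0 i * y' 0 j).
  rewrite mulr_sumr -sumrB; apply: eq_bigr => l _; rewrite SE; ring.
by field.
Qed.

(** Both sides are the velocity of [f \o c] at 0 in the chosen chart at f (c 0), computed along two
    routes. *)
Lemma isometry_chart_diff f phi psi c : smooth_map f -> atlas phi -> atlas psi ->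
  {for 0, continuous c} -> chart_dom phi (c 0) -> chart_dom psi (f (c 0)) ->
  differentiable (phi \o c) 0 ->
  'd (chart_at (f (c 0)) \o chart_inv psi) (psi (f (c 0)))
    ('d (psi \o f \o chart_inv phi) (phi (c 0)) (derive1 (phi \o c) 0)) =
  tangent_map f (c 0)
    ('d (chart_at (c 0) \o chart_inv phi) (phi (c 0)) (derive1 (phi \o c) 0)).
Proof.
move=> fs aphi apsi cc pc qc dc.
have aa := chart_at_atlas (c 0); have pa := chart_at_dom (c 0).
have ab := chart_at_atlas (f (c 0)); have pb := chart_at_dom (f (c 0)).
have [da a'] := curve_transition aphi aa cc pc pa dc.
have [_ b1] := curve_map fs aa ab cc pa pb da.
have [dp p'] := curve_map fs aphi apsi cc pc qc dc.
have fcc : {for 0, continuous (f \o c)}.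
  by apply: continuous_comp => //; case: fs => + _; exact.
have [_ b2] := curve_transition (c := f \o c) apsi ab fcc qc pb dp.
have h1 := congr1 ('d (chart_at (f (c 0)) \o chart_inv psi) (psi (f (c 0)))) (esym p').
have h2 := congr1 (tangent_map f (c 0)) a'.
exact: etrans h1 (etrans (esym b2) (etrans b1 h2)).
Qed.

(** Every coordinate vector is a velocity, so identities obtained along curves become identities of
    differentials. *)
Lemma chart_line phi x (w : 'rV[R]_n) : chart_dom phi x ->
  exists c : R -> M, [/\ c 0 = x, {for 0, continuous c},
    differentiable (phi \o c) 0 & derive1 (phi \o c) 0 = w].
Proof.
move=> px; pose l (r : R) := phi x + r *: w; exists (fun r => chart_inv phi (l r)).
have dl : differentiable l 0 by exact: differentiable_affine.
have l0 : l 0 = phi x by rewrite /l scale0r addr0.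
have il : chart_img phi (l 0) by rewrite l0; exists x.
have nl : \forall r \near (0 : R), l r = (phi \o (fun r => chart_inv phi (l r))) r.
  have lc : {for 0, continuous l} by exact: differentiable_continuous.
  have nb : nbhs (l 0) (chart_img phi).
    by apply: open_nbhs_nbhs; split; [exact: chart_img_open|exact: il].
  have : \forall r \near (0 : R), chart_img phi (l r) by exact: lc _ nb.
  by apply: filterS => r ir; rewrite /= chart_invK.
split.
- by rewrite l0 chart_funK.
- apply: (@continuous_comp _ _ _ l); first exact: differentiable_continuous.
  exact: chart_inv_continuous.
- exact: near_eq_differentiable nl dl.
rewrite -[RHS](derive1_affine (phi x) w 0) !derive1E; apply: near_eq_derive.
by apply: filterS nl => r h; exact: esym h.
Qed.

(** [riemannian_isometry] speaks of the chosen charts only; [gram_change] at x and at f x carries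
    the identity to arbitrary charts of the atlas. *)
Lemma isometry_gram f phi psi y u v : riemannian_isometry f -> atlas phi ->
  atlas psi -> (phi @` (chart_dom phi `&` f @^-1` chart_dom psi)) y ->
  bilin (gram phi y) u v =
  bilin (gram psi ((psi \o f \o chart_inv phi) y))
    ('D_u (psi \o f \o chart_inv phi) y) ('D_v (psi \o f \o chart_inv phi) y).
Proof.
move=> [_ fs fi] aphi apsi [x [px qx] <-].
have aa := chart_at_atlas x; have pa := chart_at_dom x.
have ab := chart_at_atlas (f x); have pb := chart_at_dom (f x).
have dT := smooth_map_chart_differentiable fs aphi apsi px qx.
have key w : 'd (chart_at (f x) \o chart_inv psi) (psi (f x))
    ('d (psi \o f \o chart_inv phi) (phi x) w) =
    tangent_map f x ('d (chart_at x \o chart_inv phi) (phi x) w).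
  have [c [c0 cc dc c'0]] := chart_line w px.
  have pc : chart_dom phi (c 0) by rewrite c0.
  have qc : chart_dom psi (f (c 0)) by rewrite c0.
  have K := isometry_chart_diff fs aphi apsi cc pc qc dc.
  by rewrite c'0 c0 in K.
have E : (psi \o f \o chart_inv phi) (phi x) = psi (f x) by rewrite /= chart_funK.
have h1 : bilin (gram phi (phi x)) u v = inner x
    ('d (chart_at x \o chart_inv phi) (phi x) u) ('d (chart_at x \o chart_inv phi) (phi x) v).
  exact: (gram_change phi (chart_at x) x aphi aa px pa u v).
have h2 : bilin (gram psi (psi (f x)))
    ('d (psi \o f \o chart_inv phi) (phi x) u) ('d (psi \o f \o chart_inv phi) (phi x) v) =
  inner (f x)
    ('d (chart_at (f x) \o chart_inv psi) (psi (f x)) ('d (psi \o f \o chart_inv phi) (phi x) u))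
    ('d (chart_at (f x) \o chart_inv psi) (psi (f x)) ('d (psi \o f \o chart_inv phi) (phi x) v)).
  exact: (gram_change psi (chart_at (f x)) (f x) apsi ab qx pb
  ('d (psi \o f \o chart_inv phi) (phi x) u) ('d (psi \o f \o chart_inv phi) (phi x) v)).
have h3 := fi x ('d (chart_at x \o chart_inv phi) (phi x) u) ('d (chart_at x \o chart_inv phi) (phi x) v).
have h4 := congr2 (inner (f x)) (key u) (key v).
rewrite E (deriveE u dT) (deriveE v dT).
apply: (etrans h1).
apply: (etrans (esym h3)).
apply: (etrans (esym h4)).
exact: (esym h2).
Qed.

(** A nonzero vector in the kernel of the differential would have length 0; between spaces of equal
    dimension, injectivity yields surjectivity. *)
Lemma isometry_onto f phi psi y w : riemannian_isometry f -> atlas phi ->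
  atlas psi -> (phi @` (chart_dom phi `&` f @^-1` chart_dom psi)) y ->
  exists u, 'D_u (psi \o f \o chart_inv phi) y = w.
Proof.
move=> fi aphi apsi Uy; set T := psi \o f \o chart_inv phi.
have dT : differentiable T y.
  by case: Uy => x [px qx] <-; apply: smooth_map_chart_differentiable => //; case: fi.
have iy : chart_img phi y by case: Uy => x [px _] <-; exists x.
pose A := lin1_mx ('d T y).
have AE u : u *m A = 'D_u T y by rewrite mul_rV_lin1 deriveE.
have Au : A \in unitmx.
  rewrite -row_free_unit -kermx_eq0; apply/eqP/row_matrixP => i.
  rewrite row0; apply/eqP; apply: contraT => r0.
  have := gram_pos phi y _ aphi iy r0.
  rewrite (isometry_gram _ _ fi aphi apsi Uy) -/T -!AE -row_mul mulmx_ker row0.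
  by rewrite bilin0l ltxx.
by exists (w *m invmx A); rewrite -AE mulmxKV.
Qed.

Lemma eq_at_closure (T : topologicalType) (h1 h2 : R -> T) (A : set R) t :
  hausdorff_space T -> {for t, continuous h1} -> {for t, continuous h2} ->
  closure A t -> (forall s, A s -> h1 s = h2 s) -> h1 t = h2 t.
Proof.
move=> hT c1 c2 clA h12; apply: hT => B C nB nC.
have n1 : \forall s \near t, B (h1 s) := c1 _ nB.
have n2 : \forall s \near t, C (h2 s) := c2 _ nC.
have [s [As [Bs Cs]]] := clA _ (filterI n1 n2).
by exists (h1 s); split; [exact: Bs|rewrite h12].
Qed.

(** In a chart both c and f \o c solve [geo_eq], the latter by covariance, with the same position
    and velocity at t. *)
Lemma isometry_local f c (U : set R) t : riemannian_isometry f ->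
  geodesic U c -> open U -> U t -> f (c t) = c t ->
  derive1 (chart_at (c t) \o (f \o c)) t = derive1 (chart_at (c t) \o c) t ->
  \forall s \near t, f (c s) = c s.
Proof.
move=> fi gc Uo Ut fct vct; have cs := gc.1; have fs := isometry_smooth fi.
have fcs : smooth_curve U (f \o c) by exact: smooth_map_curve.
set phi := chart_at (c t) in vct; have aphi : atlas phi by exact: chart_at_atlas.
have pt : chart_dom phi (c t) by exact: chart_at_dom.
pose O := (U `&` c @^-1` chart_dom phi) `&` (f \o c) @^-1` chart_dom phi.
have Oo : open O.
  have O1 := open_preimage_on Uo (chart_open phi) (fun s sU => smooth_curve_continuous cs sU).
  exact: open_preimage_on O1 (chart_open phi) (fun s sU => smooth_curve_continuous fcs sU.1).
have Ot : O t by split; [split|rewrite /= fct].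
pose W := phi @` (chart_dom phi `&` f @^-1` chart_dom phi).
have Wo : open W by exact: map_chart_dom_open.
pose T := phi \o f \o chart_inv phi.
have T2 : Ck 2 W T by case: fs => _ /(_ _ _ aphi aphi) h; exact: h.
have Wimg : W `<=` chart_img phi by move=> _ [x [px _] <-]; exists x.
have Timg p : W p -> chart_img phi (T p).
  by move=> [x [px qx] <-]; exists (f x); rewrite // /T /= chart_funK.
have Gd p : chart_img phi p -> differentiable (gram phi) p.
  by move=> ip; exact: (smooth_on_differentiable (gram_smooth phi aphi) ip).
have chartc s : O s -> [/\ differentiable (phi \o c) s,
    {for s, continuous (derive1 (phi \o c))} & differentiable (derive1 (phi \o c)) s].
  by move=> [[Us ps] qs]; exact: smooth_curve_chart cs aphi Us ps.
have chartf s : O s -> [/\ differentiable (phi \o (f \o c)) s,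
    {for s, continuous (derive1 (phi \o (f \o c)))} &
    differentiable (derive1 (phi \o (f \o c))) s].
  by move=> [[Us ps] qs]; exact: (smooth_curve_chart fcs aphi Us qs).
have Wc s : O s -> W (phi (c s)) by move=> [[Us ps] qs]; exists (c s).
have nO s : O s -> \forall r \near s, O r by move=> Os; exact: open_nbhs_nbhs.
have geoc s : O s -> geo_eq (gram phi) (phi \o c) s.
  by move=> [[Us ps] qs]; exact: geodesic_geo_eq gc aphi Uo Us ps.
have eqT s : O s -> (phi \o (f \o c)) s = (T \o (phi \o c)) s.
  by move=> [[Us ps] qs]; rewrite /T /= chart_funK.
have geof s : O s -> geo_eq (gram phi) (phi \o (f \o c)) s.
  move=> Os; have [_ _ d2] := chartc s Os.
  have H : geo_eq (gram phi) (T \o (phi \o c)) s.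
    apply: (@geo_eq_covariant _ _ (gram phi) (gram phi) W (chart_img phi) T (phi \o c) O s) => //.
    - by move=> r Or; split; [exact: Wc|have [] := chartc r Or].
    - by move=> p /Wimg/Gd.
    - by move=> p Wp; apply: gram_sym => //; exact: Timg.
    - by move=> p u v Wp; exact: isometry_gram.
    - by move=> w; apply: isometry_onto => //; exact: Wc.
    - exact: geoc.
  have n0 : {near s, T \o (phi \o c) =1 phi \o (f \o c)}.
    by apply: filterS (nO s Os) => r Or; rewrite eqT.
  have n1 : {near s, derive1 (T \o (phi \o c)) =1 derive1 (phi \o (f \o c))}.
    apply: filterS (nO s Os) => r Or; rewrite !derive1E; apply: near_eq_derive.
    by apply: filterS (nO r Or) => q Oq; rewrite eqT.
  have e0 := nbhs_singleton n0; have e1 := nbhs_singleton n1.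
  have e2 : derive1 (derive1 (T \o (phi \o c))) s = derive1 (derive1 (phi \o (f \o c))) s.
    by rewrite !derive1E; apply: near_eq_derive; exact: n1.
  by move=> w; have := H w; rewrite e0 e1 e2.
have [r r0 rO] : exists2 r : R, 0 < r & forall s, `|s - t| < r -> O s.
  have /nbhs_ballP[r /= r0 rP] := nO t Ot; exists r => // s sr.
  by apply: rP; rewrite /ball /= distrC.
have d3 : {for t, continuous (derive1 (derive1 (phi \o c)))}.
  have Oc := open_preimage_on Uo (chart_open phi) (fun s sU => smooth_curve_continuous cs sU).
  have [_ /(_ 1) [_ /(_ 1)]] := cs.2 phi aphi 2%N.
  move=> /(_ t (conj Ut pt)) h.
  have -> : derive1 (derive1 (phi \o c)) = 'D_1 ('D_1 (phi \o c)).
    have e1 : derive1 (phi \o c) = 'D_1 (phi \o c) by apply/funext => s; rewrite derive1E.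
    by apply/funext => s; rewrite derive1E e1.
  exact: h.
have ioo : open (chart_img phi) by exact: chart_img_open.
have g2 : Ck 2 (chart_img phi) (gram phi) by exact: gram_smooth.
have ev := @geo_eq_unique _ _ (gram phi) (chart_img phi) (phi \o (f \o c)) (phi \o c) t r
  ioo g2.
have : \forall s \near t, (phi \o (f \o c)) s = (phi \o c) s.
  apply: ev.
  - by exists (f (c t)); rewrite // fct.
  - exact: r0.
  - by move=> w w0; apply: gram_pos => //; exists (f (c t)); rewrite // fct.
  - move=> s /rO Os; have [h1 h2 h3] := chartf s Os; split; [exact: h1|exact: h3|exact: geof|exact: h2|].
    by exists (f (c s)); [exact: Os.2|].
  - move=> s /rO Os; have [h1 h2 h3] := chartc s Os; split; [exact: h1|exact: h3|exact: geoc|exact: h2|].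
    by exists (c s); [exact: Os.1.2|].
  - exact: d3.
  - by rewrite /= fct.
  - exact: vct.
apply: filterS2 (nO t Ot) => s [[_ ps] qs] /= e.
have qs' : chart_dom phi (f (c s)) := qs.
by rewrite -(chart_funK qs') e chart_funK.
Qed.

(** The times around which f fixes c pointwise form an open set. It is also closed in the interval,
    because position and velocity still agree at a limit time, and [isometry_local] applies
    there. *)
Lemma isometry_geodesic f c (a b t : R) : riemannian_isometry f ->
  geodesic `]a, b[ c -> `]a, b[%classic t -> f (c t) = c t ->
  derive1 (chart_at (c t) \o (f \o c)) t = derive1 (chart_at (c t) \o c) t ->
  forall s, `]a, b[%classic s -> f (c s) = c s.
Proof.
move=> fi gc It fct vct; have cs := gc.1; have fs := isometry_smooth fi.
have Io : open `]a, b[%classic by exact: interval_open.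
have fcs : smooth_curve `]a, b[ (f \o c) by exact: smooth_map_curve.
pose A := [set s | `]a, b[%classic s /\ \forall r \near s, f (c r) = c r].
have IA : connected (`]a, b[%classic : set R) by apply/connected_intervalP; exact: interval_is_interval.
have Aeq s : A s -> f (c s) = c s by move=> [_ /nbhs_singleton].
suff AE : A = `]a, b[%classic.
  by move=> s Is; apply: Aeq; rewrite AE.
apply: IA.
- by exists t; split => //; exact: (isometry_local fi gc Io It fct vct).
- exists A; last by apply/seteqP; split=> s [] // Is.
  rewrite openE => s [Is /nbhs_interior ns]; apply: filterI.
    exact: open_nbhs_nbhs.
  exact: ns.
exists (closure A); first exact: closed_closure.
apply/seteqP; split=> [s As|s [Is clA]].
  by split; [case: As|exact: subset_closure].
have cc := smooth_curve_continuous cs Is; have fcc := smooth_curve_continuous fcs Is.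
have fcE : f (c s) = c s.
  apply: (@eq_at_closure _ (f \o c) c A s _ fcc cc clA Aeq).
  exact: manifold_hausdorff.
split => //; apply: (isometry_local fi gc Io Is fcE).
set phi := chart_at (c s); have aphi : atlas phi by exact: chart_at_atlas.
have ps : chart_dom phi (c s) by exact: chart_at_dom.
have qs : chart_dom phi ((f \o c) s) by rewrite /= fcE.
have [_ d1 _] := smooth_curve_chart cs aphi Is ps.
have [_ d2 _] := smooth_curve_chart fcs aphi Is qs.
apply: (@eq_at_closure _ _ _ A s _ d2 d1 clA); first exact: norm_hausdorff.
move=> r [Ir nr]; rewrite !derive1E; apply: near_eq_derive.
by apply: filterS nr => q /= ->.
Qed.

End Geodesics.

(** * Minimal segments in the orbit space *)

Section Branching.
Context {R : realType} {n : nat} {M : riemannianType R n}.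
Implicit Types (phi : chart R n M) (c : R -> M).

Lemma curve_expansion phi c (U : set R) t : atlas phi -> smooth_curve U c -> U t ->
  chart_dom phi (c t) -> forall e : R, 0 < e -> \forall h \near (0 : R),
    `|phi (c (t + h)) - phi (c t) - h *: derive1 (phi \o c) t| <= e * `|h|.
Proof.
move=> aphi cs Ut pt e e0; have [dc _ _] := smooth_curve_chart cs aphi Ut pt.
have := differentiable_approx dc e0.
rewrite [\forall y \near t, _](near_shift 0) subr0.
apply: filterS => h /=; rewrite /shift /= addrK (addrC h t).
have -> : 'd (phi \o c) t h = h *: derive1 (phi \o c) t.
  by rewrite -(diff_curve dc) -linearZ /= [h *: 1]mulr1.
exact.
Qed.

Lemma shift_continuous c t : {for t, continuous c} ->
  {for 0, continuous (fun h : R => c (t + h))}.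
Proof.
move=> cc; apply: (@continuous_comp _ _ _ (fun h : R => t + h)).
  by apply: cvgD; [exact: cvg_cst|exact: cvg_id].
by rewrite /= addr0.
Qed.

Lemma reverse_continuous c t : {for t, continuous c} ->
  {for 0, continuous (fun h : R => c (t - h))}.
Proof.
move=> cc; apply: (@continuous_comp _ _ _ (fun h : R => t - h)).
  by apply: cvgB; [exact: cvg_cst|exact: cvg_id].
by rewrite /= subr0.
Qed.

Lemma curve_expansion_rev phi c (U : set R) t : atlas phi -> smooth_curve U c -> U t ->
  chart_dom phi (c t) -> forall e : R, 0 < e -> \forall h \near (0 : R),
    `|phi (c (t - h)) - phi (c t) - h *: - derive1 (phi \o c) t| <= e * `|h|.
Proof.
move=> aphi cs Ut pt e e0; have := curve_expansion aphi cs Ut pt e0.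
move=> /nbhs_ballP[r /= r0 H]; apply/nbhs_ballP; exists r => // h hr.
have /H : ball (0 : R) r (- h) by move: hr; rewrite /ball /= !sub0r !normrN.
by rewrite normrN scalerN scaleNr.
Qed.

End Branching.

(** * Lifts of minimal segments and stabilizers *)

Section MinimalSegments.
Context {R : realType} {n k : nat} {M : riemannianType R n}
  {G : lieGroupType R k} {act : G -> M -> M}.
Hypothesis GM : complete_riemannian_G_manifold act.
Variables (sigma : R -> orbit_space act) (gamma : R -> M) (a b : R)
  (p q : orbit_space act).
Hypothesis smin : minimal_geodesic_segment sigma a b p q.
Hypothesis lift : horizontal_lift gamma sigma a b.

Let D s t := set_dist (Gorbit act (gamma s)) (Gorbit act (gamma t)).

Lemma sigma_orbit t : t \in `[a, b] -> sval (sigma t) = Gorbit act (gamma t).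
Proof. by case: lift => _ _ h /h <-. Qed.

Lemma lift_broken s t : a <= s -> s < t -> t <= b -> broken gamma s t.
Proof.
move=> as_ st tb; case: lift => -[e e0 [gs _]] _ _.
apply: broken_one => //; exists gamma, e; split => //.
apply: smooth_curve_subset gs => r /=; rewrite !in_itv /= => /andP[r1 r2].
by apply/andP; split; lra.
Qed.

Lemma lift_joined s t : a <= s -> s < t -> t <= b ->
  joined (Gorbit act (gamma s)) (Gorbit act (gamma t)).
Proof.
move=> as_ st tb; exists gamma, s, t; split; first exact: lift_broken.
  exact: Gorbit_refl.
exact: Gorbit_refl.
Qed.

(** The polygon through a, s, t, u, b is no longer than sigma, that is, than D a b; two triangle
    inequalities remove its outer sides. *)
Lemma dist_additive s t u : a < s -> s < t -> t < u -> u < b -> D s t + D t u <= D s u.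
Proof.
move=> as_ st tu ub; case: smin => ab _ sa sb len.
have [sI tI uI] : [/\ s \in `[a, b], t \in `[a, b] & u \in `[a, b]].
  by rewrite !in_itv /=; split; apply/andP; split; lra.
have aI : a \in `[a, b] by rewrite in_itv /= lexx ltW.
have bI : b \in `[a, b] by rewrite in_itv /= lexx ltW.
have part : itv_partition a b [:: s; t; u; b].
  by rewrite /itv_partition /= as_ st tu ub.
have le1 : D a s + D s t + D t u + D u b <= D a b.
  have : ((\sum_(0 <= i < size [:: s; t; u; b])
      orbit_dist (sigma (nth b (a :: [:: s; t; u; b]) i))
                 (sigma (nth b (a :: [:: s; t; u; b]) i.+1)))%R%:E <= orbit_length sigma a b)%E.
    by apply: ereal_sup_ubound; exists [:: s; t; u; b].
  rewrite len lee_fin /= !big_nat_recl//= big_nil addr0.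
  rewrite -sa -sb /orbit_dist !sigma_orbit//.
  by rewrite !addrA.
have j := lift_joined.
have t1 : D a b <= D a u + D u b.
  by apply: (orbit_triangle GM); apply: j; rewrite ?lexx//; lra.
have t2 : D a u <= D a s + D s u.
  by apply: (orbit_triangle GM); apply: j; rewrite ?lexx//; lra.
lra.
Qed.

Lemma stabilizer_fixes_lift t g : a < t -> t < b -> act g (gamma t) = gamma t ->
  forall s, s \in `[a, b] -> act g (gamma s) = gamma s.
Proof.
move=> at_ tb gx; case: lift => -[e e0 gg] nrm _.
have gs := gg.1; set I := `]a - e, b + e[%classic in gs.
have Io : open I by exact: interval_open.
have It : I t by rewrite /I /= in_itv /=; apply/andP; split; lra.
have tab : t \in `[a, b] by rewrite in_itv /= !ltW.
set x := gamma t; pose phi := chart_at x.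
have aphi : atlas phi by exact: chart_at_atlas.
have px : chart_dom phi (gamma t) by exact: chart_at_dom.
have fi := act_isometry GM g; have fs := isometry_smooth fi.
have fgs : smooth_curve I (act g \o gamma) by exact: smooth_map_curve.
have pfx : chart_dom phi ((act g \o gamma) t) by rewrite /= gx.
pose v := derive1 (phi \o gamma) t.
pose v' := derive1 (phi \o (act g \o gamma)) t.
have gc := smooth_curve_continuous gs It; have fgc := smooth_curve_continuous fgs It.
have vn u : tangent_to (Gorbit act x) x u -> inner x v u = 0 by exact: nrm.
have tm : v' = tangent_map (act g) x v.
  have [dg _ _] := smooth_curve_chart gs aphi It px.
  have qx : chart_dom (chart_at (act g x)) (act g (gamma t)) by exact: chart_at_dom.
  have [_ E] := curve_map fs aphi (chart_at_atlas (act g x)) gc px qx dg.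
  by rewrite /v' /tangent_map -/phi -E gx.
pose Gi := (g^-1)%g.
have gix : act Gi x = x by rewrite -[RHS](actK GM g) gx.
(* g^-1 fixes x and permutes the curves in the orbit of x *)
have surj u : tangent_to (Gorbit act x) x u ->
    exists2 u0, tangent_to (Gorbit act x) x u0 & u = tangent_map (act g) x u0.
  case=> c [r [r0 cs cO c0 uE]].
  have fis := isometry_smooth (act_isometry GM Gi).
  have c's : smooth_curve `]- r, r[ (act Gi \o c) by apply: smooth_map_curve.
  have c'0 : (act Gi \o c) 0 = x by rewrite /= c0.
  exists (velocity (act Gi \o c) 0).
    exists (act Gi \o c), r; split=> //.
    by move=> s /cO [h _ hx]; rewrite /= -hx -(actM GM); exists (Gi * h)%g.
  have I0 : `]- r, r[%classic 0 by rewrite /= in_itv /= oppr_lt0 r0.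
  have p0 : chart_dom phi ((act Gi \o c) 0) by rewrite c'0.
  have [dc _ _] := smooth_curve_chart c's aphi I0 p0.
  have q0 : chart_dom (chart_at (act g x)) (act g ((act Gi \o c) 0)).
    by rewrite c'0; exact: chart_at_dom.
  have [_ E] := curve_map fs aphi (chart_at_atlas (act g x))
    (smooth_curve_continuous c's I0) p0 q0 dc.
  have cE : act g \o (act Gi \o c) = c.
    by apply/funext => s; rewrite /= (actVK GM).
  move: E; rewrite cE c'0 -/phi => E.
  by rewrite /velocity c'0 -/phi uE /velocity c0 -/phi /tangent_map -E gx.
have v'n u : tangent_to (Gorbit act x) x u -> inner x v' u = 0.
  move=> /surj[u0 u0O ->]; rewrite tm; have [_ _ iso] := fi.
  by have := iso x v u0; rewrite gx => ->; exact: vn.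
have vNn u : tangent_to (Gorbit act x) x u -> inner x (- v) u = 0.
  by move=> /vn; rewrite /inner bilinNl => ->; rewrite oppr0.
have vv' : bilin (gram phi (phi x)) (- v) (- v) = bilin (gram phi (phi x)) v' v'.
  rewrite bilinNl bilinNr opprK tm; have [_ _ iso] := fi.
  by have := iso x v v; rewrite gx /inner -/phi => ->.
(* Bending the second half of the lift by g leaves its image in the orbit space unchanged, so
   additivity of distances persists. *)
have OgE y : Gorbit act (act g y) = Gorbit act y.
  apply/seteqP; split => z [h _ <-].
    by rewrite -(actM GM); exists (h * g)%g.
  by exists (h * Gi)%g => //; rewrite (actM GM) (actK GM).
have near_dist : \forall h \near (0 : R)^'+,
    [/\ joined (Gorbit act (gamma (t - h))) (Gorbit act x),
        joined (Gorbit act x) (Gorbit act (act g (gamma (t + h)))) &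
        set_dist (Gorbit act (gamma (t - h))) (Gorbit act x) +
        set_dist (Gorbit act x) (Gorbit act (act g (gamma (t + h)))) <=
        set_dist (Gorbit act (gamma (t - h))) (Gorbit act (act g (gamma (t + h))))].
  have m0 : 0 < Num.min (t - a) (b - t) by rewrite lt_min !subr_gt0 at_ tb.
  near=> h; have h0 : 0 < h by near: h; exact: nbhs_right_gt.
  have : h < Num.min (t - a) (b - t) by near: h; exact: nbhs_right_lt.
  rewrite lt_min => /andP[h1 h2]; rewrite OgE; split.
  - by apply: lift_joined; lra.
  - by apply: lift_joined; lra.
  - by apply: dist_additive; lra.
have NN : - v = - v'.
  (* The first branch is run backwards from x, whence the velocity - v. *)
  apply: (no_corner GM vNn v'n (w1 := fun h => gamma (t - h))
    (w2 := fun h => act g (gamma (t + h)))).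
  - exact: reverse_continuous.
  - exact: (shift_continuous fgc).
  - by rewrite subr0.
  - by rewrite addr0.
  - exact: (curve_expansion_rev aphi gs It px).
  - move=> r r0; have := curve_expansion aphi fgs It pfx r0.
    by rewrite /= gx.
  - exact: near_dist.
  - exact: vv'.
(* Applied on the enlarged open interval, so that the end points a and b are covered. *)
move=> s sab; apply: (isometry_geodesic fi gg It gx); last exact: mem_widen.
exact/esym/oppr_inj.
Unshelve. all: by end_near.
Qed.

End MinimalSegments.

Theorem lemma3p5 (R : realType) (n k : nat) (M : riemannianType R n)
    (G : lieGroupType R k) (act : G -> M -> M)
    (GM : complete_riemannian_G_manifold act)
    (pbar qbar : orbit_space act) (d a b : R)
    (sigma : R -> orbit_space act)
    (sigma_min : minimal_geodesic_segment sigma a b pbar qbar)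
    (sigma_length : orbit_length sigma a b = d%:E)
    (gamma : R -> M) (gamma_lift : horizontal_lift gamma sigma a b)
    (p q : M) (gamma_a : gamma a = p) (gamma_b : gamma b = q)
    (p_pbar : orbit_proj act p = pbar) (q_qbar : orbit_proj act q = qbar)
    (x : M) (x_interior : exists2 t : R, a < t < b & gamma t = x) :
  stabilizer act x `<=` stabilizer act p /\
  stabilizer act x `<=` stabilizer act q.
Proof.
case: x_interior => t /andP[a_t t_b] gx; have ab := lt_trans a_t t_b.
have fixes g : stabilizer act x g -> forall s, s \in `[a, b] -> act g (gamma s) = gamma s.
  by rewrite /stabilizer /= -gx; exact: stabilizer_fixes_lift sigma_min gamma_lift _ _ a_t t_b.
split=> g /fixes h; rewrite /stabilizer /=.
  by rewrite -gamma_a; apply: h; rewrite in_itv /= lexx ltW.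
by rewrite -gamma_b; apply: h; rewrite in_itv /= lexx ltW.
Qed.
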